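(* In the STAR-RIS connected-UE model below, assume $a_c>a_t\tau_c$ and put $\tau_c^*=\frac{\tau_c}{a_c-a_t\tau_c}$. Then the coverage probability $P_{c,STAR}=\mathbb P(\gamma_c>\tau_c)$ equals $$P_{c,STAR}=\sum_{\chi\in\{\mathrm T,\mathrm R\}}\int_0^\infty\pi\lambda_Br_1\sum_{m=0}^{k-1}\frac{(-1)^m}{m!}\,e^{\Lambda_\chi(1)}\,\mathcal B_m\!\big(\Lambda_\chi'(1),\dots,\Lambda_\chi^{(m)}(1)\big)\,dr_1,$$ where for fixed $r_1$ and $x>0$ $$\Lambda_\chi(x)=-s_{c,\chi}n_0^2x-\tfrac12\pi\lambda_Br_1^2F(D^c_{\mathrm T\chi}x)-\tfrac12\pi\lambda_Br_1^2F(D^c_{\mathrm R\chi}x),$$ $s_{c,\chi}=\frac{\tau_c^*(r_1d_c)^\alpha}{\theta_r\beta_\chi P_BC_r}$, $D^c_{\psi\chi}=\frac{\theta_I\tau_c^*\beta_\psi}{\theta_r\beta_\chi}$ for $\psi\in\{\mathrm T,\mathrm R\}$, and $\Lambda_\chi^{(i)}$ is the $i$-th derivative in $x$.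
   Context: STAR-RIS connected-UE model. Constants: $\lambda_B,P_B,C_r,\theta_r,\theta_I>0$, $d_c>0$ (fixed STAR-RIS–connected-UE distance), noise power $n_0^2\ge0$, $\alpha>2$, integer $k\ge1$, $\beta_{\mathrm T}\in(0,1)$, $\beta_{\mathrm R}=1-\beta_{\mathrm T}$, $0<a_t<a_c$ with $a_t+a_c=1$, threshold $\tau_c>0$. Random elements, mutually independent unless stated: $r_1$ with density $2\pi\lambda_Br e^{-\pi\lambda_Br^2}$; $\chi$ uniform on $\{\mathrm T,\mathrm R\}$ (the mode, transmission or reflection, through which the connected UE receives its serving signal); $G\sim\Gamma(k,\theta_r)$ (shape $k$, scale $\theta_r$); conditionally on $r_1$, independent Poisson point processes $\Phi^{\mathrm T},\Phi^{\mathrm R}$ on $\{y\in\mathbb R^2:\|y\|>r_1\}$, each of intensity $\lambda_B/2$, with i.i.d. exponential marks $g_y$ of mean $\theta_I$. Set $S_c=\beta_\chi P_BC_r(r_1d_c)^{-\alpha}G$, $I_c=\sum_{y\in\Phi^{\mathrm T}}\beta_{\mathrm R}P_BC_r(\|y\|d_c)^{-\alpha}g_y+\sum_{y\in\Phi^{\mathrm R}}\beta_{\mathrm T}P_BC_r(\|y\|d_c)^{-\alpha}g_y$, and $\gamma_c=\frac{a_cS_c}{a_tS_c+I_c+n_0^2}$. Let $\delta=2/\alpha$ and $F(y)={}_2F_1(1,-\delta;1-\delta;-y)=1+\int_1^\infty\frac{2yt}{t^\alpha+y}dt$ for $y\ge0$. $\mathcal B_m$ is the $m$-th complete Bell polynomial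 ($\mathcal B_0=1$). *)

(* Defs.v *)
From HB Require Import structures.
From mathcomp Require Import all_boot all_order all_algebra.
From mathcomp Require Import all_classical all_reals all_analysis.
From mathcomp Require Import measurable_realfun.
Set Implicit Arguments. Unset Strict Implicit. Unset Printing Implicit Defensive.
Import Order.TTheory GRing.Theory Num.Theory.
Import numFieldNormedType.Exports.
Local Open Scope classical_set_scope.
Local Open Scope ring_scope.

Section StarRIS.
Variable R : realType.

(* Points of the plane are pairs; marked points are (point, mark). *)
Definition norm2 (p : R * R) : R := Num.sqrt (p.1 ^+ 2 + p.2 ^+ 2).

Definition leb2 := ((@lebesgue_measure R) \x (@lebesgue_measure R))%E.
Definition leb3 := (leb2 \x (@lebesgue_measure R))%E.

(* Poisson probability mass function with mean m >= 0 (correct also for m = 0). *)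
Definition pois_pmf (m : R) (n : nat) : R := m ^+ n / n`!%:R * expR (- m).

Definition exp_pdf (th x : R) : R := if 0 <= x then th^-1 * expR (- (x / th)) else 0.

Definition gamma_pdf (k : nat) (th x : R) : R :=
  if 0 <= x then x ^+ k.-1 * expR (- (x / th)) / ((k.-1)`!%:R * th ^+ k) else 0.

Definition r1_pdf (lam r : R) : R :=
  if 0 <= r then 2 * pi * lam * r * expR (- (pi * lam * r ^+ 2)) else 0.

(* Mean measure, conditionally on r1 = r, of a PPP of intensity lam/2 on
   {y : ||y|| > r} with i.i.d. exponential marks of mean thI, viewed as a
   Poisson process on R^2 x R. *)
Definition ppp_mean (lam thI r : R) (B : set ((R * R) * R)) : \bar R :=
  (\int[leb3]_(p in B)
     ((lam / 2) * (if r < norm2 p.1 then 1 else 0) * exp_pdf thI p.2)%:E)%E.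

Definition bounded_ground (B : set ((R * R) * R)) : Prop :=
  exists M : R, forall p, B p -> norm2 p.1 <= M.

(* F(y) = 2F1(1,-delta;1-delta;-y) = 1 + int_1^oo 2yt/(t^alpha + y) dt. *)
Definition Fhyp (alpha y : R) : R :=
  1 + fine (\int[@lebesgue_measure R]_(t in `[1%R, +oo[%classic)
              ((2 * y * t) / (t `^ alpha + y))%:E)%E.

(* Complete Bell polynomial B_m(x_1, ..., x_m) (explicit formula); the
   argument x is indexed from 1 (x 0 is unused). *)
Definition bell (x : nat -> R) (m : nat) : R :=
  \sum_(j : {ffun 'I_m -> 'I_m.+1} | (\sum_(i < m) i.+1 * j i)%N == m)
     (m`!%:R / \prod_(i < m) ((j i)`!%:R * (i.+1)`!%:R ^+ j i))
     * \prod_(i < m) x i.+1 ^+ j i.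

(* The model: power splitting coefficient of mode chi (true = T, false = R). *)
Definition beta_of (betaT : R) (chi : bool) : R := if chi then betaT else 1 - betaT.

Definition Lambda (lam PB Cr thr thI dc n0sq alpha betaT a_c a_t tau : R)
    (chi : bool) (r x : R) : R :=
  let taus := tau / (a_c - a_t * tau) in
  let s := taus * (r * dc) `^ alpha / (thr * beta_of betaT chi * PB * Cr) in
  let D psi := thI * taus * beta_of betaT psi / (thr * beta_of betaT chi) in
  - (s * n0sq * x)
  - 2^-1 * pi * lam * r ^+ 2 * Fhyp alpha (D true * x)
  - 2^-1 * pi * lam * r ^+ 2 * Fhyp alpha (D false * x).

End StarRIS.

(* Main.v *)
Require Import Defs.
From HB Require Import structures.
From mathcomp Require Import all_boot all_order all_algebra.
From mathcomp Require Import all_classical all_reals all_analysis.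
From mathcomp Require Import measurable_realfun ring lra.
Import Order.TTheory GRing.Theory Num.Theory.
Import numFieldNormedType.Exports.
Local Open Scope classical_set_scope.
Local Open Scope ring_scope.

Set Implicit Arguments. Unset Strict Implicit. Unset Printing Implicit Defensive.

(** Given [r1 = r] and [chi = c], the coverage event reads [G > thr * L] with the load
    [L = s_c(r) (I + n0^2)].  Since the Gamma survival function is a finite sum of Poisson
    probabilities, the coverage probability is the sum over [m < k] of
    [q_m = E (exp (- L) L^m / m!)].  The [q_m] are the coefficients of the generating function
    [sum_m q_m z^m = E (exp (- (1 - z) L))], a Laplace transform which Campbell's formula
    evaluates to the integral of [pi lam r exp (Lambda_c r (1 - z))].  Expanding
    [exp (Lambda_c r (1 - z))] in powers of [z] with complete Bell polynomials gives a second
    power series for the same function, also with nonnegative coefficients, so that monotone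
    convergence allows the integration term by term and the coefficients must agree.

    The law of the point processes is only given through counts of disjoint bounded sets, so
    the tail and the Laplace transform are first computed for simple approximations of the
    path gain, and then passed to the limit. *)

(** Two obstacles shape the argument. Differentiating the Laplace transform m times under the
    expectation would call for a domination argument at every order. With nonnegative coefficients
    on both sides no derivative crosses an integral, and the finiteness of each coefficient follows
    from that of the generating function. The nonnegativity comes from F itself: under the integral
    sign, F(D) - F(D (1 - z)) is a geometric series in z with nonnegative terms, so Lambda(1 - z) -
    Lambda(1) has nonnegative coefficients and so has its exponential. The processes are arbitrary
    random measures constrained only by the law of their counts. That counts are finite integers,
    that marks are nonnegative and that the interference is finite holds only off null events, which
    have to be extracted: the total mass of finite integer counts is read off at Laplace argument 0,
    negative marks have mean measure 0, and letting the Laplace argument decrease to 0 shows that an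
    infinite load has probability 0. Until then loads are extended reals, functions of them take the
    value 0 at infinity, and negative marks are truncated. *)

(** * Complete Bell polynomials as coefficients of an exponential *)

Section BellSeries.
Variable R : realType.
Implicit Types (b : nat -> R) (p q : {poly R}).

(** The coefficient of z^m in exp(sum_(i >= 1) b_i z^i): the exponent has i-th derivative i! b_i at
    0. *)
Definition bell_coef b (m : nat) : R := bell (fun i => i`!%:R * b i) m / m`!%:R.

(** The exponential series of b_(i+1) X^(i+1), cut after its N-th power. Finite products of such
    polynomials replace the exponential of an infinite series by coefficient arithmetic. *)
Let pexp b N (i : nat) : {poly R} :=
  \sum_(j < N.+1) (b i.+1 ^+ j / j`!%:R) *: 'X^(i.+1 * j).

Let bpoly b n N : {poly R} := \prod_(0 <= i < n) pexp b N i.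

Lemma bell_coefE b m : bell_coef b m =
  \sum_(j : {ffun 'I_m -> 'I_m.+1} | (\sum_(i < m) i.+1 * j i)%N == m)
     \prod_(i < m) (b i.+1 ^+ j i / (j i)`!%:R).
Proof.
rewrite /bell_coef /bell mulr_suml; apply: eq_bigr => j _.
have m0 : (m`!%:R : R) != 0 by rewrite pnatr_eq0 -lt0n fact_gt0.
rewrite mulrAC (mulrAC m`!%:R) divff// mul1r -prodfV -big_split/=.
apply: eq_bigr => i _.
have f0 n : (n`!%:R : R) != 0 by rewrite pnatr_eq0 -lt0n fact_gt0.
rewrite exprMn invfM -mulrA (mulrA (_ ^- _)) mulVf ?mul1r 1?mulrC//.
Qed.

Lemma bell_coef_ge0 b m : (forall i, 0 <= b i) -> 0 <= bell_coef b m.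
Proof.
move=> b0; rewrite bell_coefE; apply: sumr_ge0 => j _; apply: prodr_ge0 => i _.
by rewrite divr_ge0 ?exprn_ge0.
Qed.

(** Each product carries the sign (-1)^(sum i j_i); the index constraint makes this sum equal to m,
    so the prefactor cancels it. *)
Lemma bell_alternating b m :
  (-1) ^+ m / m`!%:R * bell (fun i => (-1) ^+ i * (i`!%:R * b i)) m = bell_coef b m.
Proof.
rewrite /bell_coef /bell mulrAC mulr_sumr; congr (_ / _); apply: eq_bigr => j /eqP jm.
rewrite mulrCA; congr (_ * _).
under [in LHS]eq_bigr do rewrite exprMn.
rewrite big_split/= mulrA -[RHS]mul1r; congr (_ * _).
under eq_bigr do rewrite -exprM.
by rewrite -(big_morph _ (exprD (-1 : R)) (expr0 _)) jm -expr2 sqrr_sign.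
Qed.

(** Expanding the product chooses an exponent j_i <= m in each of m factors, which is exactly the
    index set of [bell]; hence the diagonal choice n = N = m. *)
Let coef_bpoly_diag b m : (bpoly b m m)`_m = bell_coef b m.
Proof.
rewrite /bpoly big_mkord bigA_distr_bigA/= coef_sum bell_coefE [RHS]big_mkcond/=.
apply: eq_bigr => j _.
transitivity (((\prod_(i < m) (b i.+1 ^+ j i / (j i)`!%:R)) *:
   'X^(\sum_(i < m) i.+1 * j i)%N : {poly R})`_m).
  congr (_`_m); rewrite scaler_prod.
  by rewrite (big_morph _ (exprD ('X : {poly R})) (expr0 _)).
by rewrite coefZ coefXn eq_sym; case: ifP => _; rewrite ?mulr1// mulr0.
Qed.

(** Congruence modulo X^(m+1). *)
Let eqm m p q := forall i, (i <= m)%N -> p`_i = q`_i.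

Let eqm_mul m p p' q q' : eqm m p p' -> eqm m q q' -> eqm m (p * q) (p' * q').
Proof.
move=> pp qq i im; rewrite !coefM; apply: eq_bigr => j _.
rewrite pp ?qq//; first by rewrite (leq_trans (leq_subr _ _)).
by rewrite (leq_trans _ im)// -ltnS.
Qed.

Let eqm_prod m (I : Type) (s : seq I) (f g : I -> {poly R}) :
  (forall i, eqm m (f i) (g i)) -> eqm m (\prod_(i <- s) f i) (\prod_(i <- s) g i).
Proof.
move=> fg; elim: s => [|x s ih]; first by rewrite !big_nil.
by rewrite !big_cons; apply: eqm_mul.
Qed.

Let coef_pexp b N i l :
  (pexp b N i)`_l = \sum_(0 <= j < N.+1) b i.+1 ^+ j / j`!%:R * (l == (i.+1 * j)%N)%:R.
Proof.
by rewrite /pexp coef_sum big_mkord; apply: eq_bigr => j _; rewrite coefZ coefXn.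
Qed.

Let eqm_pexp b m N i : (m <= N)%N -> eqm m (pexp b N i) (pexp b m i).
Proof.
move=> mN l lm; rewrite !coef_pexp (@big_cat_nat _ _ _ m.+1)//= ?ltnS//.
rewrite [X in _ + X]big_nat [X in _ + X]big1 ?addr0// => j /andP[mj _].
rewrite (_ : (_ == _) = false) ?mulr0//; apply/negbTE; rewrite neq_ltn.
by rewrite (leq_ltn_trans lm)// (leq_trans mj)// leq_pmull.
Qed.

Let eqm_pexp1 b m N i : (m <= i)%N -> eqm m (pexp b N i) 1.
Proof.
move=> mi l lm; rewrite coef_pexp big_nat_recl// muln0 expr0 fact0 divr1 mul1r.
rewrite coef1 big_nat big1 ?addr0// => j _.
rewrite (_ : (_ == _) = false) ?mulr0//; apply/negbTE; rewrite neq_ltn.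
by rewrite (leq_ltn_trans lm)// (leq_ltn_trans mi)// mulnS leq_addr.
Qed.

(** The coefficients stabilise: a factor of index i >= m is 1 modulo X^(m+1), and so are terms of
    exponent j > m negligible, their degree being at least j. *)
Let coef_bpoly b m n N : (m <= n)%N -> (m <= N)%N -> (bpoly b n N)`_m = bell_coef b m.
Proof.
move=> mn mN; rewrite -coef_bpoly_diag /bpoly.
rewrite (@big_cat_nat _ _ _ m)//= -[\prod_(0 <= i < m) pexp b m i]mulr1.
suff: eqm m (\prod_(0 <= i < m) pexp b N i * \prod_(m <= i < n) pexp b N i)
            (\prod_(0 <= i < m) pexp b m i * 1) by apply.
apply: eqm_mul; first by apply: eqm_prod => i; apply: eqm_pexp.
rewrite big_nat big_mkcond/= [X in eqm _ _ X](_ : 1 = \prod_(i <- index_iota m n) 1); last by rewrite big1.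
by apply: eqm_prod => i; case: ifP => // /andP[mi _]; apply: eqm_pexp1.
Qed.

(** The bound 0 belongs to the order, because multiplication is monotone only on nonnegative
    coefficients. *)
Let lep p q := forall i, 0 <= p`_i <= q`_i.

Let lep_mul p p' q q' : lep p p' -> lep q q' -> lep (p * q) (p' * q').
Proof.
move=> pp qq i; rewrite !coefM; apply/andP; split.
  by apply: sumr_ge0 => j _; case/andP: (pp j) (qq (i - j)%N) => ? _ /andP[? _]; rewrite mulr_ge0.
apply: ler_sum => j _; case/andP: (pp j) (qq (i - j)%N) => ? ? /andP[? ?].
by rewrite ler_pM.
Qed.

Let lep_prod (I : Type) (s : seq I) (f g : I -> {poly R}) :
  (forall i, lep (f i) (g i)) -> lep (\prod_(i <- s) f i) (\prod_(i <- s) g i).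
Proof.
move=> fg; elim: s => [|x s ih]; last by rewrite !big_cons; apply: lep_mul.
by rewrite !big_nil => i; rewrite coef1 ler0n/=.
Qed.

Section nonneg.
Variable b : nat -> R.
Hypothesis b0 : forall i, 0 <= b i.

Let term_ge0 i j (l m : nat) : 0 <= b i ^+ j / j`!%:R * (l == m)%:R.
Proof. by rewrite mulr_ge0 ?divr_ge0 ?exprn_ge0. Qed.

Let lep_pexp N N' i : (N <= N')%N -> lep (pexp b N i) (pexp b N' i).
Proof.
move=> NN l; rewrite !coef_pexp; apply/andP; split.
  by apply: sumr_ge0 => j _; exact: term_ge0.
rewrite [leRHS](@big_cat_nat _ _ _ N.+1)//= ?ltnS// lerDl.
by apply: sumr_ge0 => j _; exact: term_ge0.
Qed.

Let lep1_pexp N i : lep 1 (pexp b N i).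
Proof.
move=> l; rewrite coef_pexp coef1 ler0n/=.
rewrite big_nat_recl// muln0 expr0 fact0 divr1 mul1r lerDl.
by apply: sumr_ge0 => j _; exact: term_ge0.
Qed.

Let coef_bpoly_le m n N : 0 <= (bpoly b n N)`_m <= bell_coef b m.
Proof.
set K := maxn m (maxn n N).
have mK : (m <= K)%N by rewrite leq_maxl.
have nK : (n <= K)%N by rewrite /K maxnC -maxnA leq_maxl.
have NK : (N <= K)%N by rewrite /K maxnC maxnAC leq_maxr.
rewrite -(@coef_bpoly b m K K)//.
rewrite [bpoly b K K](@big_cat_nat _ _ _ n)//= -[bpoly b n N]mulr1.
apply: lep_mul; first by apply: lep_prod => i; apply: lep_pexp.
rewrite [X in lep X _](_ : 1 = \prod_(i <- index_iota n K) 1); last by rewrite big1.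
by apply: lep_prod => i; apply: lep1_pexp.
Qed.

Variables (z B : R).
Hypothesis z0 : 0 <= z.
Hypothesis bB : series (fun i => b i.+1 * z ^+ i.+1) @ \oo --> B.

Let s n := \sum_(0 <= i < n) b i.+1 * z ^+ i.+1.

Let horner_pexp N i :
  (pexp b N i).[z] = series (exp_coeff (b i.+1 * z ^+ i.+1)) N.+1.
Proof.
rewrite /pexp horner_sum /series/= big_mkord; apply: eq_bigr => j _.
by rewrite hornerZ hornerXn /exp_coeff/= exprMn -exprM mulrAC.
Qed.

Let horner_pexp_le N i : 0 <= (pexp b N i).[z] <= expR (b i.+1 * z ^+ i.+1).
Proof.
have t0 : 0 <= b i.+1 * z ^+ i.+1 by rewrite mulr_ge0 ?exprn_ge0.
rewrite horner_pexp; apply/andP; split.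
  by rewrite /series/=; apply: sumr_ge0 => j _; exact: exp_coeff_ge0.
apply: nondecreasing_cvgn_le; last exact: is_cvg_series_exp_coeff.
apply/nondecreasing_seqP => n; rewrite /series/= big_nat_recr//= lerDl.
exact: exp_coeff_ge0.
Qed.

Let s_le n : s n <= B.
Proof.
have nd : nondecreasing_seq s.
  by apply/nondecreasing_seqP => m; rewrite /s big_nat_recr//= lerDl mulr_ge0// exprn_ge0.
have cs : cvgn s by apply/cvg_ex; exists B.
by rewrite -(cvg_lim _ bB)//; exact: (nondecreasing_cvgn_le nd cs).
Qed.

(** A squeeze by truncated products. They dominate the partial sums and stay below exp B; conversely
    the exponential of a partial sum of B is a limit of truncated products, each of which is a
    polynomial dominated by the full series. *)
Lemma bell_coef_series : series (fun m => bell_coef b m * z ^+ m) @ \oo --> expR B.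
Proof.
set u := series _.
have undec : nondecreasing_seq u.
  apply/nondecreasing_seqP => n; rewrite /u /series/= big_nat_recr//= lerDl.
  by rewrite mulr_ge0 ?bell_coef_ge0 ?exprn_ge0.
have prodE n : \prod_(0 <= i < n) expR (b i.+1 * z ^+ i.+1) = expR (s n).
  by rewrite -(big_morph expR (@expRD R) (@expR0 R)).
have ule n : u n <= expR B.
  (* Below degree n the diagonal truncation has exactly the coefficients [bell_coef]; its higher
     terms only add. *)
  apply: (@le_trans _ _ (bpoly b n n).[z]).
    rewrite /u /series/=.
    under eq_big_nat => i /andP[_ im].
      rewrite -(@coef_bpoly b i n n) ?(ltnW im)//.
      over.
    rewrite (horner_coef_wide z (leq_maxr n (size (bpoly b n n)))).
    rewrite -(big_mkord xpredT (fun i => (bpoly b n n)`_i * z ^+ i)).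
    rewrite [leRHS](@big_cat_nat _ _ _ n)//= ?leq_maxl// lerDl sumr_ge0// => i _.
    by case/andP: (coef_bpoly_le i n n) => ? _; rewrite mulr_ge0 ?exprn_ge0.
  rewrite /bpoly horner_prod (le_trans _ (_ : expR (s n) <= _)) ?ler_expR ?s_le//.
  by rewrite -prodE; apply: ler_prod => i _; exact: horner_pexp_le.
have cu : cvgn u by apply: nondecreasing_is_cvgn => //; exists (expR B) => _ [n _ <-].
suff eL : limn u = expR B by rewrite -eL.
apply/eqP; rewrite eq_le limr_le//=; last by apply: nearW.
have ge_s n : expR (s n) <= limn u.
  have cN : (fun N => (bpoly b n N).[z]) @ \oo --> expR (s n).
    rewrite -prodE (_ : (fun N => _) = (fun N => \prod_(0 <= i < n) (pexp b N i).[z])); last first.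
      by apply/funext => N; rewrite horner_prod.
    elim: n => [|n ih].
      rewrite (_ : (fun N => _) = cst 1); last by apply/funext => N; rewrite big_geq.
      by rewrite big_geq//; exact: cvg_cst.
    rewrite (_ : (fun N => _) = (fun N => \prod_(0 <= i < n) (pexp b N i).[z])
        \* (fun N => series (exp_coeff (b n.+1 * z ^+ n.+1)) (N + 1)%N)); last first.
      by apply/funext => N /=; rewrite big_nat_recr//= horner_pexp addn1.
    rewrite big_nat_recr//=; apply: cvgM => //.
    by rewrite cvg_shiftn; exact: is_cvg_series_exp_coeff.
  rewrite -(cvg_lim _ cN)//; apply: limr_le; first by apply/cvg_ex; eexists; exact: cN.
  apply: nearW => N; apply: (@le_trans _ _ (u (size (bpoly b n N)))); last first.
    exact: nondecreasing_cvgn_le.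
  rewrite horner_coef /u /series/= big_mkord; apply: ler_sum => i _.
  by case/andP: (coef_bpoly_le i n N) => _ ?; rewrite ler_wpM2r// exprn_ge0.
have cE : expR \o s @ \oo --> expR B.
  by apply: continuous_cvg => //; exact: continuous_expR.
rewrite -(cvg_lim _ cE)//; apply: limr_le; last by apply: nearW.
by apply/cvg_ex; eexists; exact: cE.
Qed.

End nonneg.
End BellSeries.

(** Writing the inverse as the power -1 covers the zeros of f as well, where both are 0. *)
Lemma measurable_funV_ge0 (R : realType) d (T : measurableType d) (D : set T) (f : T -> R) :
  (forall x, 0 <= f x) -> measurable_fun D f -> measurable_fun D (fun x => (f x)^-1).
Proof.
move=> f0 mf; rewrite (_ : (fun x => _) = (fun x => f x `^ (-1))); last first.
  by apply/funext => x; rewrite powR_inv1.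
exact: (measurableT_comp (@measurable_powR R (-1))).
Qed.

Lemma measurable_funpowR (R : realType) d (T : measurableType d) (D : set T) (f : T -> R) a :
  measurable_fun D f -> measurable_fun D (fun x => f x `^ a).
Proof. by move=> mf; exact: (measurableT_comp (@measurable_powR R a)). Qed.

(** * Expansion of F(D (1 - z)) in powers of z *)

Section TailIntegral.
Variables (R : realType) (alpha : R).
Hypothesis alpha_gt2 : 2 < alpha.
Notation mu := (@lebesgue_measure R).
Notation mR := (measurableTypeR R).
Notation U := (`[1%R, +oo[%classic : set mR).

Let mid : measurable_fun [set: mR] (fun t : mR => t : R).
Proof. exact: (@measurable_id _ R). Qed.

Let mpow a : measurable_fun [set: mR] (fun t : mR => (t : R) `^ a).
Proof. exact: measurable_powR. Qed.

Lemma powR_cvgy_0 (a : R) : 0 < a -> (fun t : R => t `^ (- a)) @ +oo --> (0 : R).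
Proof.
move=> a0; apply/cvgrPdist_lt => e e0; near=> t.
rewrite sub0r normrN ger0_norm ?powR_ge0// powRN.
have t1 : 1 <= t by near: t; apply: nbhs_pinfty_ge; rewrite num_real.
have t0 : 0 < t by rewrite (lt_le_trans _ t1).
rewrite -[ltRHS]invrK ltf_pV2 ?posrE ?invr_gt0 ?powR_gt0//.
rewrite (_ : e^-1 = (e^-1 `^ a^-1) `^ a); last first.
  by rewrite -powRrM mulVf ?gt_eqF// powRr1// invr_ge0 ltW.
have te : e^-1 `^ a^-1 < t by near: t; apply: nbhs_pinfty_gt; rewrite num_real.
by apply: gt0_ltr_powR; rewrite ?nnegrE ?powR_ge0 ?(ltW t0).
Unshelve. all: by end_near. Qed.

Lemma integrable_powR_tail : mu.-integrable U (fun t => (t `^ (1 - alpha))%:E).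
Proof.
have mf : measurable_fun U (fun t : R => (t `^ (1 - alpha))%:E).
  by apply/measurable_EFinP; apply: measurable_funTS; exact: mpow.
apply/integrableP; split => //.
under eq_integral do rewrite gee0_abs ?lee_fin ?powR_ge0//.
have a2 : 2 - alpha != 0 by rewrite subr_eq0 lt_eqF.
pose F (t : R) := (2 - alpha)^-1 * t `^ (2 - alpha).
have dF (x : R) : 0 < x -> is_derive x 1 F (x `^ (1 - alpha)).
  move=> x0; have h := is_derive1_powR (2 - alpha) x0.
  have -> : x `^ (1 - alpha) = (2 - alpha)^-1 *: ((2 - alpha) * x `^ (2 - alpha - 1)).
    rewrite /GRing.scale/= mulrA mulVf// mul1r; congr (_ `^ _).
    by rewrite addrAC (_ : 2 = 1 + 1 :> R)// addrK.
  exact: is_deriveZ.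
rewrite (@ge0_continuous_FTC2y _ _ F 1 0).
- by rewrite -EFinB ltry.
- by move=> x _; exact: powR_ge0.
- apply: derivable_within_continuous => x; rewrite in_itv/= andbT => x1.
  by apply: derivable_powR; rewrite in_itv/= andbT (lt_le_trans _ x1).
- rewrite -(mulr0 (2 - alpha)^-1); apply: cvgMr.
  rewrite -(opprB alpha); apply: powR_cvgy_0; by rewrite subr_gt0.
- by move=> x x1; have [] := dF x (lt_trans ltr01 x1).
- have [d1 _] := dF 1 ltr01.
  apply: cvg_at_right_filter; apply/differentiable_continuous.
  exact/derivable1_diffP.
- move=> x; rewrite in_itv/= andbT => x1; rewrite derive1E.
  by have [_ ->] := dF x (lt_trans ltr01 x1).
Qed.

Lemma integrable_tail (f : mR -> R) (C : R) : measurable_fun [set: mR] f ->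
  (forall t, 1 <= t -> `|f t| <= C * (t / t `^ alpha)) ->
  mu.-integrable U (EFin \o f).
Proof.
move=> mf fC.
apply: (@le_integrable _ mR _ _ _ _ _ (fun t => C%:E * (t `^ (1 - alpha))%:E)%E) => //.
- by apply/measurable_EFinP; apply: measurable_funTS.
- move=> t; rewrite /= in_itv/= andbT => t1; rewrite lee_fin.
  rewrite (le_trans (fC _ t1))// (le_trans _ (ler_norm _))//.
  have t0 : 0 < t := lt_le_trans ltr01 t1.
  by rewrite powRB ?powRr1 ?(ltW t0)// (gt_eqF t0) implybT.
- by apply: integrableZl => //; exact: integrable_powR_tail.
Qed.

Let iZ (c : R) (f : mR -> R) : mu.-integrable U (EFin \o f) ->
  mu.-integrable U (EFin \o (fun t => c * f t)).
Proof.
have mU : measurable U by exact: (@measurable_itv R).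
by move=> fi; have := integrableZl mU c fi.
Qed.

Variable D : R.
Hypothesis D0 : 0 < D.

(** Since t^alpha + D (1 - z) = (t^alpha + D) (1 - q z), the difference of the integrands of F(D)
    and F(D (1 - z)) is 2 t (1 - q) q z / (1 - q z), the geometric series of the terms g_j z^j for j
    >= 1. [e z n] is the remainder of that series from the term n on. *)
Let q (t : R) := D / (t `^ alpha + D).
Let g j (t : R) := 2 * t * (1 - q t) * q t ^+ j.
Let h (y t : R) := 2 * y * t / (t `^ alpha + y).
Let e (z : R) n t := z ^+ n * (g n t / (1 - q t * z)).

Definition Fhyp_coef (j : nat) : R := (\int[mu]_(t in U) g j t)%R.

Let den0 t : 0 < t `^ alpha + D.
Proof. by rewrite ltr_wpDl// powR_ge0. Qed.

Let q01 t : 0 < q t <= 1.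
Proof.
by rewrite /q divr_gt0//= ler_pdivrMr// mul1r lerDr powR_ge0.
Qed.

Let q1z z t : `|z| < 1 -> 1 - `|z| <= 1 - q t * z.
Proof.
move=> z1; rewrite lerD2l lerN2 (le_trans (ler_norm _))// normrM.
by have /andP[/ltW q0 ?] := q01 t; rewrite (ger0_norm q0) ler_piMl.
Qed.

Let mq : measurable_fun [set: mR] (q : mR -> R).
Proof.
apply: measurable_funM => //; apply: measurable_funV_ge0 => [t|]; first exact: ltW.
exact: measurable_funD.
Qed.

Let mg j : measurable_fun [set: mR] (g j : mR -> R).
Proof.
apply: measurable_funM; last exact: measurable_funX.
by apply: measurable_funM; [apply: measurable_funM|apply: measurable_funB].
Qed.

Let mh y : 0 <= y -> measurable_fun [set: mR] (h y : mR -> R).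
Proof.
move=> y0; apply: measurable_funM; first exact: measurable_funM.
by apply: measurable_funV_ge0 => [t|]; [rewrite addr_ge0 ?powR_ge0|exact: measurable_funD].
Qed.

Let me z n : `|z| < 1 -> measurable_fun [set: mR] (e z n : mR -> R).
Proof.
move=> z1; apply: measurable_funM => //; apply: measurable_funM => //.
apply: measurable_funV_ge0 => [t|].
  by rewrite (le_trans _ (q1z t z1))// subr_ge0 ltW.
by apply: measurable_funB => //; exact: measurable_funM.
Qed.

Let g_ge0 j t : 0 <= t -> 0 <= g j t.
Proof.
by move=> t0; have /andP[/ltW ? ?] := q01 t; rewrite !mulr_ge0 ?subr_ge0 ?exprn_ge0.
Qed.

Let g_le j t : 1 <= t -> g j.+1 t <= 2 * D * (t / t `^ alpha).
Proof.
move=> t1; have t0 : 0 < t by rewrite (lt_le_trans _ t1).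
have /andP[/ltW q0 q1] := q01 t.
apply: (@le_trans _ _ (2 * t * q t)).
  rewrite /g -mulrA ler_pM2l ?mulr_gt0// exprS mulrCA ler_piMr//.
  by rewrite mulr_ile1 ?subr_ge0 ?exprn_ge0 ?exprn_ile1// lerBlDr lerDl.
rewrite -!mulrA ler_pM2l// /q [leLHS]mulrCA ler_pM2l// ler_pM2l//.
by rewrite lef_pV2 ?posrE ?powR_gt0// lerDl ltW.
Qed.

Let ig j : mu.-integrable U (EFin \o g j.+1).
Proof.
apply: (@integrable_tail _ (2 * D)) => // t t1.
by rewrite ger0_norm ?g_le// g_ge0// (le_trans _ t1).
Qed.

Let ih y : 0 <= y -> mu.-integrable U (EFin \o h y).
Proof.
move=> y0; apply: (@integrable_tail _ (2 * y)) => [|t t1]; first exact: mh.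
have t0 : 0 < t by rewrite (lt_le_trans _ t1).
rewrite ger0_norm; last by rewrite /h !mulr_ge0 ?invr_ge0 ?addr_ge0 ?powR_ge0// ltW.
rewrite /h -!mulrA ler_pM2l// ler_wpM2l// ler_pM2l//.
by rewrite lef_pV2 ?posrE ?ltr_wpDr ?powR_gt0// lerDl.
Qed.

Let e_le z n t : `|z| < 1 -> 1 <= t ->
  `|e z n.+1 t| <= `|z| ^+ n.+1 * (1 - `|z|)^-1 * (2 * D * (t / t `^ alpha)).
Proof.
move=> z1 t1; have t0 : 0 <= t by rewrite (le_trans _ t1).
have z1' : 0 < 1 - `|z| by rewrite subr_gt0.
rewrite /e normrM normrX -mulrA ler_wpM2l ?exprn_ge0//.
rewrite normrM normfV mulrC ler_pM ?invr_ge0 ?normr_ge0//; last first.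
  by rewrite ger0_norm ?g_le// g_ge0.
have h1 := q1z t z1.
have h2 : 0 < 1 - q t * z := lt_le_trans z1' h1.
by rewrite (gtr0_norm h2) lef_pV2 ?posrE.
Qed.

Let ie z n : `|z| < 1 -> mu.-integrable U (EFin \o e z n.+1).
Proof.
move=> z1; apply: (@integrable_tail _ (`|z| ^+ n.+1 * (1 - `|z|)^-1 * (2 * D))) => [|t t1]; first exact: me.
by rewrite -mulrA (le_trans (e_le _ z1 t1))// -!mulrA.
Qed.

Lemma Fhyp_coef_ge0 j : 0 <= Fhyp_coef j.
Proof.
apply: Rintegral_ge0 => t; rewrite /= in_itv/= andbT => t1.
by rewrite g_ge0// (le_trans _ t1).
Qed.

Lemma Fhyp_integral y : 0 <= y ->
  (\int[mu]_(t in U) (2 * y * t / (t `^ alpha + y))%:E = (Fhyp alpha y - 1)%:E)%E.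
Proof.
move=> y0; rewrite /Fhyp addrAC subrr add0r fineK//.
by apply: integrable_fin_num => //; exact: ih.
Qed.

(** Dropping y from the denominator t^alpha + y leaves an integral proportional to y. The bound
    later lets F tend to 1 as its argument tends to 0. *)
Lemma Fhyp_le_linear y : 0 <= y ->
  1 <= Fhyp alpha y <= 1 + y * (\int[mu]_(t in U) (2 * t / t `^ alpha))%R.
Proof.
move=> y0.
have i1 : mu.-integrable U (EFin \o (fun t : R => 2 * t / t `^ alpha)).
  apply: (@integrable_tail _ 2) => [|t t1].
    apply: measurable_funM; first exact: measurable_funM.
    by apply: measurable_funV_ge0 => // t; exact: powR_ge0.
  rewrite ger0_norm ?mulrA// !mulr_ge0 ?invr_ge0 ?powR_ge0//.
  by rewrite (le_trans _ t1).
rewrite /Fhyp lerDl lerD2l; apply/andP; split.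
  apply: Rintegral_ge0 => t; rewrite /= in_itv/= andbT => t1.
  by rewrite !mulr_ge0 ?invr_ge0 ?addr_ge0 ?powR_ge0// (le_trans _ t1).
rewrite -RintegralZl//; apply: le_Rintegral => //; first exact: ih.
  exact: iZ.
move=> t; rewrite /= in_itv/= andbT => t1.
have t0 : 0 < t by rewrite (lt_le_trans _ t1).
rewrite mulrA (mulrCA y) mulrA ler_wpM2l ?mulr_ge0// ?(ltW t0)//.
by rewrite lef_pV2 ?posrE ?ltr_wpDr ?powR_gt0// lerDl.
Qed.

(** Peeling terms off the geometric series one by one avoids exchanging an infinite sum with the
    integral: after n terms the integral of the remainder [e z n.+1] is left, of order |z|^(n+1). *)
Lemma Fhyp_series z : `|z| < 1 ->
  series (fun j => Fhyp_coef j.+1 * z ^+ j.+1) @ \oo -->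
  Fhyp alpha D - Fhyp alpha (D * (1 - z)).
Proof.
move=> z1.
have z1' : 0 < 1 - `|z| by rewrite subr_gt0.
have y0 : 0 < D * (1 - z) by rewrite mulr_gt0// subr_gt0 (le_lt_trans (ler_norm _)).
have e1 : (\int[mu]_(t in U) e z 1 t)%R = Fhyp alpha D - Fhyp alpha (D * (1 - z)).
  rewrite /Fhyp opprD addrACA subrr add0r -RintegralB//.
  - apply: eq_Rintegral => t _.
    have h1 := den0 t; have h2 : 0 < 1 - q t * z by rewrite (lt_le_trans z1')// q1z.
    have h3 : 0 < t `^ alpha + D * (1 - z) by rewrite ltr_wpDl// powR_ge0.
    move: h2; rewrite /e /g /q; move: (t `^ alpha) h1 h3 => w h1 h3 h2.
    rewrite expr1.
    have -> : 1 - D / (w + D) * z = (w + D * (1 - z)) / (w + D).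
      by field; rewrite gt_eqF.
    by field; rewrite !gt_eqF.
  - exact: ih (ltW D0).
  - exact: ih (ltW y0).
have eS n : (\int[mu]_(t in U) e z n.+1 t)%R =
    Fhyp_coef n.+1 * z ^+ n.+1 + (\int[mu]_(t in U) e z n.+2 t)%R.
  rewrite (mulrC (Fhyp_coef _)) -RintegralZl// -RintegralD//; last 2 first.
  - exact: iZ.
  - exact: ie.
  - apply: eq_Rintegral => t _; rewrite /e /g.
    have h2 : 0 < 1 - q t * z by rewrite (lt_le_trans z1')// q1z.
    by rewrite !exprS; field; rewrite gt_eqF.
pose K := (\int[mu]_(t in U) (2 * D * (t / t `^ alpha)))%R.
have iK : mu.-integrable U (EFin \o (fun t : R => 2 * D * (t / t `^ alpha))).
  apply: (@integrable_tail _ (2 * D)) => [|t t1].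
    apply: measurable_funM => //; apply: measurable_funM => //.
    by apply: measurable_funV_ge0 => // t; exact: powR_ge0.
  by rewrite ger0_norm// !mulr_ge0 ?invr_ge0 ?powR_ge0 ?(ltW D0)// (le_trans _ t1).
have eK n : `|(\int[mu]_(t in U) e z n.+1 t)%R| <= `|z| ^+ n.+1 * (1 - `|z|)^-1 * K.
  apply: (le_trans (le_normr_Rintegral _ (ie _ z1))) => //.
  rewrite -RintegralZl//; apply: le_Rintegral => //; first by apply: integrable_norm; exact: ie.
    exact: iZ.
  by move=> t; rewrite /= in_itv/= andbT => t1; exact: e_le.
have sE n : series (fun j => Fhyp_coef j.+1 * z ^+ j.+1) n =
    (Fhyp alpha D - Fhyp alpha (D * (1 - z))) - (\int[mu]_(t in U) e z n.+1 t)%R.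
  elim: n => [|n ihn]; first by rewrite /series/= big_geq// e1 subrr.
  by rewrite /series/= big_nat_recr//= [X in X + _]ihn eS; ring.
rewrite (_ : series _ = (fun n => (Fhyp alpha D - Fhyp alpha (D * (1 - z))) -
    (\int[mu]_(t in U) e z n.+1 t)%R)); last by apply/funext.
rewrite -[X in _ --> X]subr0; apply: cvgB; first exact: cvg_cst.
apply/norm_cvg0P.
apply: (@squeeze_cvgr _ _ _ _ (cst 0) (fun n => `|z| ^+ n.+1 * (1 - `|z|)^-1 * K)).
- by apply: nearW => n; rewrite normr_ge0/= eK.
- exact: cvg_cst.
- rewrite -(mul0r K); apply: cvgMl; rewrite -(mul0r (1 - `|z|)^-1); apply: cvgMl.
  have := @cvg_expr _ `|z|; rewrite normr_id => /(_ z1) h0.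
  by rewrite (_ : (fun n => _) = (fun n => `|z| ^+ (n + 1))) ?cvg_shiftn//; apply/funext => n; rewrite addn1.
Qed.

End TailIntegral.

(** * Derivatives at 1 of a power series in 1 - x *)

Section PowerSeriesAtOne.
Variable R : realType.
Implicit Types (c : R^nat) (f : R -> R).

(** At a radius K' strictly between |z| and |K| the series still converges absolutely, and the
    factor n + 1 created by differentiation is absorbed by the ratio (|z| / K')^n. *)
Lemma is_cvg_pseries_diffs c K z :
  cvgn (pseries c K) -> `|z| < `|K| -> cvgn (pseries (pseries_diffs c) z).
Proof.
move=> cK zK.
have [K' zK' K'K] : exists2 K' : R, `|z| < K' & K' < `|K|.
  by exists ((`|z| + `|K|) / 2); rewrite ?midf_lt.
have K'0 : 0 < K' by rewrite (le_lt_trans _ zK').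
have cn : cvgn (pseries (fun i => `|c i|) K').
  by apply: is_cvg_pseries_inside_norm cK _; rewrite gtr0_norm.
have [q zE] : exists q : R, `|z| = q * K' by exists (`|z| / K'); rewrite divfK// gt_eqF.
have q0 : 0 <= q by rewrite -(pmulr_lge0 _ K'0) -zE.
have q1 : q < 1 by rewrite -(ltr_pM2r K'0) mul1r -zE.
(* q^n is the smallest of the n + 1 terms of the geometric sum 1 + ... + q^n. *)
have nq n : n.+1%:R * q ^+ n <= (1 - q)^-1.
  rewrite -[leRHS]mul1r ler_pdivlMr ?subr_gt0// (@le_trans _ _ (1 - q ^+ n.+1))//; last first.
    by rewrite lerBlDr lerDl exprn_ge0.
  have -> : 1 - q ^+ n.+1 = (\sum_(i < n.+1) q ^+ i) * (1 - q).
    by rewrite -opprB subrX1 -mulNr opprB mulrC.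
  rewrite ler_wpM2r ?subr_ge0 ?(ltW q1)//.
  rewrite -[n.+1 in leLHS](card_ord n.+1) mulr_natl -sumr_const; apply: ler_sum => i _.
  by rewrite ler_wiXn2l// ?ltW// -ltnS.
apply: normed_cvg.
apply: (@series_le_cvg _ _ (fun i => (1 - q)^-1 / K' * (`|c i.+1| * K' ^+ i.+1))).
- by move=> n /=; exact: normr_ge0.
- by move=> n; rewrite !mulr_ge0 ?invr_ge0 ?subr_ge0 ?exprn_ge0 ?(ltW q1) ?(ltW K'0).
- move=> n /=; rewrite /pseries_diffs !normrM normr_nat normrX.
  rewrite zE exprMn exprS (mulrACA _ `|c n.+1|).
  rewrite (mulrCA `|c n.+1|) -[leRHS]mulrA mulKf ?gt_eqF//.
  by rewrite ler_wpM2r// mulr_ge0// exprn_ge0// ltW.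
- apply: (@is_cvg_seriesZ _ (fun i => `|c i.+1| * K' ^+ i.+1)).
  rewrite (_ : series _ = (fun n => pseries (fun i => `|c i|) K' (n + 1)%N - `|c 0|)).
    apply/cvg_ex; exists (limn (pseries (fun i => `|c i|) K') - `|c 0|).
    by apply: cvgB; [rewrite cvg_shiftn|exact: cvg_cst].
  by apply/funext => n; rewrite addn1 /pseries /series/= big_nat_recl//= expr0 mulr1 addrC addKr.
Qed.

Lemma pseries_at0 c : limn (pseries c 0) = c 0.
Proof.
apply/cvg_lim => //; rewrite -(cvg_shiftn 1).
rewrite (_ : (fun n => _) = cst (c 0)); first exact: cvg_cst.
apply/funext => n; rewrite addn1 /pseries /series/= big_nat_recl//= expr0 mulr1 big1 ?addr0// => i _.
by rewrite expr0n mulr0.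
Qed.

Lemma iter_pseries_diffs_at0 c n : iter n (@pseries_diffs R) c 0 = n`!%:R * c n.
Proof.
elim: n c => [|n ih] c; first by rewrite fact0 mul1r.
by rewrite iterSr ih /pseries_diffs mulrA -natrM mulnC -factS.
Qed.

(** The induction runs over the whole disc |1 - x| < 1, since each derivative needs the preceding
    formula on a neighbourhood of the point. The inner map 1 - x contributes one sign per order. *)
Lemma derive1n_pseries c f :
  (forall z, `|z| < 1 -> cvgn (pseries c z)) ->
  (forall x, `|1 - x| < 1 -> f x = limn (pseries c (1 - x))) ->
  forall n x, `|1 - x| < 1 ->
    derive1n n f x = (-1) ^+ n * limn (pseries (iter n (@pseries_diffs R) c) (1 - x)).
Proof.
move=> cc fE.
have ccn n z : `|z| < 1 -> cvgn (pseries (iter n (@pseries_diffs R) c) z).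
  elim: n z => [|n ih] z z1; first exact: cc.
  have [K zK K1] : exists2 K : R, `|z| < K & K < 1 by exists ((`|z| + 1) / 2); rewrite ?midf_lt.
  have K0 : 0 < K by rewrite (le_lt_trans _ zK).
  by apply: (@is_cvg_pseries_diffs _ K); [apply: ih|]; rewrite (gtr0_norm K0).
elim=> [|n ih] x x1; first by rewrite expr0 mul1r derive1n0 (fE _ x1).
rewrite derive1nS derive1E.
pose P z := limn (pseries (iter n (@pseries_diffs R) c) z).
have dP : is_derive (1 - x) 1 P (limn (pseries (iter n.+1 (@pseries_diffs R) c) (1 - x))).
  have [K zK K1] : exists2 K : R, `|1 - x| < K & K < 1 by exists ((`|1 - x| + 1) / 2); rewrite ?midf_lt.
  have K0 : 0 < K by rewrite (le_lt_trans _ zK).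
  have h : `|K| < 1 by rewrite gtr0_norm.
  apply: (@pseries_snd_diffs _ _ K); [exact: ccn|exact: (ccn n.+1)|exact: (ccn n.+2)|].
  by rewrite (gtr0_norm K0).
have dx : is_derive x (1 : R) (fun y : R => 1 - y) (-1).
  rewrite -[- 1]add0r; apply: is_deriveB.
have dc := @is_derive1_comp _ P (fun y : R => 1 - y) x _ _ dP dx.
have := is_deriveZ ((-1) ^+ n) dc => dd.
rewrite (@near_eq_derive _ _ _ _ ((-1) ^+ n \*: (P \o (fun y : R => 1 - y)))).
  by have [_ ->] := dd; rewrite /GRing.scale/= exprS mulrN1 mulrN mulN1r mulNr.
near=> y; apply: ih.
near: y; apply: (@cvgr_lt _ _ _ _ (fun y : R => `|1 - y|) `|1 - x|) => //.
by apply: cvg_norm; apply: cvgB; [exact: cvg_cst|exact: cvg_id].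
Unshelve. all: by end_near. Qed.

End PowerSeriesAtOne.

(** * Expansion of Lambda and of its exponential *)

Section LambdaSeries.
Variables (R : realType) (lam PB Cr thr thI dc n0sq alpha betaT a_c a_t tau : R).
Hypotheses (lam0 : 0 < lam) (PB0 : 0 < PB) (Cr0 : 0 < Cr) (thr0 : 0 < thr)
  (thI0 : 0 < thI) (dc0 : 0 < dc) (n00 : 0 <= n0sq) (alpha2 : 2 < alpha)
  (bT : 0 < betaT < 1) (tau0 : 0 < tau) (act : a_t * tau < a_c).
Variables (c : bool) (r : R).

Let Lam := Lambda lam PB Cr thr thI dc n0sq alpha betaT a_c a_t tau c r.

(** The coefficient [s_(c,chi)] of the statement; [interf_ratio psi] below is [D^c_(psi chi)]. *)
Definition snr_scale : R :=
  tau / (a_c - a_t * tau) * (r * dc) `^ alpha / (thr * beta_of betaT c * PB * Cr).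

Definition interf_ratio (psi : bool) : R :=
  thI * (tau / (a_c - a_t * tau)) * beta_of betaT psi / (thr * beta_of betaT c).

Lemma beta_of_gt0 b : 0 < beta_of betaT b.
Proof. by case/andP: bT => b0 b1; case: b; rewrite /= ?subr_gt0. Qed.

Lemma taus_gt0 : 0 < tau / (a_c - a_t * tau).
Proof. by rewrite divr_gt0// subr_gt0. Qed.

Lemma snr_scale_ge0 : 0 <= snr_scale.
Proof.
have t0 := taus_gt0; have b0 := beta_of_gt0 c.
apply: mulr_ge0; first by apply: mulr_ge0; [exact: ltW|exact: powR_ge0].
by rewrite invr_ge0 ltW// !mulr_gt0.
Qed.

Lemma interf_ratio_gt0 psi : 0 < interf_ratio psi.
Proof.
have t0 := taus_gt0; have b0 := beta_of_gt0 c; have b1 := beta_of_gt0 psi.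
by rewrite /interf_ratio divr_gt0 ?(mulr_gt0 (mulr_gt0 thI0 t0) b1)// mulr_gt0.
Qed.

Let h := 2^-1 * pi * lam * r ^+ 2.
Let D := interf_ratio.

Let h0 : 0 <= h.
Proof. 
apply: mulr_ge0; last exact: sqr_ge0.
by rewrite mulr_ge0 ?(ltW lam0)// mulr_ge0 ?invr_ge0 ?pi_ge0.
Qed.

(** The coefficients in z of Lambda(1 - z) - Lambda(1), that is (-1)^j Lambda^(j)(1) / j!. The noise
    is linear in x and enters only at j = 1; all coefficients are nonnegative. *)
Definition Lambda_coef j : R := if j is i.+1 then
  (i == 0)%:R * (snr_scale * n0sq) +
  h * (Fhyp_coef alpha (D true) j + Fhyp_coef alpha (D false) j) else 0.

Let b := Lambda_coef.

Let b0 j : 0 <= b j.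
Proof.
case: j => [//|j]; have s0 := snr_scale_ge0.
apply: addr_ge0; first by apply: mulr_ge0 => //; exact: mulr_ge0.
by apply: mulr_ge0 => //; apply: addr_ge0; apply: Fhyp_coef_ge0; exact: interf_ratio_gt0.
Qed.

Let bLam z : `|z| < 1 ->
  series (fun j => b j.+1 * z ^+ j.+1) @ \oo --> Lam (1 - z) - Lam 1.
Proof.
move=> z1.
have sn : series (fun j => (j == 0)%:R * (snr_scale * n0sq) * z ^+ j.+1) @ \oo -->
    snr_scale * n0sq * z.
  rewrite -(cvg_shiftn 1) (_ : (fun n => _) = cst (snr_scale * n0sq * z)); first exact: cvg_cst.
  apply/funext => n; rewrite addn1 /series/= big_nat_recl//= mul1r expr1 big1 ?addr0// => i _.
  by rewrite !mul0r.
have sT := Fhyp_series alpha2 (interf_ratio_gt0 true) z1.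
have sF := Fhyp_series alpha2 (interf_ratio_gt0 false) z1.
rewrite (_ : series _ = (fun n =>
    series (fun j => (j == 0)%:R * (snr_scale * n0sq) * z ^+ j.+1) n +
    h * (series (fun j => Fhyp_coef alpha (D true) j.+1 * z ^+ j.+1) n +
         series (fun j => Fhyp_coef alpha (D false) j.+1 * z ^+ j.+1) n))); last first.
  apply/funext => n; rewrite /series/= -big_split/= mulr_sumr -big_split/=.
  by apply: eq_bigr => i _; rewrite mulrDl -[X in _ + X]mulrA [X in _ + h * X]mulrDl.
rewrite (_ : Lam (1 - z) - Lam 1 = snr_scale * n0sq * z +
    h * ((Fhyp alpha (D true) - Fhyp alpha (D true * (1 - z))) +
         (Fhyp alpha (D false) - Fhyp alpha (D false * (1 - z))))).
  by apply: cvgD => //; apply: cvgMr; apply: cvgD.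
rewrite /Lam /Lambda !mulr1 -/snr_scale -!/(interf_ratio _) -/h /D.
set x1 := Fhyp _ _; set x2 := Fhyp _ _; set x3 := Fhyp _ _; set x4 := Fhyp _ _.
by move: x1 x2 x3 x4 snr_scale h => x1 x2 x3 x4 s h'; ring.
Qed.

Let cc j : R := if j is 0 then Lam 1 else b j.

Let ccLam z : `|z| < 1 -> pseries cc z @ \oo --> Lam (1 - z).
Proof.
move=> z1; rewrite -(cvg_shiftn 1).
rewrite (_ : (fun n => _) = (fun n => series (fun j => b j.+1 * z ^+ j.+1) n + Lam 1)).
  have h1 : (fun n => series (fun j => b j.+1 * z ^+ j.+1) n + Lam 1) @ \oo -->
      Lam (1 - z) - Lam 1 + Lam 1 by apply: cvgD; [exact: bLam|exact: cvg_cst].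
  by rewrite subrK in h1.
apply/funext => n; rewrite addn1 /pseries /series/= big_nat_recl//= expr0 mulr1 addrC.
by [].
Qed.

Lemma derive1n_Lambda i : derive1n i.+1 Lam 1 = (-1) ^+ i.+1 * (i.+1`!%:R * b i.+1).
Proof.
rewrite (@derive1n_pseries _ cc).
- by rewrite subrr pseries_at0 iter_pseries_diffs_at0.
- by move=> z z1; apply/cvg_ex; exists (Lam (1 - z)); exact: ccLam.
- by move=> x x1; apply/esym/cvg_lim => //; have := ccLam x1; rewrite subKr.
- by rewrite subrr normr0.
Qed.

Definition coverage_term m : R :=
  (-1) ^+ m / m`!%:R * expR (Lam 1) * bell (fun i => derive1n i Lam 1) m.

Lemma coverage_termE m : coverage_term m = expR (Lam 1) * bell_coef b m.
Proof.
rewrite /coverage_term mulrAC mulrC -bell_alternating; congr (_ * (_ * _)).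
apply: eq_bigr => j _; congr (_ * _); apply: eq_bigr => i _.
by rewrite derive1n_Lambda.
Qed.

Lemma coverage_term_ge0 m : 0 <= coverage_term m.
Proof. by rewrite coverage_termE; apply: mulr_ge0; [exact: expR_ge0|exact: bell_coef_ge0]. Qed.

Lemma coverage_term_series z : 0 <= z < 1 ->
  series (fun m => coverage_term m * z ^+ m) @ \oo --> expR (Lam (1 - z)).
Proof.
case/andP=> z0 z1; have nz1 : `|z| < 1 by rewrite ger0_norm.
rewrite -[Lam (1 - z)](subrKC (Lam 1)) expRD.
rewrite (_ : series _ = (fun n => expR (Lam 1) * series (fun m => bell_coef b m * z ^+ m) n)).
  by apply: cvgMr; apply: bell_coef_series => //; exact: bLam.
by apply/funext => n; rewrite /series/= mulr_sumr; apply: eq_bigr => i _; rewrite coverage_termE mulrA.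
Qed.

End LambdaSeries.

(** * Measurability in the serving distance *)

Section LambdaMeasurable.
Variables (R : realType) (lam PB Cr thr thI dc n0sq alpha betaT a_c a_t tau : R).
Hypotheses (lam0 : 0 < lam) (PB0 : 0 < PB) (Cr0 : 0 < Cr) (thr0 : 0 < thr)
  (thI0 : 0 < thI) (dc0 : 0 < dc) (n00 : 0 <= n0sq) (alpha2 : 2 < alpha)
  (bT : 0 < betaT < 1) (tau0 : 0 < tau) (act : a_t * tau < a_c).
Variable c : bool.
Notation mR := (measurableTypeR R).

Let msnr : measurable_fun setT
  (fun r : mR => snr_scale PB Cr thr dc alpha betaT a_c a_t tau c r).
Proof.
apply: measurable_funM => //; apply: measurable_funM => //.
by apply: measurable_funpowR; exact: measurable_funM.
Qed.

Let mh : measurable_fun setT (fun r : mR => 2^-1 * pi * lam * r ^+ 2).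
Proof. by apply: measurable_funM => //; exact: measurable_funX. Qed.

Lemma measurable_Lambda x : measurable_fun setT
  (fun r : mR => Lambda lam PB Cr thr thI dc n0sq alpha betaT a_c a_t tau c r x).
Proof.
apply: measurable_funB; last exact: measurable_funM.
apply: measurable_funB; last exact: measurable_funM.
by apply: measurableT_comp => //; apply: measurable_funM => //; exact: measurable_funM.
Qed.

(** The derivatives in x are never examined as functions of r: in the Bell form the term is
    exp(Lambda(1)) times a polynomial in [snr_scale] and r^2. *)
Lemma measurable_coverage_term m : measurable_fun setT (fun r : mR =>
  coverage_term lam PB Cr thr thI dc n0sq alpha betaT a_c a_t tau c r m).
Proof.
under eq_fun do rewrite coverage_termE// bell_coefE.
apply: measurable_funM.
  by apply: measurableT_comp => //; exact: measurable_Lambda.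
under eq_fun do rewrite -big_filter.
apply: measurable_sum => j.
apply: measurable_prod => i _; apply: measurable_funM => //; apply: measurable_funX.
apply: measurable_funD; last exact: measurable_funM.
by apply: measurable_funM => //; exact: measurable_funM.
Qed.

End LambdaMeasurable.

(** * Transfer of weighted integrals along a map *)

Section IntegralTransfer.
Context (R : realType) d1 d2 (T : measurableType d1) (S : measurableType d2).
Variables (mu : {measure set T -> \bar R}) (nu : {measure set S -> \bar R}).
Variables (X : T -> S) (w : T -> R) (v : S -> R).
Hypotheses (mX : measurable_fun setT X) (mw : measurable_fun setT w)
  (mv : measurable_fun setT v).
Hypotheses (w0 : forall x, 0 <= w x) (v0 : forall y, 0 <= v y).
Hypothesis transfer : forall A, measurable A ->
  (\int[mu]_(x in X @^-1` A) (w x)%:E = \int[nu]_(y in A) (v y)%:E)%E.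

Import HBNNSimple.

Let simple_integral d (U : measurableType d) (m : {measure set U -> \bar R})
    (Y : U -> S) (u : U -> R) (g : {nnsfun S >-> R}) :
  measurable_fun setT Y -> measurable_fun setT u -> (forall x, 0 <= u x) ->
  (\int[m]_x ((g (Y x))%:E * (u x)%:E) =
   \sum_(y \in range g) y%:E * \int[m]_(x in Y @^-1` (g @^-1` [set y])) (u x)%:E)%E.
Proof.
move=> mY mu' u0.
have mYg y : measurable (Y @^-1` (g @^-1` [set y])).
  by rewrite -[X in measurable X]setTI; apply: mY => //; exact: measurable_sfunP.
have mind y : measurable_fun setT (fun x => ((\1_(Y @^-1` (g @^-1` [set y])) x)%:E * (u x)%:E)%E).
  by apply: emeasurable_funM; apply/measurable_EFinP => //; exact: measurable_indic.
(* The absolute value changes nothing on the range of g, but makes the summands nonnegative for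
   every real y, as the exchange of sum and integral requires. *)
transitivity (\int[m]_x (\sum_(y \in range g)
    (`|y|%:E * ((\1_(Y @^-1` (g @^-1` [set y])) x)%:E * (u x)%:E))))%E.
  apply: eq_integral => x _.
  have -> : g (Y x) = \sum_(y <- finmap.enum_fset (fset_set (range g))) `|y| * \1_(g @^-1` [set y]) (Y x).
    rewrite fimfunE (fsbig_finite _ _ (fimfunP g))/=; apply: eq_big_seq => y.
    by rewrite in_fset_set ?inE; [case=> z _ <-; rewrite ger0_norm|exact: fimfunP].
  rewrite -sumEFin ge0_sume_distrl; last by move=> y _; rewrite lee_fin mulr_ge0.
  rewrite (fsbig_finite _ _ (fimfunP g))/=; apply: eq_bigr => y _.
  by rewrite EFinM muleA.
rewrite ge0_integral_fsum//; last 2 first.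
- by move=> y; apply: measurable_funeM.
- by move=> y x _; rewrite !mule_ge0 ?lee_fin.
apply: eq_fsbigr => y; rewrite inE => -[z _ <-].
rewrite ge0_integralZl_EFin//; last by move=> x _; rewrite mule_ge0 ?lee_fin.
rewrite ger0_norm//; congr (_ * _)%E.
rewrite [RHS]integral_mkcond; apply: eq_integral => x _.
rewrite patchE indicE; case: ifPn => _; by rewrite ?mul1e ?mul0e.
Qed.

(** The hypothesis [transfer] says that the image of w mu under X is v nu. It passes from sets to
    simple functions, then to limits; stating [key] for an arbitrary map makes both sides use the
    same approximation of f. *)
Lemma integral_transfer (f : S -> \bar R) :
  measurable_fun setT f -> (forall y, (0 <= f y)%E) ->
  (\int[mu]_x (f (X x) * (w x)%:E) = \int[nu]_y (f y * (v y)%:E))%E.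
Proof.
move=> mf f0; pose g := nnsfun_approx measurableT mf.
have key d (U : measurableType d) (m : {measure set U -> \bar R})
    (Y : U -> S) (u : U -> R) :
  measurable_fun setT Y -> measurable_fun setT u -> (forall x, 0 <= u x) ->
  (\int[m]_x (f (Y x) * (u x)%:E) = limn (fun n => \int[m]_x ((g n (Y x))%:E * (u x)%:E)))%E.
  move=> mY mu' u0; rewrite -monotone_convergence//.
  - apply: eq_integral => x _; apply/esym/cvg_lim => //.
    apply: cvgeZr => //.
    exact: (@cvg_nnsfun_approx _ _ _ _ measurableT _ mf (fun y _ => f0 y) (Y x)).
  - move=> n; apply: emeasurable_funM; apply/measurable_EFinP => //.
    exact: measurableT_comp.
  - by move=> n x _; rewrite mule_ge0 ?lee_fin.
  - move=> x _ n n' nn; rewrite lee_wpmul2r ?lee_fin//.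
    exact/lefP/nd_nnsfun_approx.
rewrite (key _ _ mu X w)// (key _ _ nu id v)//.
congr (limn _); apply/funext => n; rewrite !simple_integral//.
by apply: eq_fsbigr => y _; rewrite transfer.
Qed.

End IntegralTransfer.

(** * Measures on the line determined by half-lines *)

Section MeasureOnR.
Variable R : realType.
Notation mR := (measurableTypeR R).

(** Only the half-lines need finite mass, since ]a, b] is a difference of two of them. This suits
    radial measures of the plane, whose total mass is infinite. *)
Lemma measure_eq_Iic (m1 m2 : {measure set mR -> \bar R}) :
  (forall b : R, m1 `]-oo, b]%classic = m2 `]-oo, b]%classic) ->
  (forall b : R, m1 `]-oo, b]%classic < +oo)%E ->
  forall A, measurable A -> m1 A = m2 A.
Proof.
move=> m12 m1oo A mA.
have mI (i : interval R) : measurable ([set` i] : set mR) by exact: (@measurable_itv R).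
apply: (@measure_unique _ R mR (@ocitv R) (fun n => `](- n%:R)%R, n%:R]%classic)) => //.
- exact: ocitvI.
- by move=> i; exact: is_ocitv.
- exact: bigcup_itvT.
- move=> _ [[a b] _ <-]/=.
  have [ba|ab] := leP b a; first by rewrite set_itv_ge ?measure0// bnd_simp -leNgt.
  have E : `]a, b]%classic = `]-oo, b]%classic `\` `]-oo, a]%classic :> set mR.
    apply/seteqP; split => x /=; rewrite !in_itv/=.
      by move=> /andP[ax xb]; split => //; apply/negP; rewrite -ltNge.
    by move=> [-> /negP]; rewrite -ltNge andbT.
  have I : `]-oo, b]%classic `&` `]-oo, a]%classic = `]-oo, a]%classic :> set mR.
    apply: setIidr => x /=; rewrite !in_itv/= => xa; exact: (le_trans xa (ltW ab)).
  have e1 : m1 `]a, b]%classic = (m1 `]-oo, b]%classic - m1 `]-oo, a]%classic)%E.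
    by rewrite E (measureD (mI _) (mI _) (m1oo _)) I.
  have e2 : m2 `]a, b]%classic = (m2 `]-oo, b]%classic - m2 `]-oo, a]%classic)%E.
    have m2oo : (m2 `]-oo, b]%classic < +oo)%E by rewrite -m12.
    by rewrite E (measureD (mI _) (mI _) m2oo) I.
  by rewrite e1 e2 !m12.
- move=> k; apply: le_lt_trans (m1oo k%:R); apply: le_measure; rewrite ?inE//.
  by move=> x /=; rewrite !in_itv/= => /andP[].
Qed.

End MeasureOnR.

(** * Area of a disc *)

Section DiscArea.
Variable R : realType.
Notation mR := (measurableTypeR R).
Notation mu := (@lebesgue_measure R).

Lemma integral_half_disc (r : R) : 0 < r ->
  (\int[mu]_(x in `[(- r)%R, r]) (2 * Num.sqrt (r ^+ 2 - x ^+ 2))%:E = (pi * r ^+ 2)%:E)%E.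
Proof.
move=> r0.
pose w (x : R) := Num.sqrt (r ^+ 2 - x ^+ 2).
(* 2 atan (x / (r + w)) is asin (x / r), in a form that is continuous up to the endpoints *)
pose F (x : R) := x * w x + 2 * r ^+ 2 * atan (x / (r + w x)).
have w0 x : 0 <= w x by exact: sqrtr_ge0.
have cw : continuous w.
  move=> x; apply: continuous_cvg; first exact: sqrt_continuous.
  by apply: cvgB; [exact: cvg_cst|apply: exprn_continuous].
have rw x : 0 < r + w x by rewrite ltr_pwDl.
have cF : continuous F.
  move=> x; apply: cvgD; first by apply: cvgM; [exact: cvg_id|exact: cw].
  apply: cvgMr.
  apply: continuous_cvg; first exact: continuous_atan.
  apply: cvgM; first exact: cvg_id.
  by apply: cvgV; [rewrite gt_eqF|apply: cvgD; [exact: cvg_cst|exact: cw]].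
have dF (x : R) : x \in `]- r, r[ -> is_derive x 1 F (2 * w x).
  rewrite in_itv/= => /andP[rx xr].
  have x2 : 0 < r ^+ 2 - x ^+ 2.
    by rewrite subr_gt0 -ltr_sqrt ?exprn_gt0// !sqrtr_sqr (gtr0_norm r0) ltr_norml rx.
  have wx : 0 < w x by rewrite sqrtr_gt0.
  have w2 : w x ^+ 2 = r ^+ 2 - x ^+ 2 by rewrite sqr_sqrtr// ltW.
  have dw : is_derive x 1 w (- (x / w x)).
    have d1 : is_derive x 1 (fun x : R => r ^+ 2 - x ^+ 2) (- (2 * x)).
      apply: is_derive_eq; rewrite /GRing.scale/=; ring.
    have := @is_derive1_comp _ Num.sqrt (fun x : R => r ^+ 2 - x ^+ 2) x _ _ (is_derive1_sqrt x2) d1.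
    rewrite (_ : _ * _ = - (x / w x))//.
    by rewrite /w; field; rewrite gt_eqF.
  have dv : is_derive x 1 (fun x : R => x / (r + w x)) (r / (w x * (r + w x))).
    have d1 : is_derive x 1 (fun x : R => r + w x) (0 - x / w x) by apply: is_deriveD.
    have d2 : is_derive x 1 (fun x : R => (r + w x)^-1) (- (r + w x) ^- 2 * (0 - x / w x)).
      have n0 : r + w x != 0 by rewrite gt_eqF.
      exact: (@is_deriveV R (fun x : R => r + w x) x _ 1 n0 d1).
    have d3 := @is_deriveM _ _ id (fun x : R => (r + w x)^-1) x 1 1 _ (is_derive_id _ _) d2.
    apply: (is_derive_eq d3).
    rewrite /GRing.scale/= sub0r mulr1.
    have xx : x * x = r ^+ 2 - w x ^+ 2 by rewrite w2; ring.
    have -> : x * (- (r + w x) ^- 2 * - (x / w x)) = (x * x) / (w x * (r + w x) ^+ 2).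
      by field; rewrite !gt_eqF.
    by rewrite xx; field; rewrite !gt_eqF.
  have da := @is_derive1_comp _ atan (fun x : R => x / (r + w x)) x _ _ (is_derive1_atan _) dv.
  have dxw := @is_deriveM _ _ id w x 1 1 _ (is_derive_id _ _) dw.
  have dza := is_deriveZ (2 * r ^+ 2) da.
  have dd := is_deriveD dxw dza.
  apply: (is_derive_eq dd).
  rewrite /GRing.scale/= mulr1.
  have v2 : 1 + (x / (r + w x)) ^+ 2 = 2 * r / (r + w x).
    have xx : x ^+ 2 = r ^+ 2 - w x ^+ 2 by rewrite w2; ring.
    by rewrite expr_div_n xx; field; rewrite gt_eqF.
  rewrite v2.
  have -> : x * - (x / w x) + w x + 2 * r ^+ 2 * ((2 * r / (r + w x))^-1 * (r / (w x * (r + w x))))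
     = (r ^+ 2 - x ^+ 2) / w x + w x.
    by field; rewrite !gt_eqF.
  by rewrite -w2; field; rewrite gt_eqF.
rewrite (@continuous_FTC2 _ _ F).
- rewrite /F /w sqrrN subrr sqrtr0 !mulr0 !add0r !addr0 mulNr divff ?gt_eqF// atanN atan1.
  by rewrite -EFinB; congr EFin; field.
- by rewrite gtrN.
- apply: continuous_subspaceT => x; apply: cvgMr; exact: cw.
- split; first by move=> x /dF[].
  + by apply: cvg_at_right_filter; exact: cF.
  + by apply: cvg_at_left_filter; exact: cF.
- by move=> x /dF[_ dE]; rewrite derive1E dE.
Qed.

Lemma measurable_norm2 : measurable_fun setT (@norm2 R : mR * mR -> R).
Proof.
rewrite (_ : @norm2 R = (fun p => (p.1 ^+ 2 + p.2 ^+ 2) `^ 2^-1)); last first.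
  by apply/funext => p; rewrite powR12_sqrt// addr_ge0// sqr_ge0.
apply: measurable_funpowR.
by apply: measurable_funD; apply: measurable_funX; [exact: measurable_fst|exact: measurable_snd].
Qed.

Lemma leb2_disc (r : R) : 0 <= r ->
  @leb2 R [set p | norm2 p <= r] = (pi * r ^+ 2)%:E.
Proof.
move=> r0; rewrite /leb2 /product_measure1/=.
transitivity (\int[mu]_(x in `[(- r)%R, r]) (2 * Num.sqrt (r ^+ 2 - x ^+ 2))%:E)%E; last first.
  move: r0; rewrite le_eqVlt => /predU1P[<-|r0]; last exact: integral_half_disc.
  by rewrite oppr0 set_itv1 integral_set1 expr0n mulr0.
rewrite [RHS]integral_mkcond; apply: eq_integral => x _; rewrite patchE.
have nE (y : R) : (norm2 (x, y) <= r) = (y ^+ 2 <= r ^+ 2 - x ^+ 2).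
  rewrite /norm2/= -[r in LHS]ger0_norm// -sqrtr_sqr ler_sqrt ?exprn_ge0//.
  by rewrite lerBrDl.
case: ifPn => [|xr].
  rewrite inE/= in_itv/= -ler_norml => xr.
  have x2 : 0 <= r ^+ 2 - x ^+ 2 by rewrite subr_ge0 -ler_sqrt ?exprn_ge0// !sqrtr_sqr (ger0_norm r0).
  rewrite (_ : xsection _ _ = `[- Num.sqrt (r ^+ 2 - x ^+ 2), Num.sqrt (r ^+ 2 - x ^+ 2)]%classic).
    rewrite lebesgue_measure_itv/= lte_fin; case: ltP => [_|].
      by rewrite -EFinB opprK -mulr2n mulr_natl.
    have := sqrtr_ge0 (r ^+ 2 - x ^+ 2); move: (Num.sqrt _) => s s0 h.
    by congr EFin; lra.
  apply/seteqP; split => y; rewrite /xsection/= inE/= nE in_itv/= -ler_norml.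
    by rewrite -ler_sqrt// sqrtr_sqr.
  by rewrite -sqrtr_sqr ler_sqrt.
rewrite (_ : xsection _ _ = set0) ?measure0//; apply/seteqP; split => // y.
rewrite /xsection/= inE => /=; rewrite nE => yx; move/negP: xr; apply; rewrite inE/= in_itv/= -ler_norml.
rewrite -[r]ger0_norm// -!sqrtr_sqr ler_sqrt ?exprn_ge0// -subr_ge0.
by rewrite (le_trans _ yx)// sqr_ge0.
Qed.

End DiscArea.

(** * Images of measures with density, and polar coordinates *)

Section ImageDensity.
Context (R : realType) d1 d2 (T : measurableType d1) (S : measurableType d2).
Variables (mu : {measure set T -> \bar R}) (X : T -> S) (w : T -> R).
Hypotheses (mX : measurable_fun setT X) (mw : measurable_fun setT w)
  (w0 : forall x, 0 <= w x).

(** The measurability and positivity proofs are arguments so that the measure structure can be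
    attached to this very term. *)
Definition image_density of measurable_fun setT X & measurable_fun setT w &
    (forall x, 0 <= w x) : set S -> \bar R :=
  fun A => (\int[mu]_(x in X @^-1` A) (w x)%:E)%E.

Let m := image_density mX mw w0.

Let m_set0 : m set0 = 0%E.
Proof. by rewrite /m /image_density preimage_set0 integral_set0. Qed.

Let m_ge0 A : (0 <= m A)%E.
Proof. by apply: integral_ge0 => x _; rewrite lee_fin. Qed.

Let m_sigma_additive : semi_sigma_additive m.
Proof.
move=> F mF tF mUF; rewrite /m /image_density preimage_bigcup.
have mXF A : measurable A -> measurable (X @^-1` A).
  by move=> mA; rewrite -[X in measurable X]setTI; exact: mX.
apply: semi_sigma_additive_nng_induced.
- exact/measurable_EFinP.
- by move=> x; rewrite lee_fin.
- by move=> n; exact: mXF.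
- apply/trivIsetP => /= i j _ _ ij; rewrite -preimage_setI.
  by move/trivIsetP : tF => /(_ _ _ _ _ ij) ->//; rewrite preimage_set0.
- by rewrite -preimage_bigcup; exact: mXF.
Qed.

HB.instance Definition _ := isMeasure.Build _ _ _ m m_set0 m_ge0 m_sigma_additive.

End ImageDensity.

Section Polar.
Variable R : realType.
Notation mR := (measurableTypeR R).
Notation mu := (@lebesgue_measure R).

Let mI (i : interval R) : measurable ([set` i] : set mR).
Proof. exact: (@measurable_itv R). Qed.

Let mid : measurable_fun setT (fun t : mR => t : R).
Proof. exact: (@measurable_id _ R). Qed.

Let mmax : measurable_fun setT (fun t : mR => Num.max (t : R) 0).
Proof. by apply: measurable_maxr. Qed.

Lemma integral_linear (c b : R) : 0 <= b ->
  (\int[mu]_(t in `[0%R, b]) (2 * c * t)%:E = (c * b ^+ 2)%:E)%E.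
Proof.
rewrite le_eqVlt => /predU1P[<-|b0].
  by rewrite set_itv1 integral_set1 expr0n mulr0.
have dF (x : R) : is_derive x 1 (fun t : R => c * t ^+ 2) (2 * c * x).
  by apply: is_derive_eq; rewrite /GRing.scale/=; ring.
rewrite (@continuous_FTC2 _ _ (fun t : R => c * t ^+ 2))//.
- by rewrite expr0n/= mulr0 sube0.
- by apply: continuous_subspaceT => x; apply: cvgMr; exact: cvg_id.
- have cF : continuous (fun t : R => c * t ^+ 2).
    by move=> x; apply: cvgMr; exact: exprn_continuous.
  split; first by move=> x _; have [] := dF x.
  + by apply: cvg_at_right_filter; exact: cF.
  + by apply: cvg_at_left_filter; exact: cF.
- by move=> x _; rewrite derive1E; have [_ ->] := dF x.
Qed.

(** Polar coordinates with the unit of length r. Both image measures vanish on the negative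
    half-line and give mass pi r^2 b^2 to ]-oo, b] for b >= 0: the area of a disc on one side, the
    integral of 2 pi r^2 t on the other. *)
Lemma radial_integral (r : R) (phi : mR -> \bar R) : 0 < r ->
  measurable_fun setT phi -> (forall t, (0 <= phi t)%E) ->
  (\int[@leb2 R]_y phi ((norm2 y / r)%R)
   = \int[mu]_t (phi t * (2 * (pi * r ^+ 2) * Num.max (t : R) 0)%:E))%E.
Proof.
move=> r0 mphi phi0.
pose X (y : mR * mR) : mR := norm2 y / r.
pose v (t : mR) : R := 2 * (pi * r ^+ 2) * Num.max (t : R) 0.
have mX : measurable_fun setT X.
  have : measurable_fun setT (fun y : mR * mR => norm2 y / r).
    by apply: measurable_funM => //; exact: measurable_norm2.
  exact.
have mv : measurable_fun setT v by exact: measurable_funM.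
have v0 t : 0 <= v t.
  apply: mulr_ge0; last by rewrite le_max lexx orbT.
  by apply: mulr_ge0 => //; apply: mulr_ge0; [exact: pi_ge0|exact: sqr_ge0].
transitivity (\int[@leb2 R]_y (phi (X y) * 1%:E))%E.
  by apply: eq_integral => y _; rewrite mule1.
apply: (@integral_transfer R _ _ _ _ (@leb2 R) mu X (cst 1) v) => // A mA.
have m1v : measurable_fun setT (cst 1 : mR * mR -> R) by [].
have m10 (x : mR * mR) : 0 <= (cst 1 : mR * mR -> R) x by [].
have mid' : measurable_fun setT (id : mR -> mR) by [].
change (image_density (@leb2 R) mX m1v m10 A = image_density mu mid' mv v0 A).
have e1 b : image_density (@leb2 R) mX m1v m10 `]-oo, b]%classic = (pi * r ^+ 2 * (Num.max b 0) ^+ 2)%:E.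
  have mXb : measurable (X @^-1` `]-oo, b]%classic).
    by rewrite -[X in measurable X]setTI; exact: mX.
  transitivity (@leb2 R (X @^-1` `]-oo, b]%classic)).
    rewrite -[RHS]mul1e; exact: (integral_cst (@leb2 R) mXb 1%:E).
  have [b0|b0] := leP 0 b.
    rewrite -mulrA -exprMn -leb2_disc ?mulr_ge0 ?(ltW r0)//.
    congr (leb2 _); apply/seteqP; split => y /=; rewrite in_itv/= /X ler_pdivrMr// mulrC//.
  rewrite expr0n mulr0 (_ : _ @^-1` _ = set0); first by rewrite /leb2 measure0.
  apply/seteqP; split => // y /=; rewrite in_itv/= /X => h.
  have := le_lt_trans h b0; rewrite ltNge => /negP; apply.
  by rewrite divr_ge0 ?sqrtr_ge0// ltW.
have e2 b : image_density mu mid' mv v0 `]-oo, b]%classic = (pi * r ^+ 2 * (Num.max b 0) ^+ 2)%:E.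
  rewrite /image_density preimage_id; have [b0|b0] := leP 0 b.
    rewrite -integral_linear// [LHS]integral_mkcond [RHS]integral_mkcond.
    apply: eq_integral => t _; rewrite !patchE !mem_setE !in_itv/= /v.
    have [t0|t0] := leP 0 t; first by [].
    by rewrite mulr0 if_same.
  rewrite expr0n mulr0; apply: integral0_eq => t /=; rewrite in_itv/= => tb.
  by rewrite /v (max_r (le_trans tb (ltW b0))) mulr0.
apply: measure_eq_Iic => // b; first exact: etrans (e1 b) (esym (e2 b)).
by have := ltry (pi * r ^+ 2 * (Num.max b 0) ^+ 2); rewrite -e1.
Qed.

End Polar.

(* The library's canonical sigma-finite structure on [_ \x _] is the one of
   subprobabilities, hence the explicit structure on a named copy. *)
Section SigmaFinitePlane.
Variable R : realType.
Notation mR := (measurableTypeR R).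
Notation mu := (@lebesgue_measure R).

Definition plane_measure : set (mR * mR)%type -> \bar R := (mu \x mu)%E.

HB.instance Definition _ := Measure.on plane_measure.

Let plane_sigma_finite : sigma_finite setT plane_measure.
Proof.
exists (fun n => [set p | norm2 p <= n%:R]).
  apply/esym/seteqP; split => // p _; exists (Num.truncn (norm2 p)).+1 => //=.
  exact: ltW (truncnS_gt _).
move=> n; split; last by rewrite [X in (X < _)%E](leb2_disc (ler0n _ n)) ltry.
have := @measurable_norm2 R measurableT _ (@measurable_itv R `]-oo, n%:R]).
by rewrite setTI; congr measurable; apply/seteqP; split => p; rewrite /= in_itv.
Qed.

HB.instance Definition _ :=
  Measure_isSigmaFinite.Build _ _ _ plane_measure plane_sigma_finite.

End SigmaFinitePlane.

(** * Campbell's formula for one marked process *)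

Section Campbell.
Variables (R : realType).
Notation mR := (measurableTypeR R).
Notation mu := (@lebesgue_measure R).

Lemma cvg_expRNM (c : R) : 0 < c -> (fun t : R => expR (- (c * t))) @ +oo --> (0 : R).
Proof.
move=> c0; apply: (@cvg_comp _ _ _ (fun t : R => c * t) (fun t => expR (- t)) _ +oo).
  by apply: gt0_cvgMry => //; exact: cvg_id.
exact: cvgr_expR.
Qed.

Lemma is_derive_expRNM (c x : R) :
  is_derive x 1 (fun t : R => expR (- (c * t))) (- (c * expR (- (c * x)))).
Proof.
have d1 : is_derive x 1 (fun t : R => - (c * t)) (- c).
  by apply: is_derive_eq; rewrite /GRing.scale/=; ring.
have := @is_derive1_comp _ expR (fun t : R => - (c * t)) x _ _ (is_derive_expR _) d1.
by rewrite mulrN mulrC.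
Qed.

Lemma exp_pdf_ge0 (th x : R) : 0 < th -> 0 <= exp_pdf th x.
Proof.
move=> th0; rewrite /exp_pdf; case: ifP => // _.
by rewrite mulr_ge0 ?expR_ge0// invr_ge0 ltW.
Qed.

Lemma measurable_exp_pdf (th : R) : measurable_fun setT (exp_pdf th : mR -> R).
Proof.
have m : measurable_fun setT (fun t : mR => t : R) by exact: (@measurable_id _ R).
apply: measurable_fun_if => //.
- by apply: measurable_fun_ler.
- apply: measurable_funTS; apply: measurable_funM => //.
  by apply: measurableT_comp => //; apply: measurableT_comp => //; exact: measurable_funM.
Qed.

(** The value is 1 - 1 / (1 + a th), the complement of the Laplace transform of the exponential
    law. *)
Lemma mark_integral (a th : R) : 0 <= a -> 0 < th ->
  (\int[mu]_g ((1 - expR (- (a * Num.max g 0))) * exp_pdf th g)%:E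
   = (a * th / (1 + a * th))%:E)%E.
Proof.
move=> a0 th0.
have c0 : 0 < a + th^-1 by rewrite ltr_wpDl// invr_gt0.
have at0 : 0 < 1 + a * th by rewrite ltr_pwDl// mulr_ge0// ltW.
pose f (g : R) := (1 - expR (- (a * g))) * (th^-1 * expR (- (th^-1 * g))).
pose F (g : R) := (1 + a * th)^-1 * expR (- ((a + th^-1) * g)) - expR (- (th^-1 * g)).
transitivity (\int[mu]_(g in `[0%R, +oo[) (f g)%:E)%E.
  rewrite [RHS]integral_mkcond; apply: eq_integral => g _; rewrite patchE mem_setE in_itv/= andbT /exp_pdf.
  case: ifPn => g0; last by rewrite mulr0.
  by rewrite (max_l g0) /f (mulrC g).
have dF (x : R) : is_derive x 1 F (f x).
  have := is_deriveB (is_deriveZ (1 + a * th)^-1 (is_derive_expRNM (a + th^-1) x)) (is_derive_expRNM th^-1 x).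
  move=> dd; apply: (is_derive_eq dd).
  have E : expR (- ((a + th^-1) * x)) = expR (- (a * x)) * expR (- (th^-1 * x)).
    by rewrite mulrDl opprD expRD.
  rewrite /GRing.scale/= E /f; move: (expR (- (a * x))) (expR _) => e1 e2.
  by field; rewrite !gt_eqF.
have cE (c : R) : continuous (fun t : R => expR (- (c * t))).
  move=> x; apply/differentiable_continuous/derivable1_diffP.
  by have [] := is_derive_expRNM c x.
have cf : continuous f.
  move=> x; apply: cvgM.
    by apply: cvgB; [exact: cvg_cst|exact: cE].
  by apply: cvgM; [exact: cvg_cst|exact: cE].
rewrite (@ge0_continuous_FTC2y _ f F 0 0).
- rewrite /F !mulr0 oppr0 expR0 mulr1 sub0e -EFinN; congr EFin.
  by field; rewrite gt_eqF.
- move=> x x0; rewrite /f mulr_ge0//; last by rewrite mulr_ge0 ?expR_ge0// invr_ge0 ltW.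
  by rewrite subr_ge0 -expR0 ler_expR oppr_le0 mulr_ge0.
- by apply: continuous_subspaceT.
- rewrite -[X in _ --> X](subrr (0 : R)); apply: cvgB.
    by rewrite -(mulr0 (1 + a * th)^-1); apply: cvgMr; exact: cvg_expRNM.
  by apply: cvg_expRNM; rewrite invr_gt0.
- by move=> x _; have [] := dF x.
- apply: cvg_at_right_filter; apply/differentiable_continuous/derivable1_diffP.
  by have [] := dF 0.
- by move=> x _; rewrite derive1E; have [_ ->] := dF x.
Qed.

Variables (lam thI dc alpha : R).
Hypotheses (lam0 : 0 < lam) (thI0 : 0 < thI) (dc0 : 0 < dc) (alpha2 : 2 < alpha).

(** The maximum makes the gain nonnegative everywhere, so that monotone approximation applies. It
    agrees with the model at nonnegative marks, and negative ones turn out to be almost surely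
    absent. *)
Definition path_gain (p : (R * R) * R) : R :=
  (norm2 p.1 * dc) `^ (- alpha) * Num.max p.2 0.

Definition ppp_density (r : R) (p : (R * R) * R) : R :=
  (lam / 2) * (if r < norm2 p.1 then 1 else 0) * exp_pdf thI p.2.

Lemma path_gain_ge0 p : 0 <= path_gain p.
Proof. by apply: mulr_ge0; rewrite ?powR_ge0// le_max lexx orbT. Qed.

Lemma ppp_density_ge0 r p : 0 <= ppp_density r p.
Proof.
apply: mulr_ge0; last exact: exp_pdf_ge0.
by apply: mulr_ge0; [rewrite divr_ge0// ltW|case: ifP].
Qed.

Lemma measurable_path_gain :
  measurable_fun setT (path_gain : (mR * mR) * mR -> R).
Proof.
have m : measurable_fun setT (fun t : mR => t : R) by exact: (@measurable_id _ R).
apply: measurable_funM.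
  apply: measurable_funpowR; apply: measurable_funM => //.
  by apply: (measurableT_comp (@measurable_norm2 R)); exact: measurable_fst.
by apply: measurable_maxr.
Qed.

Lemma measurable_ppp_density2 :
  measurable_fun setT (fun q : mR * ((mR * mR) * mR) => ppp_density q.1 q.2).
Proof.
have m : measurable_fun setT (fun t : mR => t : R) by exact: (@measurable_id _ R).
apply: measurable_funM; last first.
  apply: (measurableT_comp (@measurable_exp_pdf thI)).
  by apply: measurableT_comp; [exact: measurable_snd|exact: measurable_snd].
apply: measurable_funM => //; apply: measurable_fun_if => //.
apply: measurable_fun_ltr.
  by apply: (measurableT_comp m); exact: measurable_fst.
apply: (measurableT_comp (@measurable_norm2 R)).
by apply: measurableT_comp; [exact: measurable_fst|exact: measurable_snd].
Qed.

Lemma measurable_ppp_density r :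
  measurable_fun setT (ppp_density r : (mR * mR) * mR -> R).
Proof.
have h : measurable_fun setT (fun p : (mR * mR) * mR => (r : mR, p)).
  exact: measurable_fun_pair.
exact: (measurableT_comp measurable_ppp_density2 h).
Qed.

(** Integrating the exponential mark first leaves a function of norm2 y / r alone. Polar coordinates
    in the unit r then extract r^2, turn the exclusion norm2 y > r into t > 1, and produce the
    integrand 2 Y t / (t^alpha + Y) of F. *)
Lemma campbell (r ka : R) : 0 < r -> 0 <= ka ->
  (\int[@leb3 R]_p ((1 - expR (- (ka * path_gain p))) * ppp_density r p)%:E =
   (2^-1 * pi * lam * r ^+ 2 * (Fhyp alpha (ka * thI * (r * dc) `^ (- alpha)) - 1))%:E)%E.
Proof.
move=> r0 ka0.
set Y := ka * thI * (r * dc) `^ (- alpha).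
have Y0 : 0 <= Y by rewrite !mulr_ge0 ?powR_ge0// ltW.
have i0 p : 0 <= (1 - expR (- (ka * path_gain p))) * ppp_density r p.
  apply: mulr_ge0; last exact: ppp_density_ge0.
  by rewrite subr_ge0 -expR0 ler_expR oppr_le0 mulr_ge0 ?path_gain_ge0.
pose phi (t : mR) : \bar R := (lam / 2 * (if 1 < t then 1 else 0) * (Y / (t `^ alpha + Y)))%:E.
have mm : measurable_fun setT (fun t : mR => t : R) by exact: (@measurable_id _ R).
have mphi : measurable_fun setT phi.
  apply/measurable_EFinP; apply: measurable_funM.
    by apply: measurable_funM => //; apply: measurable_fun_if => //; exact: measurable_fun_ltr.
  apply: measurable_funM => //; apply: measurable_funV_ge0 => [t|].
    by rewrite addr_ge0 ?powR_ge0.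
  by apply: measurable_funD => //; exact: measurable_funpowR.
have phi0 t : (0 <= phi t)%E.
  rewrite lee_fin; apply: mulr_ge0.
    by apply: mulr_ge0; [rewrite divr_ge0// ltW|case: ifP].
  by rewrite divr_ge0// addr_ge0 ?powR_ge0.
pose f (p : (mR * mR) * mR) : \bar R :=
  ((1 - expR (- (ka * path_gain p))) * ppp_density r p)%:E.
have mf : measurable_fun setT f.
  apply/measurable_EFinP; apply: measurable_funM; last exact: measurable_ppp_density.
  apply: measurable_funB => //; apply: measurableT_comp => //; apply: measurableT_comp => //.
  by apply: measurable_funM => //; exact: measurable_path_gain.
have f0 p : (0 <= f p)%E by rewrite lee_fin.
have -> : (\int[@leb3 R]_p f p = \int[@leb2 R]_y \int[mu]_g f (y, g))%E.
  exact: (@fubini_tonelli1 _ _ _ mR R (@plane_measure R) mu f mf f0).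
transitivity (\int[@leb2 R]_y phi ((norm2 y / r)%R))%E.
  apply: eq_integral => y _; rewrite /f /phi ltr_pdivlMr// mul1r.
  rewrite /ppp_density /path_gain/=.
  have [ry|ry] := ltP r (norm2 y); last first.
    rewrite mulr0 !mul0r; apply: integral0_eq => g _; by rewrite mul0r mulr0.
  rewrite mulr1; set a := ka * (norm2 y * dc) `^ (- alpha).
  have a0 : 0 <= a by rewrite mulr_ge0 ?powR_ge0.
  transitivity (\int[mu]_g ((lam / 2)%:E * ((1 - expR (- (a * Num.max g 0))) * exp_pdf thI g)%:E))%E.
    by apply: eq_integral => g _; rewrite (mulrA ka) -EFinM mulrCA.
  rewrite ge0_integralZl_EFin//.
  - rewrite mark_integral// -EFinM; congr (_ * _)%:E.
    have n0 : 0 < norm2 y by rewrite (lt_trans r0).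
    (* By homogeneity of the power law only the ratio of norm2 y to r survives; Y collects the
       values at distance r. *)
    have -> : a * thI = Y / (norm2 y / r) `^ alpha.
      rewrite /a /Y -powRN (_ : norm2 y * dc = (r * dc) * (norm2 y / r)).
        rewrite (powRM _ (mulr_ge0 (ltW r0) (ltW dc0))) ?divr_ge0 ?ltW//.
        by ring.
      by field; rewrite gt_eqF.
    have w0 : 0 < (norm2 y / r) `^ alpha by rewrite powR_gt0// divr_gt0.
    have wY : 0 < (norm2 y / r) `^ alpha + Y by rewrite ltr_pwDl.
    have key (w y' : R) : 0 < w -> 0 < w + y' -> y' / w / (1 + y' / w) = y' / (w + y').
      by move=> w1 wy1; field; rewrite !gt_eqF.
    exact: key.
  - move=> g _; rewrite lee_fin mulr_ge0 ?exp_pdf_ge0//.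
    by rewrite subr_ge0 -expR0 ler_expR oppr_le0 mulr_ge0// le_max lexx orbT.
  - apply/measurable_EFinP; apply: measurable_funM; last exact: measurable_exp_pdf.
    apply: measurable_funB => //; apply: measurableT_comp => //; apply: measurableT_comp => //.
    by apply: measurable_funM => //; exact: measurable_maxr.
  - by rewrite divr_ge0// ltW.
rewrite radial_integral//.
set C := 2^-1 * pi * lam * r ^+ 2.
have C0 : 0 <= C.
  apply: mulr_ge0; last exact: sqr_ge0.
  by rewrite mulr_ge0 ?(ltW lam0)// mulr_ge0 ?invr_ge0 ?pi_ge0.
have mh : measurable_fun setT (fun t : mR => 2 * Y * t / (t `^ alpha + Y)).
  apply: measurable_funM; first exact: measurable_funM.
  by apply: measurable_funV_ge0 => [t|]; [rewrite addr_ge0 ?powR_ge0|apply: measurable_funD => //; exact: measurable_funpowR].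
transitivity (\int[mu]_(t in `]1%R, +oo[) (C%:E * (2 * Y * t / (t `^ alpha + Y))%:E))%E.
  rewrite [RHS]integral_mkcond; apply: eq_integral => t _; rewrite patchE mem_setE in_itv/= andbT /phi.
  case: ifPn => t1; last by rewrite mulr0 mul0r mul0e.
  have t0 : 0 <= t by rewrite (le_trans ler01)// ltW.
  rewrite (max_l t0) -!EFinM; congr EFin; rewrite /C.
  have wY : 0 < t `^ alpha + Y by rewrite ltr_pwDl// powR_gt0// (lt_trans ltr01).
  by field; rewrite gt_eqF.
rewrite ge0_integralZl_EFin//.
- rewrite integral_itv_obnd_cbnd; first by rewrite Fhyp_integral.
  by apply/measurable_EFinP; exact: (measurable_funTS mh).
- move=> t; rewrite /= in_itv/= andbT => t1; rewrite lee_fin.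
  have t0 : 0 <= t := le_trans ler01 (ltW t1).
  apply: divr_ge0; last by rewrite addr_ge0 ?powR_ge0.
  by apply: mulr_ge0 => //; exact: mulr_ge0.
- by apply/measurable_EFinP; exact: (measurable_funTS mh).
Qed.

End Campbell.

(** * Gamma tails, and uniqueness of nonnegative coefficients *)

Section GammaTail.
Variable R : realType.
Notation mR := (measurableTypeR R).
Notation mu := (@lebesgue_measure R).
Implicit Types (u x y th : R) (k m n : nat).

Definition pois_term m u : R := expR (- u) * (u ^+ m / m`!%:R).

(** The survival function at u of the Gamma law of shape k and scale 1: a Poisson variable of mean u
    is below k exactly when the k-th arrival of a unit-rate process comes after u. *)
Definition gamma_sf k u : R := \sum_(m < k) pois_term m u.

Lemma pois_term_ge0 m u : 0 <= u -> 0 <= pois_term m u.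
Proof. by move=> u0; rewrite mulr_ge0 ?expR_ge0// divr_ge0 ?exprn_ge0. Qed.

Lemma pow_fact_le_expR n u : 0 <= u -> u ^+ n / n`!%:R <= expR u.
Proof.
move=> u0.
have nd : nondecreasing_seq (series (exp_coeff u)).
  apply/nondecreasing_seqP => i; rewrite /series/= big_nat_recr//= lerDl.
  exact: exp_coeff_ge0.
apply: (@le_trans _ _ (series (exp_coeff u) n.+1)); last first.
  exact: (nondecreasing_cvgn_le nd (is_cvg_series_exp_coeff u)).
rewrite /series/= big_nat_recr//= lerDr sumr_ge0// => i _.
exact: exp_coeff_ge0.
Qed.

Lemma series_pois_term u : series (pois_term ^~ u) @ \oo --> (1 : R).
Proof.
rewrite -(expRxMexpNx_1 u) mulrC (_ : series _ = (fun n => expR (- u) * series (exp_coeff u) n)).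
  by apply: cvgMr; exact: is_cvg_series_exp_coeff.
by apply/funext => n; rewrite /series/= mulr_sumr; apply: eq_bigr.
Qed.

Lemma gamma_sf_le1 k u : 0 <= u -> gamma_sf k u <= 1.
Proof.
move=> u0; have := series_pois_term u => cs.
rewrite -(cvg_lim _ cs)// /gamma_sf -(big_mkord xpredT (pois_term ^~ u)).
apply: (@nondecreasing_cvgn_le _ (series (pois_term ^~ u))); last by apply/cvg_ex; exists 1.
apply/nondecreasing_seqP => n; rewrite /series/= big_nat_recr//= lerDl.
exact: pois_term_ge0.
Qed.

Lemma gamma_sf_ge0 k u : 0 <= u -> 0 <= gamma_sf k u.
Proof. by move=> u0; apply: sumr_ge0 => m _; exact: pois_term_ge0. Qed.

Lemma pois_term_cvgy m : pois_term m u @[u --> +oo] --> (0 : R).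
Proof.
(* Comparing exp u with its term of degree m + 1, one above that of [pois_term m], leaves a spare
   factor 1 / u. *)
apply: (@squeeze_cvgr _ _ _ _ (cst 0) (fun u => m.+1`!%:R / m`!%:R * u^-1)).
- near=> u; have u0 : 0 < u by near: u; apply: nbhs_pinfty_gt; rewrite num_real.
  rewrite pois_term_ge0 ?(ltW u0)//= /pois_term.
  have := pow_fact_le_expR m.+1 (ltW u0); rewrite ler_pdivrMr ?ltr0n ?fact_gt0// exprS => h.
  rewrite expRN -(ler_pM2l (expR_gt0 u)) mulVKf ?gt_eqF ?expR_gt0//.
  rewrite -(ler_pM2l u0).
  have f0 : 0 < (m`!%:R : R) by rewrite ltr0n fact_gt0.
  have -> : u * (expR u * (m.+1`!%:R / m`!%:R / u)) = expR u * m.+1`!%:R / m`!%:R.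
    by field; rewrite !gt_eqF.
  rewrite mulrA.
  by rewrite ler_pM2r ?invr_gt0.
- exact: cvg_cst.
- rewrite -(mulr0 (m.+1`!%:R / m`!%:R)); apply: cvgMr.
  by apply/gtr0_cvgV0; [apply: nbhs_pinfty_gt; rewrite num_real|exact: cvg_id].
Unshelve. all: by end_near. Qed.

Lemma gamma_sf_cvgy k : gamma_sf k u @[u --> +oo] --> (0 : R).
Proof.
elim: k => [|k ih].
  rewrite (_ : gamma_sf 0 = cst 0); first exact: cvg_cst.
  by apply/funext => t; rewrite /gamma_sf big_ord0.
rewrite (_ : gamma_sf k.+1 = (fun u => gamma_sf k u + pois_term k u)); last first.
  by apply/funext => t; rewrite /gamma_sf big_ord_recr.
by rewrite -(addr0 (0 : R)); apply: cvgD => //; exact: pois_term_cvgy.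
Qed.

(** The derivative of [pois_term m.+1] is [pois_term m] minus [pois_term m.+1], so the sum
    telescopes to its last term. *)
Lemma is_derive_gamma_sf k u :
  is_derive u 1 (gamma_sf k.+1) (- pois_term k u).
Proof.
have dE : is_derive u 1 (fun t : R => expR (- t)) (- expR (- u)).
  have := is_derive_expRNM 1 u; rewrite !mul1r.
  by rewrite (_ : (fun t => _) = (fun t => expR (- t)))//; apply/funext => t; rewrite mul1r.
have dT m : is_derive u 1 (pois_term m.+1) (pois_term m u - pois_term m.+1 u).
  have dX : is_derive u 1 (fun t : R => t ^+ m.+1 / m.+1`!%:R) (u ^+ m / m`!%:R).
    have dX0 : is_derive u 1 (fun t : R => t ^+ m.+1) (m.+1%:R * u ^+ m).
      have dd := is_deriveX m.+1 (is_derive_id u (1 : R)).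
      rewrite (_ : (fun t : R => t ^+ m.+1) = (id : R -> R) ^+ m.+1); last first.
        by apply/funext => t; rewrite exprfctE.
      by apply: (is_derive_eq dd); rewrite /GRing.scale/= mulr1.
    rewrite (_ : (fun t : R => _) = m.+1`!%:R^-1 \*: (fun t : R => t ^+ m.+1)); last first.
      by apply/funext => t /=; rewrite mulrC.
    have dd := is_deriveZ m.+1`!%:R^-1 dX0; apply: (is_derive_eq dd).
    rewrite /GRing.scale/= factS natrM invfM mulrCA mulrA mulVKf ?pnatr_eq0//.
    by rewrite mulrC.
  have dd := is_deriveM dE dX; apply: (is_derive_eq dd).
  by rewrite /GRing.scale/= /pois_term; ring.
elim: k => [|k ih].
  rewrite (_ : gamma_sf 1 = (fun t => expR (- t))); last first.
    by apply/funext => t; rewrite /gamma_sf big_ord1 /pois_term expr0 fact0 divr1 mulr1.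
  by rewrite /pois_term expr0 fact0 divr1 mulr1.
rewrite (_ : gamma_sf k.+2 = gamma_sf k.+1 + pois_term k.+1); last first.
  by apply/funext => t; rewrite /gamma_sf big_ord_recr.
by have dd := is_deriveD ih (dT k); apply: (is_derive_eq dd); rewrite addrA addNr add0r.
Qed.

Lemma continuous_gamma_sf k : continuous (gamma_sf k).
Proof.
case: k => [|k] u.
  rewrite (_ : gamma_sf 0 = cst 0); first exact: cvg_cst.
  by apply/funext => t; rewrite /gamma_sf big_ord0.
by apply/differentiable_continuous/derivable1_diffP; have [] := is_derive_gamma_sf k u.
Qed.

Lemma continuous_pois_term m : continuous (pois_term m).
Proof.
move=> u; rewrite (_ : pois_term m = (fun u => gamma_sf m.+1 u - gamma_sf m u)); last first.
  by apply/funext => t; rewrite /gamma_sf big_ord_recr/= addrAC subrr add0r.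
by apply: cvgB; exact: continuous_gamma_sf.
Qed.

Lemma gamma_pdf_tail k th y : (0 < k)%N -> 0 < th -> 0 <= y ->
  (\int[mu]_(x in `[y, +oo[) (gamma_pdf k th x)%:E = (gamma_sf k (y / th))%:E)%E.
Proof.
case: k => // k _ th0 y0.
pose f x := th^-1 * pois_term k (th^-1 * x).
pose F x := - gamma_sf k.+1 (th^-1 * x).
transitivity (\int[mu]_(x in `[y, +oo[) (f x)%:E)%E.
  apply: eq_integral => x; rewrite inE/= in_itv/= andbT => yx; congr EFin.
  rewrite /gamma_pdf (le_trans y0 yx)/= /f /pois_term (mulrC x) exprMn exprVn exprS.
  by field; rewrite expf_neq0 ?gt_eqF// ltr0n fact_gt0.
have dF x : is_derive x 1 F (f x).
  have d1 : is_derive x 1 (fun t : R => th^-1 * t) th^-1.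
    by apply: is_derive_eq; rewrite /GRing.scale/= mulr1.
  have := @is_derive1_comp _ (gamma_sf k.+1) (fun t : R => th^-1 * t) x _ _ (is_derive_gamma_sf k _) d1.
  move=> /is_deriveN dd; apply: (is_derive_eq dd).
  by rewrite mulNr opprK mulrC.
rewrite (@ge0_continuous_FTC2y _ f F y 0).
- by rewrite /F sub0e -EFinN opprK mulrC.
- move=> x yx; have x0 := le_trans y0 yx.
  by rewrite mulr_ge0 ?pois_term_ge0 ?mulr_ge0 ?invr_ge0 ?(ltW th0).
- apply: continuous_subspaceT => x; apply: cvgM; first exact: cvg_cst.
  apply: continuous_cvg; first exact: continuous_pois_term.
  by apply: cvgM; [exact: cvg_cst|exact: cvg_id].
- rewrite -oppr0; apply: cvgN.
  apply: (@cvg_comp _ _ _ (fun t : R => th^-1 * t) (gamma_sf k.+1) _ +oo).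
    by apply: gt0_cvgMry; [rewrite invr_gt0|exact: cvg_id].
  exact: gamma_sf_cvgy.
- by move=> x _; have [] := dF x.
- apply: cvg_at_right_filter; apply/differentiable_continuous/derivable1_diffP.
  by have [] := dF y.
- by move=> x _; rewrite derive1E; have [_ ->] := dF x.
Qed.

Lemma psum_coef_inj (a b : R^nat) (S : R -> R) :
  (forall m, 0 <= a m) -> (forall m, 0 <= b m) ->
  (forall z, 0 <= z < 1 -> series (fun m => a m * z ^+ m) @ \oo --> S z) ->
  (forall z, 0 <= z < 1 -> series (fun m => b m * z ^+ m) @ \oo --> S z) ->
  forall m, a m = b m.
Proof.
have half01 : 0 <= (2^-1 : R) < 1 by rewrite invr_ge0 ler0n/= invf_lt1 ?ltr1n.
have nd (c : R^nat) z : (forall m, 0 <= c m) -> 0 <= z ->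
    nondecreasing_seq (series (fun m => c m * z ^+ m)).
  move=> c0 z0; apply/nondecreasing_seqP => i; rewrite /series/= big_nat_recr//= lerDl.
  by rewrite mulr_ge0 ?exprn_ge0.
have part_le (c : R^nat) (T : R -> R) z n : (forall m, 0 <= c m) -> 0 <= z < 1 ->
    (forall z, 0 <= z < 1 -> series (fun m => c m * z ^+ m) @ \oo --> T z) ->
    \sum_(0 <= i < n) c i * z ^+ i <= T z.
  move=> c0 z01 cT; rewrite -(cvg_lim _ (cT z z01))//.
  apply: (@nondecreasing_cvgn_le _ (series (fun m => c m * z ^+ m))).
    by apply: nd => //; case/andP: z01.
  by apply/cvg_ex; exists (T z); exact: cT.
(* If the coefficients agree below m, the tail of the second series is O(z^{m+1}). *)
have key (a' b' : R^nat) m : (forall m, 0 <= a' m) -> (forall m, 0 <= b' m) ->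
    (forall z, 0 <= z < 1 -> series (fun m => a' m * z ^+ m) @ \oo --> S z) ->
    (forall z, 0 <= z < 1 -> series (fun m => b' m * z ^+ m) @ \oo --> S z) ->
    (forall j, (j < m)%N -> a' j = b' j) -> a' m <= b' m.
  move=> a0 b0 aS bS ab.
  (* For z <= 1/2 and i > m one has z^i <= (2 z)^(m+1) 2^(-i). Summed against b', this bounds the
     tail by z^(m+1) times this constant. *)
  set C := 2 ^+ m.+1 * S 2^-1.
  have C0 : 0 <= C.
    rewrite mulr_ge0 ?exprn_ge0// -(big_geq (leqnn 0) : \sum_(0 <= i < 0) b' i * 2^-1 ^+ i = 0).
    exact: part_le bS.
  have bnd z : 0 < z -> z <= 2^-1 -> a' m <= b' m + C * z.
    move=> z0 z2; have z01 : 0 <= z < 1 by rewrite ltW//= (le_lt_trans z2)//; case/andP: half01.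
    have Sz : S z <= \sum_(0 <= i < m.+1) b' i * z ^+ i + C * z ^+ m.+1.
      rewrite -(cvg_lim _ (bS z z01))//; apply: limr_le; first by apply/cvg_ex; exists (S z); exact: bS.
      apply: nearW => n; apply: (@le_trans _ _ (\sum_(0 <= i < maxn n m.+1) b' i * z ^+ i)).
        by apply: (nd b' z b0 (ltW z0)); rewrite leq_maxl.
      rewrite (@big_cat_nat _ _ _ m.+1)//= ?leq_maxr// lerD2l.
      apply: (@le_trans _ _ (\sum_(m.+1 <= i < maxn n m.+1) (2 ^+ m.+1 * (b' i * 2^-1 ^+ i)) * z ^+ m.+1)).
        rewrite !big_nat; apply: ler_sum => i /andP[mi _].
        rewrite -(subnK mi) !exprD.
        rewrite (_ : _ * _ * _ = b' (i - m.+1 + m.+1)%N * 2^-1 ^+ (i - m.+1) * z ^+ m.+1); last first.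
          have : 2 ^+ m.+1 * 2^-1 ^+ m.+1 = 1 :> R by rewrite -exprMn divff ?expr1n.
          move: (2 ^+ m.+1) (2^-1 ^+ m.+1) => p q pq.
          rewrite (_ : _ * _ * _ = b' (i - m.+1 + m.+1)%N * 2^-1 ^+ (i - m.+1) * z ^+ m.+1 * (p * q)).
            by rewrite pq mulr1.
          by ring.
        by rewrite mulrA ler_wpM2r ?exprn_ge0 ?(ltW z0)// ler_wpM2l// lerXn2r// nnegrE ?ltW.
      rewrite -mulr_suml -mulr_sumr ler_wpM2r ?exprn_ge0 ?(ltW z0)// ler_wpM2l ?exprn_ge0//.
      apply: le_trans (part_le b' S 2^-1 (maxn n m.+1) b0 half01 bS).
      rewrite [leRHS](@big_cat_nat _ _ _ m.+1)//= ?leq_maxr// lerDr.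
      by apply: sumr_ge0 => i _; rewrite mulr_ge0 ?exprn_ge0.
    have := le_trans (part_le a' S z m.+1 a0 z01 aS) Sz.
    rewrite !big_nat_recr//= (eq_big_nat _ _ (fun i im => congr1 (fun c => c * z ^+ i) (ab i (andP im).2))).
    rewrite -addrA lerD2l exprS mulrA -mulrDl ler_pM2r// exprn_gt0//.
  rewrite leNgt; apply/negP => ba.
  set e := a' m - b' m; have e0 : 0 < e by rewrite subr_gt0.
  have C1 : 0 < C + 1 by rewrite ltr_wpDl.
  set z := Num.min 2^-1 (e / 2 / (C + 1)).
  have z0 : 0 < z by rewrite lt_min invr_gt0 ltr0n/= !divr_gt0.
  have := bnd z z0; rewrite ge_min lexx => /(_ isT); rewrite -lerBlDl -/e => h.
  have : C * z <= e / 2.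
    apply: (@le_trans _ _ ((C + 1) * z)); first by rewrite ler_wpM2r ?(ltW z0)// lerDl.
    by rewrite mulrC -ler_pdivlMr// ge_min lexx orbT.
  lra.
move=> a0 b0 aS bS m; have [n] := ubnP m; elim: n m => // n ih m mn.
apply/eqP; rewrite eq_le !key// => j jm; first by apply/esym/ih; exact: leq_trans jm _.
by apply/ih; exact: leq_trans jm _.
Qed.

End GammaTail.

(** * The mean measure as a function of the serving distance *)

Section SigmaFiniteSpace.
Variable R : realType.
Notation mR := (measurableTypeR R).
Notation mu := (@lebesgue_measure R).

Definition space_measure : set ((mR * mR) * mR)%type -> \bar R :=
  (@plane_measure R \x mu)%E.

HB.instance Definition _ := Measure.on space_measure.

Let space_sigma_finite : sigma_finite setT space_measure.
Proof.
have /sigma_finiteP[F [TF ndF Foo]] := sigma_finiteT (@plane_measure R).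
have /sigma_finiteP[G [TG ndG Goo]] := sigma_finiteT mu.
exists (fun n => F n `*` G n).
  rewrite -setXTT TF TG predeqE => -[x y]; split.
    move=> [/= [n _ Fnx] [k _ Gky]]; exists (maxn n k) => //; split.
    - by move: x Fnx; exact/subsetPset/ndF/leq_maxl.
    - by move: y Gky; exact/subsetPset/ndG/leq_maxr.
  by move=> [n _ []/= ? ?]; split; exists n.
move=> k; have [? ?] := Foo k; have [? ?] := Goo k.
split; first exact: measurableX.
by rewrite /space_measure product_measure1E// lte_mul_pinfty// ge0_fin_numE.
Qed.

HB.instance Definition _ :=
  Measure_isSigmaFinite.Build _ _ _ space_measure space_sigma_finite.

Variables (lam thI : R).
Hypotheses (lam0 : 0 < lam) (thI0 : 0 < thI).

Lemma measurable_ppp_mean (B : set ((mR * mR) * mR)) : measurable B ->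
  measurable_fun setT (fun r : mR => ppp_mean lam thI r B).
Proof.
move=> mB.
pose f (q : mR * ((mR * mR) * mR)) : \bar R :=
  (\1_B q.2 * ppp_density lam thI q.1 q.2)%:E.
have mf : measurable_fun setT f.
  apply/measurable_EFinP; apply: measurable_funM; last exact: measurable_ppp_density2.
  by apply: measurableT_comp; [exact: measurable_indic|exact: measurable_snd].
have f0 q : (0 <= f q)%E.
  by rewrite lee_fin mulr_ge0// ppp_density_ge0.
have := @measurable_fun_fubini_tonelli_F _ _ mR _ R space_measure f mf f0.
congr measurable_fun; apply/funext => r; rewrite /fubini_F /ppp_mean [RHS]integral_mkcond.
apply: eq_integral => p _; rewrite /f /= patchE indicE.
by case: ifP => _; rewrite ?mul1r ?mul0r.
Qed.

End SigmaFiniteSpace.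

(** * Integration against the law of two variables on an event *)

Section JointDensity.
Context (R : realType) d (T : measurableType d) (P : {finite_measure set T -> \bar R}).
Notation mR := (measurableTypeR R).
Notation mu := (@lebesgue_measure R).
Variables (X1 X2 : T -> mR) (E : set T) (v1 v2 : mR -> R).
Hypotheses (mX1 : measurable_fun setT X1) (mX2 : measurable_fun setT X2)
  (mE : measurable E) (mv1 : measurable_fun setT v1) (mv2 : measurable_fun setT v2)
  (v10 : forall x, 0 <= v1 x) (v20 : forall x, 0 <= v2 x).
Hypothesis law : forall A C : set mR, measurable A -> measurable C ->
  P (E `&` (X1 @^-1` A `&` X2 @^-1` C)) =
  (\int[mu]_(y in C) (v2 y)%:E * \int[mu]_(x in A) (v1 x)%:E)%E.

(** Under P restricted to E the pair has a product density; rectangles generate the sigma-algebra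
    and are closed under intersection. The intended pair is (r1, G), with E prescribing counts and
    v1 absorbing their conditional probabilities. *)
Lemma joint_density_integral (h : mR * mR -> \bar R) :
  measurable_fun setT h -> (forall q, (0 <= h q)%E) ->
  (\int[P]_(w in E) h (X1 w, X2 w) =
   \int[mu]_x ((\int[mu]_y (h (x, y) * (v2 y)%:E)) * (v1 x)%:E))%E.
Proof.
move=> mh h0.
pose X w := (X1 w, X2 w).
pose v (q : mR * mR) : R := v2 q.2 * v1 q.1.
have mX : measurable_fun setT X by exact: measurable_fun_pair.
have mv : measurable_fun setT v.
  apply: measurable_funM; first by apply: (measurableT_comp mv2); exact: measurable_snd.
  by apply: (measurableT_comp mv1); exact: measurable_fst.
have v0 q : 0 <= v q by exact: mulr_ge0.
have mw : measurable_fun setT (\1_E : T -> R) by exact: measurable_indic.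
have w0 x : 0 <= (\1_E : T -> R) x by [].
have mid : measurable_fun setT (id : mR * mR -> mR * mR) by [].
have mXA A : measurable A -> measurable (X @^-1` A).
  by move=> mA; rewrite -[X in measurable X]setTI; exact: mX.
have iE (A : set (mR * mR)) : measurable A ->
    (\int[P]_(w in X @^-1` A) (\1_E w)%:E = P (E `&` X @^-1` A))%E.
  by move=> mA; rewrite integral_indic//; exact: mXA.
have restr (u : mR -> R) (A : set mR) :
    (\int[mu]_x (\1_A x * u x)%:E = \int[mu]_(x in A) (u x)%:E)%E.
  rewrite [RHS]integral_mkcond; apply: eq_integral => x _; rewrite patchE indicE.
  by case: ifP => _; rewrite ?mul1r ?mul0r.
have mrestr (u : mR -> R) (A : set mR) : measurable A -> measurable_fun setT u ->
    measurable_fun setT (fun x => (\1_A x * u x)%:E).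
  by move=> mA mu'; apply/measurable_EFinP; apply: measurable_funM => //; exact: measurable_indic.
have rectangle (A C : set mR) : measurable A -> measurable C ->
    (\int[@plane_measure R]_(q in A `*` C) (v q)%:E =
     \int[mu]_(y in C) (v2 y)%:E * \int[mu]_(x in A) (v1 x)%:E)%E.
  move=> mA mC.
  pose g (q : mR * mR) : \bar R := ((\1_C q.2 * v2 q.2)%:E * (\1_A q.1 * v1 q.1)%:E)%E.
  have mg : measurable_fun setT g.
    apply: emeasurable_funM.
      by apply: (measurableT_comp (mrestr _ _ mC mv2)); exact: measurable_snd.
    by apply: (measurableT_comp (mrestr _ _ mA mv1)); exact: measurable_fst.
  have g0 q : (0 <= g q)%E by rewrite mule_ge0// lee_fin mulr_ge0.
  transitivity (\int[@plane_measure R]_q g q)%E.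
    rewrite integral_mkcond; apply: eq_integral => q _; rewrite patchE /g /v !indicE in_setX.
    by case: (q.1 \in A) (q.2 \in C) => -[]; rewrite /= ?mul1r ?mul0r ?EFinM ?mule0 ?mul0e.
  rewrite (@fubini_tonelli1 _ _ mR mR R mu mu g mg g0) /fubini_F -(restr v2 C) -(restr v1 A).
  rewrite -ge0_integralZl//; last 3 first.
  - exact: mrestr.
  - by move=> x _; rewrite lee_fin mulr_ge0.
  - by apply: integral_ge0 => x _; rewrite lee_fin mulr_ge0.
  apply: eq_integral => x _; rewrite -ge0_integralZr//.
  - exact: mrestr.
  - by move=> y _; rewrite lee_fin mulr_ge0.
  - by rewrite lee_fin mulr_ge0.
have tr (A : set (mR * mR)) : measurable A ->
   (\int[P]_(w in X @^-1` A) (\1_E w)%:E = \int[@plane_measure R]_(q in A) (v q)%:E)%E.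
  move=> mA.
  change (image_density P mX mw w0 A = image_density (@plane_measure R) mid mv v0 A).
  (* The constant cover by the whole plane is admissible because P is finite. *)
  apply: (@measure_unique _ R (mR * mR)%type [set A `*` B | A in measurable & B in measurable] (fun=> setT)) => //.
  - by rewrite measurable_prod_measurableType.
  - move=> _ _ [A1 mA1 [B1 mB1 <-]] [A2 mA2 [B2 mB2 <-]].
    rewrite -setXI; exists (A1 `&` A2); first exact: measurableI.
    by exists (B1 `&` B2) => //; exact: measurableI.
  - by move=> _; exists setT => //; exists setT => //; rewrite setXTT.
  - by rewrite bigcup_const.
  - move=> _ [A1 mA1 [C1 mC1 <-]].
    transitivity (P (E `&` (X1 @^-1` A1 `&` X2 @^-1` C1))).
      exact: (iE _ (measurableX mA1 mC1)).
    rewrite law//; apply/esym.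
    exact: rectangle.
  - move=> k; apply: le_lt_trans (_ : (P setT < +oo)%E); last by rewrite -ge0_fin_numE// fin_num_measure.
    apply: le_trans (_ : P (E `&` X @^-1` setT) <= _)%E; first by rewrite -iE.
    by apply: le_measure; rewrite ?inE//; apply: measurableI => //; exact: mXA.
transitivity (\int[@plane_measure R]_q (h q * (v q)%:E))%E.
  rewrite -(@integral_transfer R _ _ _ _ P (@plane_measure R) X (\1_E) v)//.
  rewrite [LHS]integral_mkcond; apply: eq_integral => w _; rewrite patchE indicE.
  by case: ifP => _; rewrite ?mule1 ?mule0.
rewrite (@fubini_tonelli1 _ _ mR mR R mu mu).
- apply: eq_integral => x _; rewrite /fubini_F.
  rewrite -ge0_integralZr//; last 3 first.
  + apply: emeasurable_funM; last exact/measurable_EFinP.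
    by apply: (measurableT_comp mh); exact: measurable_fun_pair.
  + by move=> y _; rewrite mule_ge0 ?lee_fin.
  + by rewrite lee_fin.
  by apply: eq_integral => y _; rewrite /v/= EFinM muleA.
- by apply: emeasurable_funM => //; exact/measurable_EFinP.
- by move=> q; rewrite mule_ge0 ?lee_fin.
Qed.

End JointDensity.

(** * Limits of integrals with possibly infinite arguments *)

Section LimitTools.
Variable R : realType.

Lemma bounded_cvg_integral d (T : measurableType d) (m : {finite_measure set T -> \bar R})
    (D : set T) (f_ : nat -> T -> R) (f : T -> R) :
  measurable D -> (forall n, measurable_fun D (f_ n)) ->
  (forall n x, D x -> `|f_ n x| <= 1) ->
  (forall x, D x -> f_ n x @[n --> \oo] --> f x) ->
  (\int[m]_(x in D) (f_ n x)%:E)%E @[n --> \oo] --> (\int[m]_(x in D) (f x)%:E)%E.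
Proof.
move=> mD mf_ f1 ff; apply: (@dominated_cvg _ T R m D mD _ _ (cst 1%E)) => //.
- by move=> n; exact/measurable_EFinP.
- by move=> x Dx; apply: cvg_EFin; [exact: nearW|exact: ff].
- exact: finite_measure_integrable_cst.
Qed.

(** For phi vanishing at +oo the value 0 is the limit, so convergence of loads to +oo is covered.
    For [cst 1] this is the indicator of finite values. *)
Definition ext0 (phi : R -> R) (u : \bar R) : R := if u is r%:E then phi r else 0.

Lemma ext0_cvg (phi : R -> R) (u_ : R^nat) (u : \bar R) :
  continuous phi -> phi x @[x --> +oo] --> (0 : R) ->
  (0 <= u)%E -> (u_ n)%:E @[n --> \oo] --> u -> phi (u_ n) @[n --> \oo] --> ext0 phi u.
Proof.
move=> cphi phi0; case: u => [r _|_|//] /=.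
  by move=> /fine_cvgP[_ ur]; apply: continuous_cvg => //; exact: cphi.
by move=> /cvgeryP uy; apply: (cvg_comp _ _ uy phi0).
Qed.

Lemma measurable_ext0 (phi : R -> R) : measurable_fun setT phi -> measurable_fun setT (ext0 phi).
Proof.
move=> mphi; pose D : set (\bar R) := ~` ([set +oo%E] `|` [set -oo%E]).
rewrite (_ : ext0 phi = (fun u => phi (fine u) * \1_D u)).
  apply: measurable_funM; first exact: (measurableT_comp mphi).
  by apply: measurable_indic; apply: measurableC; apply: measurableU; exact: emeasurable_set1.
apply/funext => -[r||] /=; rewrite indicE.
- by rewrite mem_set ?mulr1// => -[].
- by rewrite memNset ?mulr0//; apply; left.
- by rewrite memNset ?mulr0//; apply; right.
Qed.

Import HBNNSimple.

(** A simple integrand gives a finite combination of the functions M x B; monotone convergence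
    reaches all nonnegative integrands. *)
Lemma measurable_integral_family d d' (X : measurableType d) (Y : measurableType d')
    (M : X -> {measure set Y -> \bar R}) (f : Y -> \bar R) :
  (forall B, measurable B -> measurable_fun [set: X] (fun x => M x B : \bar R)) ->
  measurable_fun setT f -> (forall y, (0 <= f y)%E) ->
  measurable_fun setT (fun x => \int[M x]_y f y)%E.
Proof.
move=> mM mf f0; pose g := nnsfun_approx measurableT mf.
apply: (emeasurable_fun_cvg (fun n x => \int[M x]_y (g n y)%:E)%E) => //.
- move=> n; rewrite (_ : (fun x => _) = (fun x => \sum_(r \in range (g n)) r%:E * M x (g n @^-1` [set r])))%E.
    under eq_fun do rewrite (fsbig_finite _ _ (fimfunP (g n))).
    apply: emeasurable_sum => r; apply: measurable_funeM; apply: mM.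
    exact: measurable_sfunP.
  by apply/funext => x; rewrite integralT_nnsfun sintegralE.
- move=> x _.
  rewrite (_ : (\int[M x]_y f y)%E = (\int[M x]_y limn (fun n => (g n y)%:E))%E); last first.
    apply: eq_integral => y _; apply/esym/cvg_lim => //.
    exact: (@cvg_nnsfun_approx _ _ _ _ measurableT _ mf (fun y _ => f0 y) y).
  apply: cvg_monotone_convergence => //.
  + by move=> n; exact/measurable_EFinP.
  + by move=> n y _; rewrite lee_fin.
  + by move=> y _ n n' nn; rewrite lee_fin; exact/lefP/nd_nnsfun_approx.
Qed.

End LimitTools.

(** * Term-by-term integration of power series *)

Section PowerSeriesIntegral.
Variable R : realType.

(** The Poisson generating function: splitting exp(-u) as exp(-(1 - z) u) exp(-z u) leaves Poisson
    probabilities of mean z u, which sum to 1. *)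
Lemma pois_term_series (z u : R) :
  series (fun m => pois_term m u * z ^+ m) @ \oo --> expR (- ((1 - z) * u)).
Proof.
rewrite (_ : series _ = (fun n => expR (- ((1 - z) * u)) * series (fun m => pois_term m (z * u)) n)).
  rewrite -[X in _ --> X]mulr1; apply: cvgM; first exact: cvg_cst.
  exact: series_pois_term.
apply/funext => n; rewrite /series/= mulr_sumr; apply: eq_bigr => m _.
have e : expR (- u) = expR (- ((1 - z) * u)) * expR (- (z * u)).
  by rewrite -expRD; congr expR; ring.
by rewrite /pois_term e exprMn; ring.
Qed.

Section OneSeries.
Variables (d : measure_display) (T : measurableType d) (m : {measure set T -> \bar R})
  (D : set T) (f : nat -> T -> R) (h : R -> T -> R) (S : R -> R).
Hypotheses (mD : measurable D) (mf : forall n, measurable_fun D (f n))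
  (f0 : forall n x, D x -> 0 <= f n x)
  (fh : forall z x, 0 <= z < 1 -> D x -> series (fun n => f n x * z ^+ n) @ \oo --> h z x)
  (hS : forall z, 0 <= z < 1 -> (\int[m]_(x in D) (h z x)%:E = (S z)%:E)%E).

Let I n := (\int[m]_(x in D) (f n x)%:E)%E.

Let I0 n : (0 <= I n)%E.
Proof. by apply: integral_ge0 => x Dx; rewrite lee_fin f0. Qed.

Let partial_cvg z : 0 <= z < 1 ->
  (\sum_(0 <= n < N) I n * (z ^+ n)%:E)%E @[N --> \oo] --> (S z)%:E.
Proof.
move=> z01; have z0 : 0 <= z by case/andP: z01.
have E N : (\sum_(0 <= n < N) I n * (z ^+ n)%:E =
    \int[m]_(x in D) (series (fun n => f n x * z ^+ n)%R N)%:E)%E.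
  under [RHS]eq_integral do rewrite /series/= -sumEFin.
  rewrite ge0_integral_sum//; last 2 first.
  - by move=> n; apply/measurable_EFinP; exact: measurable_funM.
  - by move=> n x Dx; rewrite lee_fin mulr_ge0 ?f0 ?exprn_ge0.
  apply: eq_bigr => n _; under [RHS]eq_integral do rewrite EFinM.
  rewrite ge0_integralZr//; first exact/measurable_EFinP.
  - by move=> x Dx; rewrite lee_fin f0.
  - by rewrite lee_fin exprn_ge0.
rewrite (_ : (fun N => _) = (fun N => \int[m]_(x in D) (series (fun n => f n x * z ^+ n)%R N)%:E)%E); last first.
  by apply/funext => N; exact: E.
rewrite -hS// (_ : (\int[m]_(x in D) (h z x)%:E)%E =
  (\int[m]_(x in D) limn (fun N => (series (fun n => f n x * z ^+ n)%R N)%:E))%E); last first.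
  apply: eq_integral => x; rewrite inE => Dx; apply/esym/cvg_lim => //.
  by apply: cvg_EFin; [exact: nearW|exact: fh].
apply: cvg_monotone_convergence => //.
- move=> N; apply/measurable_EFinP; apply: measurable_sum => n; exact: measurable_funM.
- by move=> N x Dx; rewrite lee_fin sumr_ge0// => n _; rewrite mulr_ge0 ?f0 ?exprn_ge0.
- move=> x Dx N N' NN; rewrite lee_fin; move: N N' NN; apply/nondecreasing_seqP => n.
  by rewrite /series/= big_nat_recr//= lerDl mulr_ge0 ?f0 ?exprn_ge0.
Qed.

(** All terms being nonnegative, one infinite coefficient would make the integrated series infinite
    at z = 1/2, where its sum is the real number S(1/2). *)
Lemma integral_coef_fin_num n : (\int[m]_(x in D) (f n x)%:E)%E \is a fin_num.
Proof.
rewrite ge0_fin_numE; last exact: I0.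
rewrite ltey; apply/eqP => Iy.
have z01 : 0 <= (2^-1 : R) < 1 by rewrite invr_ge0 ler0n invf_lt1 ?ltr1n.
have cvy : (\sum_(0 <= n < N) I n * (2^-1 ^+ n)%:E)%E @[N --> \oo] --> (+oo%E : \bar R).
  apply: cvg_near_cst; near=> N.
  have nN : (n < N)%N by near: N; exact: nbhs_infty_gt.
  rewrite (bigD1_seq n)/= ?mem_index_iota ?iota_uniq//.
  rewrite [I n]Iy gt0_mulye ?lte_fin ?exprn_gt0 ?invr_gt0// addye//.
  rewrite gt_eqF//; apply: lt_le_trans (_ : 0 <= _)%E; first exact: ltNy0.
  by apply: sume_ge0 => i _; rewrite mule_ge0// lee_fin exprn_ge0// invr_ge0.
have : (S 2^-1)%:E = +oo%E by exact: (cvg_unique _ (partial_cvg z01) cvy).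
by [].
Unshelve. all: by end_near. Qed.

Lemma integral_coef_series z : 0 <= z < 1 ->
  series (fun n => fine (\int[m]_(x in D) (f n x)%:E)%E * z ^+ n) @ \oo --> S z.
Proof.
move=> z01.
rewrite (_ : series _ = fine \o (fun N => \sum_(0 <= n < N) I n * (z ^+ n)%:E)%E).
  by apply: fine_cvg; exact: partial_cvg.
apply/funext => N /=; rewrite (eq_bigr (fun n => (fine (I n) * z ^+ n)%:E)).
  by rewrite sumEFin.
by move=> n _; rewrite EFinM fineK//; exact: integral_coef_fin_num.
Qed.

End OneSeries.

Lemma measure_eq_off_null d (T : measurableType d) (m : {measure set T -> \bar R}) (X Y N : set T) :
  measurable X -> measurable Y -> measurable N -> m N = 0%E ->
  (forall w, ~ N w -> X w <-> Y w) -> m X = m Y.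
Proof.
have key (X' Y' : set T) : measurable X' -> measurable Y' -> measurable N -> m N = 0%E ->
    (forall w, ~ N w -> X' w -> Y' w) -> (m X' <= m Y')%E.
  move=> mX mY mN N0 XY; apply: le_trans (_ : m (Y' `|` N) <= _)%E.
    apply: le_measure; rewrite ?inE//; first exact: measurableU.
    by move=> w Xw; have [Nw|nN] := pselect (N w); [right|left; exact: XY].
  by apply: (le_trans (measureU2 _ _ _)) => //; rewrite [X in (_ + X)%E]N0 adde0.
move=> mX mY mN N0 XY; apply/eqP; rewrite eq_le; apply/andP; split; apply: key => //.
  by move=> w nN; have [] := XY w nN.
by move=> w nN; have [] := XY w nN.
Qed.

End PowerSeriesIntegral.

(** * The network model *)

Section StarModel.
Variables (R : realType) (lam PB Cr thr thI dc n0sq alpha betaT a_c a_t tau : R) (k : nat).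
Variables (d : measure_display) (Omega : measurableType d) (P : probability Omega R)
  (r1 : Omega -> R) (chi : Omega -> bool) (G : Omega -> R)
  (NT NR : Omega -> {measure set ((R * R) * R) -> \bar R}).
Hypotheses (lam0 : 0 < lam) (PB0 : 0 < PB) (Cr0 : 0 < Cr) (thr0 : 0 < thr)
  (thI0 : 0 < thI) (dc0 : 0 < dc) (n00 : 0 <= n0sq) (alpha2 : 2 < alpha)
  (k1 : (1 <= k)%N) (bT : 0 < betaT < 1) (tau0 : 0 < tau) (act : a_t * tau < a_c).
Hypotheses (mr1 : measurable_fun setT r1) (mG : measurable_fun setT G)
  (mchi : measurable [set w | chi w]).
Hypothesis mNT : forall B, measurable B ->
  measurable_fun [set: Omega] (fun w => NT w B : \bar R).
Hypothesis mNR : forall B, measurable B ->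
  measurable_fun [set: Omega] (fun w => NR w B : \bar R).
Hypothesis law : forall (A C : set R) (c : bool)
          (n n' : nat) (B : 'I_n -> set ((R * R) * R)) (kk : 'I_n -> nat)
          (B' : 'I_n' -> set ((R * R) * R)) (kk' : 'I_n' -> nat),
      measurable A -> measurable C ->
      (forall i, measurable (B i) /\ bounded_ground (B i)) ->
      (forall i j, i != j -> B i `&` B j = set0) ->
      (forall i, measurable (B' i) /\ bounded_ground (B' i)) ->
      (forall i j, i != j -> B' i `&` B' j = set0) ->
      P [set w | A (r1 w) /\ chi w = c /\ C (G w) /\
                 (forall i, NT w (B i) = ((kk i)%:R)%:E) /\
                 (forall j, NR w (B' j) = ((kk' j)%:R)%:E)]
      = ((2^-1)%:E
         * (\int[@lebesgue_measure R]_(y in C) (gamma_pdf k thr y)%:E)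
         * \int[@lebesgue_measure R]_(r in A)
              (r1_pdf lam r
               * (\prod_(i < n) pois_pmf (fine (ppp_mean lam thI r (B i))) (kk i))
               * (\prod_(j < n') pois_pmf (fine (ppp_mean lam thI r (B' j))) (kk' j)))%:E)%E.

Notation mR := (measurableTypeR R).
Notation mu := (@lebesgue_measure R).
Notation pos := (`]0%R, +oo[%classic : set R).

Let mpos : measurable (pos : set mR).
Proof. exact: (@measurable_itv R). Qed.

Let mid : measurable_fun setT (fun t : mR => t : R).
Proof. exact: (@measurable_id _ R). Qed.

Let mXr1 : measurable_fun setT (r1 : Omega -> mR).
Proof. exact: mr1. Qed.

Let mXG : measurable_fun setT (G : Omega -> mR).
Proof. exact: mG. Qed.

Let mchiE c : measurable [set w | chi w = c].
Proof.
case: c; first exact: mchi.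
rewrite (_ : mkset _ = ~` [set w | chi w]); first exact: measurableC.
by apply/seteqP; split => w /=; case: (chi w).
Qed.

Lemma r1_pdf_ge0 r : 0 <= r1_pdf lam r.
Proof.
rewrite /r1_pdf; case: ifP => // r0; rewrite mulr_ge0 ?expR_ge0// mulr_ge0//.
by rewrite mulr_ge0 ?(ltW lam0)// mulr_ge0 ?pi_ge0.
Qed.

Lemma measurable_r1_pdf : measurable_fun setT (r1_pdf lam : mR -> R).
Proof.
apply: measurable_fun_if => //; first exact: measurable_fun_ler.
apply: measurable_funTS; apply: measurable_funM; first exact: measurable_funM.
apply: measurableT_comp => //; apply: measurableT_comp => //; apply: measurable_funM => //.
Qed.

Lemma gamma_pdf_ge0 y : 0 <= gamma_pdf k thr y.
Proof.
rewrite /gamma_pdf; case: ifP => // y0.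
by rewrite divr_ge0 ?mulr_ge0 ?exprn_ge0 ?expR_ge0// ltW.
Qed.

Lemma measurable_gamma_pdf : measurable_fun setT (gamma_pdf k thr : mR -> R).
Proof.
apply: measurable_fun_if => //; first exact: measurable_fun_ler.
apply: measurable_funTS; apply: measurable_funM => //; apply: measurable_funM.
  exact: measurable_funX.
by apply: measurableT_comp => //; apply: measurableT_comp => //; exact: measurable_funM.
Qed.

Lemma integral_gamma_pdf (y : R) : 0 <= y ->
  (\int[mu]_x ((if y <= x then 1 else 0)%:E * (gamma_pdf k thr x)%:E) =
   (gamma_sf k (y / thr))%:E)%E.
Proof.
move=> y0; rewrite -gamma_pdf_tail// [RHS]integral_mkcond; apply: eq_integral => x _.
rewrite patchE mem_setE in_itv/= andbT.
by case: ifP => _; rewrite ?mul1e ?mul0e.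
Qed.

Lemma gamma_sf0 : gamma_sf k 0 = 1 :> R.
Proof.
case: k k1 => // k' _; rewrite /gamma_sf big_ord_recl big1 => [|i _].
  by rewrite /pois_term oppr0 expR0 expr0 fact0 divr1 mulr1 addr0.
by rewrite /pois_term /bump/= exprS mul0r mul0r mulr0.
Qed.

Lemma integral_gamma_pdfT : (\int[mu]_x (gamma_pdf k thr x)%:E = 1)%E.
Proof.
rewrite -gamma_sf0 -(mul0r thr^-1) -integral_gamma_pdf//; apply: eq_integral => x _.
by rewrite /gamma_pdf; case: ifP; rewrite ?mul1e ?mul0e.
Qed.

(** Mode c with a positive serving distance: Campbell's formula and the threshold inequality need r1
    > 0, and the complementary distances have probability 0. *)
Definition good_event c : set Omega := [set w | chi w = c /\ 0 < r1 w].

Lemma measurable_good_event c : measurable (good_event c).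
Proof.
rewrite (_ : good_event c = [set w | chi w = c] `&` r1 @^-1` pos).
  by apply: measurableI => //; rewrite -[X in measurable X]setTI; exact: (mXr1 measurableT mpos).
by apply/seteqP; split => w /=; rewrite in_itv/= andbT.
Qed.

(** * Loads built from finitely many disjoint bounded sets *)

Section FixedFamily.
Variables (N : nat) (a : 'I_N -> R) (B : 'I_N -> set ((R * R) * R)).
Hypotheses (a0 : forall i, 0 <= a i)
  (mB : forall i, measurable (B i)) (bB : forall i, bounded_ground (B i))
  (dB : forall i j, i != j -> B i `&` B j = set0).

Definition count_event c (f f' : 'I_N -> nat) : set Omega :=
  [set w | good_event c w /\ ((forall i, NT w (B i) = ((f i)%:R)%:E) /\
                              (forall i, NR w (B i) = ((f' i)%:R)%:E))].

Let meanB i (r : R) : R := fine (ppp_mean lam thI r (B i)).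

Definition count_weight (f : 'I_N -> nat) (r : R) : R :=
  \prod_(i < N) pois_pmf (meanB i r) (f i).

(** The density of [r1] on [good_event c]; the factor 1/2 is the probability of the mode, the same
    for both. *)
Definition half_density (r : R) : R := 2^-1 * (\1_pos r * r1_pdf lam r).

Lemma half_density_ge0 r : 0 <= half_density r.
Proof. by rewrite mulr_ge0 ?invr_ge0// mulr_ge0 ?r1_pdf_ge0. Qed.

Lemma measurable_half_density : measurable_fun setT (half_density : mR -> R).
Proof.
apply: measurable_funM => //; apply: measurable_funM; last exact: measurable_r1_pdf.
exact: measurable_indic.
Qed.

Let meanB_ge0 i r : 0 <= meanB i r.
Proof.
rewrite fine_ge0//; apply: integral_ge0 => p _; rewrite lee_fin.
exact: (ppp_density_ge0 lam0 thI0).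
Qed.

Let mmeanB i : measurable_fun setT (meanB i : mR -> R).
Proof.
apply: (@measurableT_comp _ _ _ _ _ _ (@fine R)) => //.
by apply: measurable_ppp_mean => //; exact: mB.
Qed.

Lemma pois_pmf_ge0 (m : R) n : 0 <= m -> 0 <= pois_pmf m n.
Proof. by move=> m0; rewrite mulr_ge0 ?expR_ge0// divr_ge0 ?exprn_ge0. Qed.

Lemma count_weight_ge0 f r : 0 <= count_weight f r.
Proof. by apply: prodr_ge0 => i _; exact: pois_pmf_ge0. Qed.

Lemma measurable_count_weight f : measurable_fun setT (count_weight f : mR -> R).
Proof.
apply: measurable_prod => i _; apply: measurable_funM.
  by apply: measurable_funM => //; exact: measurable_funX.
by apply: measurableT_comp => //; exact: measurableT_comp.
Qed.

Let measurable_level (M : Omega -> {measure set ((R * R) * R) -> \bar R}) (f : 'I_N -> nat) :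
  (forall B, measurable B -> measurable_fun [set: Omega] (fun w => M w B : \bar R)) ->
  measurable [set w | forall i, M w (B i) = ((f i)%:R)%:E].
Proof.
move=> mM; rewrite (_ : mkset _ = \bigcap_(i in [set: 'I_N]) [set w | M w (B i) = ((f i)%:R)%:E]).
  apply: fin_bigcap_measurable => // i _; rewrite -[X in measurable X]setTI.
  by apply: (mM _ (mB i) measurableT [set ((f i)%:R)%:E]); exact: emeasurable_set1.
by apply/seteqP; split => w /= h; [move=> i _; exact: h|move=> i; exact: h].
Qed.

Lemma measurable_count_event c f f' : measurable (count_event c f f').
Proof.
apply: measurableI; first exact: measurable_good_event.
by apply: measurableI; exact: measurable_level.
Qed.

Lemma count_event_law c f f' (A C : set mR) : measurable A -> measurable C ->
  P (count_event c f f' `&` (r1 @^-1` A `&` G @^-1` C)) =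
  (\int[mu]_(y in C) (gamma_pdf k thr y)%:E *
   \int[mu]_(r in A) (half_density r * (count_weight f r * count_weight f' r))%:E)%E.
Proof.
move=> mA mC.
have E : count_event c f f' `&` (r1 @^-1` A `&` G @^-1` C) =
   [set w | (A `&` pos) (r1 w) /\ chi w = c /\ C (G w) /\
                 (forall i, NT w (B i) = ((f i)%:R)%:E) /\
                 (forall j, NR w (B j) = ((f' j)%:R)%:E)].
  apply/seteqP; split => w /=; rewrite in_itv/= andbT.
    by move=> [[[? ?] [? ?]] [? ?]].
  by move=> [[? ?] [? [? [? ?]]]].
have BB i := conj (mB i) (bB i).
rewrite E (@law (A `&` pos) C c N N B f B f' (measurableI _ _ mA mpos) mC BB dB BB dB).
rewrite muleAC muleC; congr (_ * _)%E.
rewrite -ge0_integralZl//; last 3 first.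
- by apply: measurableI.
- apply/measurable_EFinP; apply: measurable_funTS.
  apply: measurable_funM; last exact: measurable_count_weight.
  by apply: measurable_funM; [exact: measurable_r1_pdf|exact: measurable_count_weight].
- move=> r _; rewrite lee_fin; apply: mulr_ge0; last exact: count_weight_ge0.
  by apply: mulr_ge0; [exact: r1_pdf_ge0|exact: count_weight_ge0].
rewrite integral_mkcond [RHS]integral_mkcond; apply: eq_integral => r _.
rewrite !patchE in_setI /half_density indicE.
case: (r \in A) => //=; case: (r \in pos).
  by rewrite -EFinM mul1r !mulrA.
by rewrite mul0r mulr0 mul0r.
Qed.

Lemma count_event_integral c f f' (h : mR * mR -> \bar R) :
  measurable_fun setT h -> (forall q, (0 <= h q)%E) ->
  (\int[P]_(w in count_event c f f') h (r1 w, G w) =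
   \int[mu]_x ((\int[mu]_y (h (x, y) * (gamma_pdf k thr y)%:E)) *
               (half_density x * (count_weight f x * count_weight f' x))%:E))%E.
Proof.
move=> mh h0; apply: (@joint_density_integral R _ _ P r1 G) => //.
- exact: measurable_count_event.
- apply: measurable_funM; first exact: measurable_half_density.
  by apply: measurable_funM; exact: measurable_count_weight.
- exact: measurable_gamma_pdf.
- by move=> r; rewrite mulr_ge0 ?half_density_ge0// mulr_ge0 ?count_weight_ge0.
- exact: gamma_pdf_ge0.
- exact: count_event_law.
Qed.

(** Once all counts are fixed the load depends on [r1] alone, so G can be integrated first, against
    a threshold t(r1). The inequality is nonstrict because it is this form that survives increasing
    limits of loads. *)
Lemma count_event_tail c f f' (t : mR -> R) :
  measurable_fun setT t -> (forall x, 0 <= t x) ->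
  (\int[P]_(w in count_event c f f') (if (t (r1 w) <= G w)%R then 1 else 0)%:E =
   \int[P]_(w in count_event c f f') (gamma_sf k (t (r1 w) / thr))%:E)%E.
Proof.
move=> mt t0.
pose h1 (q : mR * mR) : \bar R := (if t q.1 <= q.2 then 1 else 0)%:E.
pose h2 (q : mR * mR) : \bar R := (gamma_sf k (t q.1 / thr))%:E.
have mh1 : measurable_fun setT h1.
  apply/measurable_EFinP; apply: measurable_fun_if => //; apply: measurable_fun_ler.
    by apply: (measurableT_comp mt); exact: measurable_fst.
  by apply: (measurableT_comp mid); exact: measurable_snd.
have mh2 : measurable_fun setT h2.
  apply/measurable_EFinP; apply: (@measurableT_comp _ _ _ _ _ _ (@gamma_sf R k)).
    by apply: continuous_measurable_fun; exact: continuous_gamma_sf.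
  by apply: measurable_funM => //; apply: (measurableT_comp mt); exact: measurable_fst.
have h10 q : (0 <= h1 q)%E by rewrite lee_fin; case: ifP.
have h20 q : (0 <= h2 q)%E by rewrite lee_fin gamma_sf_ge0// divr_ge0// ltW.
rewrite (count_event_integral c f f' mh1 h10) (count_event_integral c f f' mh2 h20).
apply: eq_integral => x _; congr (_ * _)%E.
rewrite /h1 /h2/= integral_gamma_pdf// ge0_integralZl//.
- by rewrite integral_gamma_pdfT mule1.
- by apply/measurable_EFinP; exact: measurable_gamma_pdf.
- by move=> y _; rewrite lee_fin gamma_pdf_ge0.
- by rewrite lee_fin gamma_sf_ge0// divr_ge0// ltW.
Qed.

Let F2 K : finType := ({ffun 'I_N -> 'I_K} * {ffun 'I_N -> 'I_K})%type.
Let ev c K (p : F2 K) := count_event c (fun i => p.1 i) (fun i => p.2 i).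

(** All counts are integers below K; a finite disjoint union of count events, so sums over count
    patterns stay finite until K tends to infinity. *)
Definition bounded_counts c K : set Omega := \big[setU/set0]_(p <- index_enum (F2 K)) ev c p.

Let bounded_countsP c K w : bounded_counts c K w <-> exists p : F2 K, ev c p w.
Proof.
rewrite /bounded_counts -bigcup_seq; split; first by move=> [p _ h]; exists p.
by move=> [p h]; exists p => //=; rewrite mem_index_enum.
Qed.

Lemma measurable_bounded_counts c K : measurable (bounded_counts c K).
Proof. by apply: bigsetU_measurable => p _; exact: measurable_count_event. Qed.

Let nat_inj_E (m n : nat) : ((m%:R : R)%:E = (n%:R)%:E) -> m = n.
Proof. by move=> [] /eqP; rewrite eqr_nat => /eqP. Qed.

Let integral_bounded_counts c K (phi : Omega -> \bar R) :
  measurable_fun setT phi -> (forall w, (0 <= phi w)%E) ->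
  (\int[P]_(w in bounded_counts c K) phi w =
   \sum_(p : F2 K) \int[P]_(w in ev c p) phi w)%E.
Proof.
move=> mphi phi0; rewrite /bounded_counts ge0_integral_bigsetU//.
- by move=> p; exact: measurable_count_event.
- exact: index_enum_uniq.
- move=> p q _ _ [w [[_ [h1 h2]] [_ [h3 h4]]]].
  rewrite [p]surjective_pairing [q]surjective_pairing; congr pair; apply/ffunP => i; apply/val_inj.
    by apply: nat_inj_E; rewrite -h1 h3.
  by apply: nat_inj_E; rewrite -h2 h4.
- exact: measurable_funTS.
Qed.

Let bR := (1 - betaT) * PB * Cr.
Let bT' := betaT * PB * Cr.
Let sc c (r : R) := snr_scale PB Cr thr dc alpha betaT a_c a_t tau c r.

Lemma sc_ge0 c r : 0 <= sc c r.
Proof. exact: snr_scale_ge0. Qed.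

Lemma measurable_sc c : measurable_fun setT (sc c : mR -> R).
Proof.
apply: measurable_funM => //; apply: measurable_funM => //.
by apply: measurable_funpowR; exact: measurable_funM.
Qed.

Definition simple_interference w : R :=
  \sum_(i < N) a i * (bR * fine (NT w (B i)) + bT' * fine (NR w (B i))).

Let level (f f' : 'I_N -> nat) : R := \sum_(i < N) a i * (bR * (f i)%:R + bT' * (f' i)%:R).

Let bR0 : 0 <= bR.
Proof. by case/andP: bT => _ b1; rewrite !mulr_ge0 ?subr_ge0 ?ltW. Qed.

Let bT0 : 0 <= bT'.
Proof. by case/andP: bT => b0 _; rewrite !mulr_ge0 ?ltW. Qed.

Let level_ge0 f f' : 0 <= level f f'.
Proof. by apply: sumr_ge0 => i _; rewrite mulr_ge0// addr_ge0// mulr_ge0. Qed.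

Let interference_ev c f f' w : count_event c f f' w -> simple_interference w = level f f'.
Proof. by move=> [_ [h1 h2]]; apply: eq_bigr => i _; rewrite h1 h2. Qed.

Lemma simple_interference_ge0 w : 0 <= simple_interference w.
Proof.
apply: sumr_ge0 => i _; rewrite mulr_ge0// addr_ge0// mulr_ge0// fine_ge0//.
Qed.

Lemma measurable_simple_interference : measurable_fun setT simple_interference.
Proof.
apply: measurable_sum => i; apply: measurable_funM => //; apply: measurable_funD; apply: measurable_funM => //.
  by apply: (@measurableT_comp _ _ _ _ _ _ (@fine R)) => //; exact: mNT.
by apply: (@measurableT_comp _ _ _ _ _ _ (@fine R)) => //; exact: mNR.
Qed.

Definition simple_load c w : R := sc c (r1 w) * (simple_interference w + n0sq).

Lemma simple_load_ge0 c w : 0 <= simple_load c w.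
Proof. by rewrite mulr_ge0 ?sc_ge0// addr_ge0// simple_interference_ge0. Qed.

Lemma measurable_simple_load c : measurable_fun setT (simple_load c).
Proof.
apply: measurable_funM; first exact: (measurableT_comp (measurable_sc c) mXr1).
by apply: measurable_funD => //; exact: measurable_simple_interference.
Qed.

Let bounded_counts_tail c K e : 0 <= e ->
  (\int[P]_(w in bounded_counts c K) (if (thr * simple_load c w + e <= G w)%R then 1 else 0)%:E =
   \int[P]_(w in bounded_counts c K) (gamma_sf k ((thr * simple_load c w + e) / thr))%:E)%E.
Proof.
move=> e0.
have mY : measurable_fun setT (fun w => thr * simple_load c w + e).
  by apply: measurable_funD => //; apply: measurable_funM => //; exact: measurable_simple_load.
rewrite !integral_bounded_counts//; last 4 first.
- apply/measurable_EFinP; apply: (@measurableT_comp _ _ _ _ _ _ (@gamma_sf R k)).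
    by apply: continuous_measurable_fun; exact: continuous_gamma_sf.
  exact: measurable_funM.
- move=> w; rewrite lee_fin gamma_sf_ge0// divr_ge0 ?(ltW thr0)// addr_ge0//.
  by rewrite mulr_ge0 ?(ltW thr0)// simple_load_ge0.
- by apply/measurable_EFinP; apply: measurable_fun_if => //; exact: measurable_fun_ler.
- by move=> w; rewrite lee_fin; case: ifP.
apply: eq_bigr => p _.
pose t (x : mR) : R := thr * (sc c x * (level (fun i => p.1 i) (fun i => p.2 i) + n0sq)) + e.
have mt : measurable_fun setT t.
  apply: measurable_funD => //; apply: measurable_funM => //; apply: measurable_funM => //.
  exact: measurable_sc.
have t0 x : 0 <= t x.
  by rewrite addr_ge0// mulr_ge0 ?(ltW thr0)// mulr_ge0 ?sc_ge0// addr_ge0.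
have := count_event_tail c (fun i => p.1 i) (fun i => p.2 i) mt t0.
have E w : w \in ev c p -> thr * simple_load c w + e = t (r1 w).
  by rewrite inE => h; rewrite /simple_load (interference_ev h).
move=> h; etransitivity; last etransitivity; [|exact: h|].
- by apply: eq_integral => w wp; rewrite (E w wp).
- by apply: eq_integral => w wp; rewrite (E w wp).
Qed.

(** The product of the Laplace transforms at q a_i of Poisson counts, each truncated below K.
    [wprod] is one term of the expanded product. *)
Let wsum K q r : R :=
  \prod_(i < N) \sum_(j < K) pois_pmf (meanB i r) j * expR (- (q * a i * j%:R)).

Let wprod q (f : 'I_N -> nat) r : R :=
  \prod_(i < N) (pois_pmf (meanB i r) (f i) * expR (- (q * a i * (f i)%:R))).

Let wsumE K q r : wsum K q r = \sum_(f : {ffun 'I_N -> 'I_K}) wprod q (fun i => f i) r.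
Proof. exact: (bigA_distr_bigA (fun i (j : 'I_K) => _)). Qed.

Let level_weight x s f f' r :
  expR (- (x * (s * (level f f' + n0sq)))) * (count_weight f r * count_weight f' r) =
  expR (- (x * (s * n0sq))) * (wprod (x * s * bR) f r * wprod (x * s * bT') f' r).
Proof.
rewrite /wprod /count_weight !big_split/= -!(big_morph expR (@expRD R) (@expR0 R)).
have -> : expR (- (x * (s * (level f f' + n0sq)))) = expR (- (x * (s * n0sq))) *
   (expR (\sum_(i < N) - (x * s * bR * a i * (f i)%:R)) *
    expR (\sum_(i < N) - (x * s * bT' * a i * (f' i)%:R))).
  rewrite -!expRD -big_split/= mulrDr mulrDr opprD addrC; congr (expR (_ + _)).
  rewrite /level !mulr_sumr -sumrN; apply: eq_bigr => i _; ring.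
rewrite -[LHS]mulrA mulrACA; congr (_ * (_ * _)); exact: mulrC.
Qed.

(** The load is affine in the counts, so its exponential factorises over sets and over the two
    processes; the sum over all count patterns becomes a product of sums. *)
Let bounded_counts_laplace c K x : 0 <= x ->
  (\int[P]_(w in bounded_counts c K) (expR (- (x * simple_load c w)))%:E =
   \int[mu]_r (half_density r * (expR (- (x * (sc c r * n0sq))) *
     (wsum K (x * sc c r * bR) r * wsum K (x * sc c r * bT') r)))%:E)%E.
Proof.
move=> x0; rewrite integral_bounded_counts//; last first.
  apply/measurable_EFinP; apply: measurableT_comp => //; apply: measurableT_comp => //.
  by apply: measurable_funM => //; exact: measurable_simple_load.
pose h (p : F2 K) (q : mR * mR) : \bar R :=
  (expR (- (x * (sc c q.1 * (level (fun i => p.1 i) (fun i => p.2 i) + n0sq)))))%:E.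
have mexp (v : R) : measurable_fun setT (fun r : mR => expR (- (x * (sc c r * v)))).
  apply: measurableT_comp => //; apply: measurableT_comp => //; apply: measurable_funM => //.
  by apply: measurable_funM => //; exact: measurable_sc.
transitivity (\sum_(p : F2 K) \int[mu]_r (half_density r * (expR (- (x * (sc c r * n0sq))) *
     (wprod (x * sc c r * bR) (fun i => p.1 i) r * wprod (x * sc c r * bT') (fun i => p.2 i) r)))%:E)%E.
  apply: eq_bigr => p _.
  transitivity (\int[P]_(w in ev c p) h p (r1 w, G w))%E.
    by apply: eq_integral => w; rewrite inE => wp; rewrite /h/= /simple_load (interference_ev wp).
  rewrite count_event_integral//; last 2 first.
  - by apply/measurable_EFinP; apply: (measurableT_comp (mexp _)); exact: measurable_fst.
  - by move=> q; rewrite lee_fin expR_ge0.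
  apply: eq_integral => r _; rewrite /h/= ge0_integralZl//.
  - by rewrite integral_gamma_pdfT mule1 -EFinM mulrCA level_weight.
  - by apply/measurable_EFinP; exact: measurable_gamma_pdf.
  - by move=> y _; rewrite lee_fin gamma_pdf_ge0.
have wprod_ge0 q f r : 0 <= wprod q f r.
  by apply: prodr_ge0 => i _; rewrite mulr_ge0 ?expR_ge0 ?pois_pmf_ge0.
have mwprod b f : measurable_fun setT (fun r : mR => wprod (x * sc c r * b) f r).
  apply: measurable_prod => i _; apply: measurable_funM.
    apply: measurable_funM; first by apply: measurable_funM => //; exact: measurable_funX.
    by apply: measurableT_comp => //; exact: measurableT_comp.
  apply: measurableT_comp => //; apply: measurableT_comp => //; apply: measurable_funM => //.
  apply: measurable_funM => //; apply: measurable_funM => //; apply: measurable_funM => //.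
  exact: measurable_sc.
rewrite -ge0_integral_sum//; last 2 first.
- move=> p; apply/measurable_EFinP; apply: measurable_funM; first exact: measurable_half_density.
  by apply: measurable_funM; [exact: mexp|exact: measurable_funM].
- move=> p r _; rewrite lee_fin mulr_ge0 ?half_density_ge0// mulr_ge0 ?expR_ge0//.
  exact: mulr_ge0.
apply: eq_integral => r _; rewrite sumEFin; congr EFin.
rewrite !wsumE big_distrlr/= pair_big/= !mulr_sumr.
by apply: eq_bigr.
Qed.

Let wlim q r : R := \prod_(i < N) expR (- (meanB i r * (1 - expR (- (q * a i))))).

Let wsum_term q i r (j : nat) : pois_pmf (meanB i r) j * expR (- (q * a i * j%:R)) =
  expR (- meanB i r) * exp_coeff (meanB i r * expR (- (q * a i))) j.
Proof.
rewrite /pois_pmf /exp_coeff/= exprMn -expRM_natr mulNr.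
by ring.
Qed.

Let wsum_ge0 K q r : 0 <= wsum K q r.
Proof.
apply: prodr_ge0 => i _; apply: sumr_ge0 => j _.
by rewrite mulr_ge0 ?expR_ge0 ?pois_pmf_ge0.
Qed.

Let wsum_nd q r : nondecreasing_seq (fun K => wsum K q r).
Proof.
apply/nondecreasing_seqP => K; apply: ler_prod => i _; apply/andP; split.
  by apply: sumr_ge0 => j _; rewrite mulr_ge0 ?expR_ge0 ?pois_pmf_ge0.
by rewrite big_ord_recr/= lerDl mulr_ge0 ?expR_ge0 ?pois_pmf_ge0.
Qed.

Let wsum_cvg q r : wsum K q r @[K --> \oo] --> wlim q r.
Proof.
have key (I : Type) (s : seq I) (u : I -> nat -> R) (l : I -> R) :
    (forall i, u i K @[K --> \oo] --> l i) ->
    (\prod_(i <- s) u i K) @[K --> \oo] --> \prod_(i <- s) l i.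
  move=> ul; elim: s => [|i s ih].
    rewrite (_ : (fun K => _) = cst 1); last by apply/funext => K; rewrite big_nil.
    by rewrite big_nil; exact: cvg_cst.
  rewrite (_ : (fun K => _) = (fun K => u i K * \prod_(i <- s) u i K)); last first.
    by apply/funext => K; rewrite big_cons.
  by rewrite big_cons; apply: cvgM.
apply: key => i.
rewrite (_ : (fun K => _) = (fun K => expR (- meanB i r) *
    series (exp_coeff (meanB i r * expR (- (q * a i)))) K)); last first.
  apply/funext => K; rewrite /series/= big_mkord mulr_sumr.
  by apply: eq_bigr => j _; rewrite wsum_term.
rewrite mulrBr mulr1 opprB addrC expRD.
by apply: cvgM; [exact: cvg_cst|exact: is_cvg_series_exp_coeff].
Qed.

Let mwsum K b x c : measurable_fun setT (fun r : mR => wsum K (x * sc c r * b) r).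
Proof.
apply: measurable_prod => i _; apply: measurable_sum => j; apply: measurable_funM.
  apply: measurable_funM; first by apply: measurable_funM => //; exact: measurable_funX.
  by apply: measurableT_comp => //; exact: measurableT_comp.
apply: measurableT_comp => //; apply: measurableT_comp => //; apply: measurable_funM => //.
apply: measurable_funM => //; apply: measurable_funM => //; apply: measurable_funM => //.
exact: measurable_sc.
Qed.

Let laplace_weight c x r (u v : R) : R :=
  half_density r * (expR (- (x * (sc c r * n0sq))) * (u * v)).

Let bounded_counts_laplace_cvg c x : 0 <= x ->
  (\int[P]_(w in bounded_counts c K) (expR (- (x * simple_load c w)))%:E)%E @[K --> \oo] -->
  (\int[mu]_r (laplace_weight c x r (wlim (x * sc c r * bR) r) (wlim (x * sc c r * bT') r))%:E)%E.
Proof.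
move=> x0.
pose g K (r : mR) : \bar R :=
  (laplace_weight c x r (wsum K (x * sc c r * bR) r) (wsum K (x * sc c r * bT') r))%:E.
rewrite (_ : (fun K => _) = (fun K => \int[mu]_r g K r)%E); last first.
  by apply/funext => K; exact: bounded_counts_laplace.
rewrite (_ : (\int[mu]_r _)%E = (\int[mu]_r (limn (g ^~ r)))%E); last first.
  apply: eq_integral => r _; apply/esym/cvg_lim => //.
  apply: cvg_EFin; first exact: nearW.
  apply: cvgM; first exact: cvg_cst.
  apply: cvgM; first exact: cvg_cst.
  by apply: cvgM; exact: wsum_cvg.
apply: cvg_monotone_convergence => //.
- move=> K; apply/measurable_EFinP; apply: measurable_funM; first exact: measurable_half_density.
  apply: measurable_funM; last by apply: measurable_funM; exact: mwsum.
  apply: measurableT_comp => //; apply: measurableT_comp => //; apply: measurable_funM => //.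
  by apply: measurable_funM => //; exact: measurable_sc.
- move=> K r _; rewrite lee_fin mulr_ge0 ?half_density_ge0// mulr_ge0 ?expR_ge0//.
  exact: mulr_ge0.
- move=> r _ K K' KK; rewrite lee_fin ler_wpM2l ?half_density_ge0// ler_wpM2l ?expR_ge0//.
  by rewrite ler_pM//; exact: wsum_nd.
Qed.

(** The law with empty families of test sets, so that both Poisson products are 1. *)
Lemma good_event_prob c : P (good_event c) = (\int[mu]_r (half_density r)%:E)%E.
Proof.
have Z0 (i : 'I_0) : measurable ((fun=> set0) i : set ((R * R) * R)) /\
    bounded_ground ((fun=> set0) i : set ((R * R) * R)) by case: i.
have Z1 (i j : 'I_0) : i != j -> (fun=> set0 : set ((R * R) * R)) i `&` (fun=> set0) j = set0 by case: i.
have := @law pos setT c 0 0 _ (fun=> 0%N) _ (fun=> 0%N) mpos measurableT Z0 Z1 Z0 Z1.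
rewrite (_ : mkset _ = good_event c); last first.
  apply/seteqP; split => w /=; rewrite in_itv/= andbT; first by move=> [? [? _]].
  by move=> [? ?]; split => //; split => //; split => //; split=> -[].
move=> ->; rewrite integral_gamma_pdfT mule1 -ge0_integralZl//; last 2 first.
- apply/measurable_EFinP; apply: measurable_funTS.
  by under eq_fun do rewrite !big_ord0 !mulr1; exact: measurable_r1_pdf.
- by move=> r _; rewrite !big_ord0 !mulr1 lee_fin r1_pdf_ge0.
rewrite integral_mkcond; apply: eq_integral => r _.
rewrite patchE !big_ord0 !mulr1 /half_density indicE; case: ifP => _.
  by rewrite mul1r EFinM.
by rewrite mul0r mulr0.
Qed.

Let bounded_counts_nd c : nondecreasing_seq (bounded_counts c).
Proof.
move=> K K' KK; apply/subsetPset => w /bounded_countsP[p [h [h1 h2]]].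
apply/bounded_countsP.
exists ([ffun i => widen_ord KK (p.1 i)], [ffun i => widen_ord KK (p.2 i)]).
by split => //; split => i; rewrite ffunE/=.
Qed.

Let bounded_counts_sub c K : bounded_counts c K `<=` good_event c.
Proof. by move=> w /bounded_countsP[p []]. Qed.

Let all_counts c := \bigcup_K bounded_counts c K.

Let m_all c : measurable (all_counts c).
Proof. by apply: bigcup_measurable => K _; exact: measurable_bounded_counts. Qed.

(** A random measure could take non-integer or infinite values. At Laplace argument 0 the truncated
    transforms are the probabilities of [bounded_counts], and their limit is the whole mass of
    [good_event], which leaves nothing for such values. *)
Let all_counts_full c : P (good_event c `\` all_counts c) = 0%E.
Proof.
have cv1 : P (bounded_counts c K) @[K --> \oo] --> P (all_counts c).
  apply: nondecreasing_cvg_mu => [K| |];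
    [exact: measurable_bounded_counts|exact: m_all|exact: bounded_counts_nd].
have cv2 : P (bounded_counts c K) @[K --> \oo] --> P (good_event c).
  rewrite good_event_prob; have := @bounded_counts_laplace_cvg c 0 (lexx 0).
  rewrite (_ : (fun K => _) = (fun K => P (bounded_counts c K))); last first.
    apply/funext => K; under eq_integral do rewrite mul0r oppr0 expR0.
    by rewrite integral_cst ?mul1e//; exact: measurable_bounded_counts.
  rewrite (_ : (\int[mu]_r _)%E = (\int[mu]_r (half_density r)%:E)%E)//.
  apply: eq_integral => r _; rewrite /laplace_weight /wlim !mul0r oppr0 expR0.
  by rewrite !big1 ?mulr1// => i _; rewrite mul0r oppr0 expR0 subrr mulr0 oppr0 expR0.
have eqP' : P (all_counts c) = P (good_event c) by apply: cvg_unique cv1 cv2.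
rewrite measureD//; last 2 first.
- exact: measurable_good_event.
- by rewrite -ge0_fin_numE// fin_num_measure//; exact: measurable_good_event.
rewrite setIidr; last by move=> w [K _]; exact: bounded_counts_sub.
rewrite [X in (_ - X)%E]eqP' subee// fin_num_measure//.
exact: measurable_good_event.
Qed.

Let good_event_limit c (phi : Omega -> \bar R) :
  measurable_fun setT phi -> (forall w, (0 <= phi w)%E) ->
  (\int[P]_(w in bounded_counts c K) phi w)%E @[K --> \oo] --> (\int[P]_(w in good_event c) phi w)%E.
Proof.
move=> mphi phi0; have full := all_counts_full c.
rewrite (_ : (\int[P]_(w in good_event c) phi w)%E = (\int[P]_(w in all_counts c) phi w)%E).
  apply: ge0_nondecreasing_set_cvg_integral => //.
  - exact: measurable_bounded_counts.
  - by move=> K; exact: measurable_funTS.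
rewrite (@ge0_negligible_integral _ _ _ _ _ (good_event c `\` all_counts c))//.
- rewrite setDD setIidr//; by move=> w [K _]; exact: bounded_counts_sub.
- by apply: measurableD => //; exact: measurable_good_event.
- exact: measurable_good_event.
- exact: measurable_funTS.
Qed.

Lemma counts_finite c : exists Z, [/\ measurable Z, P Z = 0%E &
  forall w, good_event c w -> ~ Z w -> forall i,
    (NT w (B i) \is a fin_num)%E /\ (NR w (B i) \is a fin_num)%E].
Proof.
exists (good_event c `\` all_counts c); split.
- by apply: measurableD; [exact: measurable_good_event|exact: m_all].
- exact: all_counts_full.
- move=> w gw nZ i; have [K _ /bounded_countsP[p [_ [-> ->]]]//] : all_counts c w.
  by apply: contrapT => h; apply: nZ.
Qed.

(** The shift e is kept for a later limit: e tending to 0 from above recovers the strict inequality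
    of the coverage event. *)
Lemma simple_tail c e : 0 <= e ->
  (\int[P]_(w in good_event c) (if (thr * simple_load c w + e <= G w)%R then 1 else 0)%:E =
   \int[P]_(w in good_event c) (gamma_sf k ((thr * simple_load c w + e) / thr))%:E)%E.
Proof.
move=> e0.
have mY : measurable_fun setT (fun w => thr * simple_load c w + e).
  by apply: measurable_funD => //; apply: measurable_funM => //; exact: measurable_simple_load.
have c1 : (\int[P]_(w in bounded_counts c K) (if (thr * simple_load c w + e <= G w)%R then 1 else 0)%:E)%E
   @[K --> \oo] --> (\int[P]_(w in good_event c) (if (thr * simple_load c w + e <= G w)%R then 1 else 0)%:E)%E.
  apply: good_event_limit; last by move=> w; rewrite lee_fin; case: ifP.
  by apply/measurable_EFinP; apply: measurable_fun_if => //; exact: measurable_fun_ler.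
have c2 : (\int[P]_(w in bounded_counts c K) (gamma_sf k ((thr * simple_load c w + e) / thr))%:E)%E
   @[K --> \oo] --> (\int[P]_(w in good_event c) (gamma_sf k ((thr * simple_load c w + e) / thr))%:E)%E.
  apply: good_event_limit.
    apply/measurable_EFinP; apply: (@measurableT_comp _ _ _ _ _ _ (@gamma_sf R k)).
      by apply: continuous_measurable_fun; exact: continuous_gamma_sf.
    exact: measurable_funM.
  move=> w; rewrite lee_fin gamma_sf_ge0// divr_ge0 ?(ltW thr0)// addr_ge0//.
  by rewrite mulr_ge0 ?(ltW thr0)// simple_load_ge0.
have E : (fun K => \int[P]_(w in bounded_counts c K) (if (thr * simple_load c w + e <= G w)%R then 1 else 0)%:E)%E =
  (fun K => \int[P]_(w in bounded_counts c K) (gamma_sf k ((thr * simple_load c w + e) / thr))%:E)%E.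
  by apply/funext => K; exact: bounded_counts_tail.
by rewrite E in c1; exact: (cvg_unique _ c1 c2).
Qed.

Hypothesis gain_bound : forall p, \sum_(i < N) a i * \1_(B i) p <= path_gain dc alpha p.

Definition simple_exponent q r : R :=
  fine (\int[@leb3 R]_p ((1 - expR (- (q * \sum_(i < N) a i * \1_(B i) p))) *
                          ppp_density lam thI r p)%:E)%E.

(** Disjointness puts each point in at most one set, so 1 - exp(-q sum a_i 1_(B i)) is linear in the
    indicators; integrating it gives the sum of the Poisson exponents. *)
Let wlimE q r : 0 < r -> 0 <= q -> wlim q r = expR (- simple_exponent q r).
Proof.
move=> r0 q0.
have mBR i : measurable (B i : set ((mR * mR) * mR)) by exact: mB.
have mdens := measurable_ppp_density lam thI r.
have split1 p : 1 - expR (- (q * \sum_(i < N) a i * \1_(B i) p)) =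
    \sum_(i < N) (1 - expR (- (q * a i))) * \1_(B i) p.
  have [[i Bi]|nB] := pselect (exists i, B i p).
    have out j : j != i -> \1_(B j) p = 0 :> R.
      move=> ji; rewrite indicE memNset// => Bj.
      by have := dB ji; rewrite -subset0 => /(_ p); apply.
    rewrite (bigD1 i)//= [in RHS](bigD1 i)//= big1 ?[X in _ = _ + X]big1.
    - by rewrite indicE mem_set// !mulr1 !addr0.
    - by move=> j ji; rewrite out// mulr0.
    - by move=> j ji; rewrite out// mulr0.
  have out j : \1_(B j) p = 0 :> R by rewrite indicE memNset// => Bj; apply: nB; exists j.
  rewrite !big1 ?mulr0 ?oppr0 ?expR0 ?subrr//; by move=> j _; rewrite out mulr0.
have c0 i : 0 <= 1 - expR (- (q * a i)).
  by rewrite subr_ge0 -expR0 ler_expR oppr_le0 mulr_ge0.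
have intE : (\int[@leb3 R]_p ((1 - expR (- (q * \sum_(i < N) a i * \1_(B i) p))) *
      ppp_density lam thI r p)%:E =
    \sum_(i < N) (1 - expR (- (q * a i)))%:E * ppp_mean lam thI r (B i))%E.
  transitivity (\int[@leb3 R]_p (\sum_(i < N) ((1 - expR (- (q * a i)))%:E *
     (\1_(B i) p * ppp_density lam thI r p)%:E)))%E.
    apply: eq_integral => p _; rewrite split1 mulr_suml -sumEFin.
    by apply: eq_bigr => i _; rewrite -mulrA EFinM.
  have mi i : measurable_fun setT (fun p : (mR * mR) * mR => (\1_(B i) p * ppp_density lam thI r p)%:E).
    by apply/measurable_EFinP; apply: measurable_funM => //; exact: measurable_indic.
  have i0 i p : (0 <= (\1_(B i) p * ppp_density lam thI r p)%:E)%E.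
    by rewrite lee_fin mulr_ge0// ppp_density_ge0.
  rewrite (@ge0_integral_sum _ _ _ (@space_measure R))//; last 2 first.
  - by move=> i; apply: measurable_funeM.
  - by move=> i p _; rewrite mule_ge0// lee_fin.
  apply: eq_bigr => i _; rewrite (@ge0_integralZl_EFin _ _ _ (@space_measure R))//.
  congr (_ * _)%E; rewrite /ppp_mean [RHS]integral_mkcond; apply: eq_integral => p _.
  by rewrite patchE indicE; case: ifP => _; rewrite ?mul1r ?mul0r.
(* Lying below the path gain, the simple gain inherits finiteness from Campbell's formula. *)
have fin : (\int[@leb3 R]_p ((1 - expR (- (q * \sum_(i < N) a i * \1_(B i) p))) *
      ppp_density lam thI r p)%:E < +oo)%E.
  apply: le_lt_trans (_ : (\int[@leb3 R]_p ((1 - expR (- (q * path_gain dc alpha p))) * ppp_density lam thI r p)%:E) < +oo)%E.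
    apply: (@ge0_le_integral _ _ _ (@space_measure R)) => //.
    - move=> p _; rewrite lee_fin mulr_ge0 ?ppp_density_ge0// subr_ge0 -expR0 ler_expR oppr_le0.
      by rewrite mulr_ge0// sumr_ge0// => i _; rewrite mulr_ge0.
    - apply/measurable_EFinP; apply: measurable_funM => //; apply: measurable_funB => //.
      apply: measurableT_comp => //; apply: measurableT_comp => //; apply: measurable_funM => //.
      by apply: measurable_sum => i; apply: measurable_funM => //; exact: measurable_indic.
    - apply/measurable_EFinP; apply: measurable_funM => //; apply: measurable_funB => //.
      apply: measurableT_comp => //; apply: measurableT_comp => //; apply: measurable_funM => //.
      exact: measurable_path_gain.
    - move=> p _; rewrite lee_fin ler_wpM2r ?ppp_density_ge0// lerD2l lerN2 ler_expR lerN2.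
      by rewrite ler_wpM2l.
  by rewrite campbell// ltry.
have m0 i : (0 <= ppp_mean lam thI r (B i))%E.
  by apply: integral_ge0 => p _; rewrite lee_fin; exact: (ppp_density_ge0 lam0 thI0).
have fini i : ((1 - expR (- (q * a i)))%:E * ppp_mean lam thI r (B i) \is a fin_num)%E.
  rewrite ge0_fin_numE ?mule_ge0 ?lee_fin//; apply: le_lt_trans fin; rewrite intE.
  rewrite (bigD1 i)//= leeDl//; apply: sume_ge0 => j _; by rewrite mule_ge0 ?lee_fin.
rewrite /simple_exponent intE.
rewrite (eq_bigr (fun i => (fine ((1 - expR (- (q * a i)))%:E * ppp_mean lam thI r (B i))%E)%:E)); last first.
  by move=> i _; rewrite fineK.
rewrite sumEFin/= /wlim -sumrN (big_morph expR (@expRD R) (@expR0 R)).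
apply: eq_bigr => i _; congr (expR (- _)); rewrite /meanB.
(* An infinite mean would force a zero coefficient, the product being finite; both sides then
   vanish. *)
have := fini i; case: (ppp_mean _ _ _ _) (m0 i) => [m||]//= _ fin_i; first by rewrite mulrC.
have [->|ne] := eqVneq (1 - expR (- (q * a i))) 0; first by rewrite mul0e mulr0.
by move: fin_i; rewrite gt0_muley// lte_fin lt_neqAle eq_sym ne c0.
Qed.

Let laplace_weightE c x r : 0 <= x ->
  laplace_weight c x r (wlim (x * sc c r * bR) r) (wlim (x * sc c r * bT') r) =
  half_density r * (expR (- (x * (sc c r * n0sq))) *
     (expR (- simple_exponent (x * sc c r * bR) r) *
      expR (- simple_exponent (x * sc c r * bT') r))).
Proof.
move=> x0; rewrite /laplace_weight; have [r0|r0] := ltP 0 r; last first.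
  by rewrite /half_density indicE memNset ?mul0r ?mulr0 ?mul0r//= in_itv/= andbT ltNge r0.
by rewrite !wlimE// mulr_ge0// mulr_ge0// sc_ge0.
Qed.

Lemma measurable_simple_laplace c x : 0 <= x ->
  measurable_fun setT (fun r : mR => half_density r * (expR (- (x * (sc c r * n0sq))) *
     (expR (- simple_exponent (x * sc c r * bR) r) *
      expR (- simple_exponent (x * sc c r * bT') r)))).
Proof.
move=> x0; rewrite (_ : (fun r => _) = (fun r : mR =>
    laplace_weight c x r (wlim (x * sc c r * bR) r) (wlim (x * sc c r * bT') r))); last first.
  by apply/funext => r; rewrite laplace_weightE.
have mw b : measurable_fun setT (fun r : mR => wlim (x * sc c r * b) r).
  apply: measurable_prod => i _; apply: measurableT_comp => //; apply: measurableT_comp => //.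
  apply: measurable_funM => //; apply: measurable_funB => //; apply: measurableT_comp => //.
  apply: measurableT_comp => //; apply: measurable_funM => //; apply: measurable_funM => //.
  by apply: measurable_funM => //; exact: measurable_sc.
apply: measurable_funM; first exact: measurable_half_density.
apply: measurable_funM; last by apply: measurable_funM; exact: mw.
apply: measurableT_comp => //; apply: measurableT_comp => //; apply: measurable_funM => //.
by apply: measurable_funM => //; exact: measurable_sc.
Qed.

Lemma simple_laplace c x : 0 <= x ->
  (\int[P]_(w in good_event c) (expR (- (x * simple_load c w)))%:E =
   \int[mu]_r (half_density r * (expR (- (x * (sc c r * n0sq))) *
     (expR (- simple_exponent (x * sc c r * bR) r) *
      expR (- simple_exponent (x * sc c r * bT') r))))%:E)%E.
Proof.
move=> x0.
have h1 := @bounded_counts_laplace_cvg c x x0.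
have h2 : (\int[P]_(w in bounded_counts c K) (expR (- (x * simple_load c w)))%:E)%E
   @[K --> \oo] --> (\int[P]_(w in good_event c) (expR (- (x * simple_load c w)))%:E)%E.
  apply: good_event_limit; last by move=> w; rewrite lee_fin expR_ge0.
  apply/measurable_EFinP; apply: measurableT_comp => //; apply: measurableT_comp => //.
  by apply: measurable_funM => //; exact: measurable_simple_load.
rewrite (cvg_unique _ h2 h1)//; apply: eq_integral => r _.
by rewrite laplace_weightE.
Qed.

End FixedFamily.

(** * Simple approximations of the path gain *)

Import HBNNSimple.

Let mgain : measurable_fun (setT : set ((R * R) * R)) (fun p => (path_gain dc alpha p)%:E).
Proof. by apply/measurable_EFinP; exact: measurable_path_gain. Qed.

Let gn n : {nnsfun ((R * R) * R)%type >-> R} := nnsfun_approx measurableT mgain n.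
Let vals n : seq R := finmap.enum_fset (fset_set (range (gn n))).
Let sz n := size (vals n).
Let a n (i : 'I_(sz n)) : R := nth 0 (vals n) i.
Let ball n : set ((R * R) * R) := [set p | norm2 p.1 <= n%:R].
(** Level sets of the n-th simple approximation, cut to a ball of radius n because the law only
    speaks of bounded sets. The growing radius keeps [hn] increasing to the full path gain. *)
Let B n (i : 'I_(sz n)) : set ((R * R) * R) := gn n @^-1` [set a i] `&` ball n.
Let hn n p : R := \sum_(i < sz n) a i * \1_(B i) p.

Let a0 n i : 0 <= @a n i.
Proof.
have : a i \in vals n by exact: mem_nth.
rewrite [_ \in _](in_fset_set (fimfunP (gn n))) inE => -[p _ <-].
exact: fun_ge0.
Qed.

Let mball n : measurable (ball n).
Proof.
have m : measurable_fun setT (fun p : (R * R) * R => norm2 p.1).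
  have h : measurable_fun setT (fun p : (mR * mR) * mR => norm2 p.1).
    by apply: (measurableT_comp (@measurable_norm2 R)); exact: measurable_fst.
  exact: h.
rewrite (_ : ball n = setT `&` (fun p : (R * R) * R => norm2 p.1) @^-1` `]-oo, n%:R]%classic).
  by apply: m => //; exact: measurable_itv.
by rewrite setTI; apply/seteqP; split => p; rewrite /= in_itv.
Qed.

Let mB n i : measurable (@B n i).
Proof. by apply: measurableI => //; exact: measurable_sfunP. Qed.

Let bB n i : bounded_ground (@B n i).
Proof. by exists n%:R => p []. Qed.

Let dB n i j : i != j -> @B n i `&` B j = set0.
Proof.
move=> ij; apply/seteqP; split => // p [[/= h1 _] [/= h2 _]].
move: ij; have : a i == a j by rewrite -h1 -h2.
rewrite /a nth_uniq ?finmap.fset_uniq// => /eqP/val_inj ->; by rewrite eqxx.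
Qed.

Let hnE n p : hn n p = gn n p * \1_(ball n) p.
Proof.
rewrite /hn fimfunE (fsbig_finite _ _ (fimfunP (gn n)))/= (big_nth 0)/= big_mkord mulr_suml.
by apply: eq_bigr => i _; rewrite indicI mulrA.
Qed.

Let hn_ge0 n p : 0 <= hn n p.
Proof. by rewrite hnE mulr_ge0. Qed.

Let hn_nd p : nondecreasing_seq (hn ^~ p).
Proof.
move=> n m nm; rewrite !hnE ler_pM//; first exact/lefP/nd_nnsfun_approx.
rewrite !indicE; case: (boolP (p \in ball n)) => // pn; rewrite mem_set//.
by move: pn; rewrite inE /ball/= => /le_trans; apply; rewrite ler_nat.
Qed.

Let hn_cvg p : hn n p @[n --> \oo] --> path_gain dc alpha p.
Proof.
have gain0 q : setT q -> (0 <= (path_gain dc alpha q)%:E)%E by rewrite lee_fin path_gain_ge0.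
have := @cvg_nnsfun_approx _ _ _ _ measurableT _ mgain gain0 p Logic.I.
move=> /fine_cvgP[_]; rewrite /= => cg.
rewrite -[X in _ --> X]mulr1 (_ : (fun n => _) = (fun n => gn n p * \1_(ball n) p)); last first.
  by apply/funext => n; rewrite hnE.
apply: cvgM; first exact: cg.
apply: cvg_near_cst; near=> n; rewrite indicE mem_set// /ball/=.
by near: n; exact: nbhs_infty_ger.
Unshelve. all: by end_near. Qed.

Let hn_le n p : hn n p <= path_gain dc alpha p.
Proof.
rewrite -(cvg_lim _ (@hn_cvg p))//; apply: (nondecreasing_cvgn_le (@hn_nd p)).
by apply/cvg_ex; eexists; exact: hn_cvg.
Qed.

Let mhn n : measurable_fun setT (hn n).
Proof.
apply: measurable_sum => i; apply: measurable_funM => //; exact: measurable_indic.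
Qed.

(** The exponential density vanishes at negative marks, so this bounded set has mean measure 0 and
    its Poisson count is almost surely 0. *)
Let neg n : set ((R * R) * R) := [set p | p.2 < 0] `&` ball n.

Let mnegset : measurable [set p : (R * R) * R | p.2 < 0].
Proof.
rewrite (_ : mkset _ = setT `&` snd @^-1` `]-oo, 0%R[%classic).
  by apply: measurable_snd => //; exact: measurable_itv.
by rewrite setTI; apply/seteqP; split => p; rewrite /= in_itv.
Qed.

Let mneg n : measurable (neg n).
Proof. exact: measurableI. Qed.

Let mark_event c n := [set w | pos (r1 w) /\ chi w = c /\ setT (G w) /\
   (forall i : 'I_1, NT w (neg n) = (0%:R)%:E) /\ (forall i : 'I_1, NR w (neg n) = (0%:R)%:E)].

Let mark_event_prob c n : P (mark_event c n) = P (good_event c).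
Proof.
have h1 (i : 'I_1) : measurable ((fun=> neg n) i) /\ bounded_ground ((fun=> neg n) i).
  by split; [exact: mneg|exists n%:R => p []].
have h2 (i j : 'I_1) : i != j -> (fun=> neg n) i `&` (fun=> neg n) j = set0 by rewrite !ord1.
rewrite (@law pos setT c 1 1 (fun=> neg n) (fun=> 0%N) (fun=> neg n) (fun=> 0%N) mpos measurableT h1 h2 h1 h2).
rewrite integral_gamma_pdfT mule1 good_event_prob.
have m0 r : ppp_mean lam thI r (neg n) = 0%E.
  apply: integral0_eq => p [/= p2 _]; rewrite /exp_pdf leNgt p2/= mulr0//.
have E r : r1_pdf lam r * (\prod_(i < 1) pois_pmf (fine (ppp_mean lam thI r (neg n))) 0) *
  (\prod_(i < 1) pois_pmf (fine (ppp_mean lam thI r (neg n))) 0) = r1_pdf lam r.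
  by rewrite !big_ord1 m0 /pois_pmf expr0 fact0 divr1 oppr0 expR0 !mulr1.
under eq_integral do rewrite E.
rewrite -ge0_integralZl//; last 2 first.
- by apply/measurable_EFinP; apply: measurable_funTS; exact: measurable_r1_pdf.
- by move=> r _; rewrite lee_fin r1_pdf_ge0.
rewrite integral_mkcond; apply: eq_integral => r _.
rewrite patchE /half_density indicE; case: ifP => _.
  by rewrite mul1r EFinM.
by rewrite mul0r mulr0.
Qed.

Let mlevel0 (M : Omega -> {measure set ((R * R) * R) -> \bar R}) n :
  (forall B, measurable B -> measurable_fun [set: Omega] (fun w => M w B : \bar R)) ->
  measurable [set w | M w (neg n) = (0%:R)%:E].
Proof.
move=> mM; rewrite -[X in measurable X]setTI.
exact: (mM _ (mneg n) measurableT [set (0%:R)%:E] (emeasurable_set1 _)).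
Qed.

Let mark_event_sub c n : mark_event c n `<=` good_event c.
Proof. by move=> w [/=]; rewrite in_itv/= andbT => ? []. Qed.

Let measurable_mark_event c n : measurable (mark_event c n).
Proof.
rewrite (_ : mark_event c n = good_event c `&`
    ([set w | NT w (neg n) = (0%:R)%:E] `&` [set w | NR w (neg n) = (0%:R)%:E])).
  apply: measurableI; first exact: measurable_good_event.
  by apply: measurableI; exact: mlevel0.
apply/seteqP; split => w.
  move=> h; have := mark_event_sub h; move: h => [_ [_ [_ [h1 h2]]]] g.
  by split => //; split; [exact: (h1 ord0)|exact: (h2 ord0)].
move=> [[h1 h2] [h3 h4]]; split; first by rewrite /= in_itv/= h2.
by split => //; split => //; split => i.
Qed.

(** Countably many null events, two for each n, are gathered into one, so that all approximations
    are meaningful at the same sample point. *)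
Let null_set c : exists Z, [/\ measurable Z, P Z = 0%E &
  forall w, good_event c w -> ~ Z w ->
    (forall n i, (NT w (@B n i) \is a fin_num)%E /\ (NR w (@B n i) \is a fin_num)%E) /\
    (forall n, NT w (neg n) = 0%E /\ NR w (neg n) = 0%E)].
Proof.
have cf n : exists Z, [/\ measurable Z, P Z = 0%E & forall w, good_event c w -> ~ Z w -> forall i,
    (NT w (@B n i) \is a fin_num)%E /\ (NR w (@B n i) \is a fin_num)%E].
  apply: (counts_finite (@a n) (@mB n) (@bB n) (@dB n)).
have [Z1 Z1P] := choice cf.
pose Z2 n := good_event c `\` mark_event c n.
have mgood : measurable (good_event c) by exact: measurable_good_event.
have mZ1 n : measurable (Z1 n) by have [] := Z1P n.
have mZ2 n : measurable (Z2 n) by apply: measurableD.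
have Z20 n : P (Z2 n) = 0%E.
  rewrite measureD//; last by rewrite -ge0_fin_numE// fin_num_measure.
  rewrite setIidr; last exact: mark_event_sub.
  by rewrite [X in (_ - X)%E]mark_event_prob subee// fin_num_measure.
exists (\bigcup_n (Z1 n `|` Z2 n)); split.
- by apply: bigcup_measurable => n _; exact: measurableU.
- apply/eqP; rewrite -measure_le0; apply: le_trans (_ : \sum_(n <oo) P (Z1 n `|` Z2 n) <= _)%E.
    apply: measure_sigma_subadditive => //; first by move=> n; exact: measurableU.
    by apply: bigcup_measurable => n _; exact: measurableU.
  rewrite eseries0// => n _ _; apply/eqP; rewrite -measure_le0.
  apply: (le_trans (measureU2 _ _ _)) => //.
  rewrite -[leRHS]adde0; apply: leeD; rewrite le_eqVlt; apply/orP; left; apply/eqP.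
    by have [_ z _] := Z1P n; exact: z.
  exact: Z20.
- move=> w gw nZ; split => n.
    have [_ _ h] := Z1P n; apply: h => // Zw; apply: nZ; exists n => //; by left.
  have : mark_event c n w by apply: contrapT => h; apply: nZ; exists n => //; right.
  by move=> [_ [_ [_ [h1 h2]]]]; split; [exact: (h1 ord0)|exact: (h2 ord0)].
Qed.

(** * The load and its Laplace transform *)

Local Notation bR := ((1 - betaT) * PB * Cr).
Local Notation bT' := (betaT * PB * Cr).
Local Notation sc := (snr_scale PB Cr thr dc alpha betaT a_c a_t tau).
Local Notation Lam := (Lambda lam PB Cr thr thI dc n0sq alpha betaT a_c a_t tau).

Let bR0 : 0 <= bR.
Proof. by case/andP: bT => _ b1; rewrite !mulr_ge0 ?subr_ge0 ?ltW. Qed.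

Let bT0 : 0 <= bT'.
Proof. by case/andP: bT => b0 _; rewrite !mulr_ge0 ?ltW. Qed.

(** Extended-real, with truncated marks, hence a monotone limit of simple interferences. The
    real-valued interference of the statement agrees with it off a null event. *)
Definition interference w : \bar R :=
  (bR%:E * (\int[NT w]_p (path_gain dc alpha p)%:E) +
   bT'%:E * (\int[NR w]_p (path_gain dc alpha p)%:E))%E.

Definition load c w : \bar R := ((sc c (r1 w))%:E * (interference w + n0sq%:E))%E.

Let gain0 (p : (R * R) * R) : (0 <= (path_gain dc alpha p)%:E)%E.
Proof. by rewrite lee_fin path_gain_ge0. Qed.

Let int_gain0 (M : {measure set ((R * R) * R) -> \bar R}) :
  (0 <= \int[M]_p (path_gain dc alpha p)%:E)%E.
Proof. exact: integral_ge0. Qed.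

Lemma interference_ge0 w : (0 <= interference w)%E.
Proof. by rewrite adde_ge0// mule_ge0// lee_fin. Qed.

Lemma load_ge0 c w : (0 <= load c w)%E.
Proof.
rewrite mule_ge0//; first by rewrite lee_fin snr_scale_ge0.
by rewrite adde_ge0// ?interference_ge0// lee_fin.
Qed.

Lemma measurable_interference : measurable_fun setT interference.
Proof.
by apply: emeasurable_funD; apply: measurable_funeM; exact: measurable_integral_family.
Qed.

Lemma measurable_load c : measurable_fun setT (load c).
Proof.
apply: emeasurable_funM; last by apply: emeasurable_funD => //; exact: measurable_interference.
apply/measurable_EFinP; apply: measurable_funM => //; apply: measurable_funM => //.
by apply: measurable_funpowR; exact: measurable_funM.
Qed.

Let sl c n w : R := simple_load (@a n) (@B n) c w.

Let sl_ge0 c n w : 0 <= sl c n w.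
Proof. exact: (simple_load_ge0 (@B n) (@a0 n)). Qed.

Let msl c n : measurable_fun setT (sl c n).
Proof. exact: (measurable_simple_load (@a n) (@mB n)). Qed.

Let sl_tail c n e : 0 <= e ->
  (\int[P]_(w in good_event c) (if (thr * sl c n w + e <= G w)%R then 1 else 0)%:E =
   \int[P]_(w in good_event c) (gamma_sf k ((thr * sl c n w + e) / thr))%:E)%E.
Proof.
move=> e0; exact: (simple_tail (@a0 n) (@mB n) (@bB n) (@dB n) c e0).
Qed.

Let weight c n x (r : mR) : R :=
  half_density r * (expR (- (x * (sc c r * n0sq))) *
     (expR (- simple_exponent (@a n) (@B n) (x * sc c r * bR) r) *
      expR (- simple_exponent (@a n) (@B n) (x * sc c r * bT') r))).

Let sl_laplace c n x : 0 <= x ->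
  (\int[P]_(w in good_event c) (expR (- (x * sl c n w)))%:E = \int[mu]_r (weight c n x r)%:E)%E.
Proof.
move=> x0; exact: (simple_laplace (@a0 n) (@mB n) (@bB n) (@dB n) (@hn_le n) c x0).
Qed.

Let mweight c n x : 0 <= x -> measurable_fun setT (weight c n x).
Proof.
move=> x0; exact: (measurable_simple_laplace (@a0 n) (@mB n) (@dB n) (@hn_le n) c x0).
Qed.

Let integral_hn (M : {measure set ((R * R) * R) -> \bar R}) n :
  (forall i, M (@B n i) \is a fin_num)%E ->
  (\int[M]_p (hn n p)%:E = (\sum_(i < sz n) a i * fine (M (B i)))%:E)%E.
Proof.
move=> fin.
transitivity (\int[M]_p \sum_(i < sz n) ((a i)%:E * (\1_(B i) p)%:E))%E.
  by apply: eq_integral => p _; rewrite /hn -sumEFin; apply: eq_bigr => i _; rewrite EFinM.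
have mi i : measurable_fun setT (fun p => (\1_(@B n i) p)%:E : \bar R).
  by apply/measurable_EFinP; apply: measurable_indic; exact: mB.
rewrite ge0_integral_sum//; last 2 first.
- by move=> i; exact: measurable_funeM.
- by move=> i p _; rewrite mule_ge0// lee_fin// a0.
rewrite -sumEFin; apply: eq_bigr => i _.
rewrite ge0_integralZl_EFin ?a0//.
by rewrite integral_indic// setIT EFinM fineK.
Qed.

Let gain_cvg (M : {measure set ((R * R) * R) -> \bar R}) :
  (\int[M]_p (hn n p)%:E)%E @[n --> \oo] --> (\int[M]_p (path_gain dc alpha p)%:E)%E.
Proof.
rewrite (_ : (\int[M]_p (path_gain dc alpha p)%:E)%E = (\int[M]_p limn (fun n => (hn n p)%:E))%E).
  apply: cvg_monotone_convergence => //.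
  - by move=> n; apply/measurable_EFinP; exact: mhn.
  - by move=> n p _; rewrite lee_fin hn_ge0.
  - by move=> p _ n m nm; rewrite lee_fin; exact: hn_nd.
apply: eq_integral => p _; apply/esym/cvg_lim => //.
by apply: cvg_EFin; [exact: nearW|exact: hn_cvg].
Qed.

(** [sl] is computed from [fine] of the counts, so it is an integral of the simple gain only where
    these counts are finite. *)
Let fin_counts w := forall n i, (NT w (@B n i) \is a fin_num)%E /\ (NR w (@B n i) \is a fin_num)%E.

Let slE c n w : fin_counts w -> (sl c n w)%:E =
  ((sc c (r1 w))%:E * ((bR%:E * \int[NT w]_p (hn n p)%:E + bT'%:E * \int[NR w]_p (hn n p)%:E) + n0sq%:E))%E.
Proof.
move=> fw; rewrite !integral_hn; [|by move=> i; have [] := fw n i|by move=> i; have [] := fw n i].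
set S1 := \sum_(i < _) _ * fine (NT w _); set S2 := \sum_(i < _) _.
transitivity ((sc c (r1 w) * (bR * S1 + bT' * S2 + n0sq))%:E)%E => //.
congr (EFin (_ * (_ + _))); rewrite /S1 /S2 !mulr_sumr -big_split/=; apply: eq_bigr => i _.
by rewrite mulrDr; congr (_ + _); rewrite mulrCA.
Qed.

Let sl_cvg c w : fin_counts w -> (sl c n w)%:E @[n --> \oo] --> load c w.
Proof.
move=> fw; rewrite (_ : (fun n => (sl c n w)%:E) = (fun n =>
  ((sc c (r1 w))%:E * ((bR%:E * \int[NT w]_p (hn n p)%:E + bT'%:E * \int[NR w]_p (hn n p)%:E) + n0sq%:E))%E)).
  apply: cvgeZl => //; apply: cvgeD; last exact: cvg_cst.
    by apply: ge0_adde_def; rewrite inE ?interference_ge0// lee_fin.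
  apply: cvgeD; first by apply: ge0_adde_def; rewrite inE mule_ge0// lee_fin.
    by apply: cvgeZl => //; exact: gain_cvg.
  by apply: cvgeZl => //; exact: gain_cvg.
by apply/funext => n; rewrite slE.
Qed.

Let sl_le c n w : fin_counts w -> ((sl c n w)%:E <= load c w)%E.
Proof.
move=> fw; rewrite slE//.
have le (M : {measure set ((R * R) * R) -> \bar R}) :
    (\int[M]_p (hn n p)%:E <= \int[M]_p (path_gain dc alpha p)%:E)%E.
  apply: ge0_le_integral => //.
  - by move=> p _; rewrite lee_fin hn_ge0.
  - by apply/measurable_EFinP; exact: mhn.
  - by move=> p _; rewrite lee_fin hn_le.
rewrite lee_wpmul2l//; first by rewrite lee_fin snr_scale_ge0.
by rewrite leeD2r// leeD// lee_wpmul2l// lee_fin.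
Qed.

Let approx c : exists H, [/\ measurable H, H `<=` good_event c,
  forall phi : Omega -> \bar R, measurable_fun setT phi -> (forall w, 0 <= phi w)%E ->
    (\int[P]_(w in good_event c) phi w = \int[P]_(w in H) phi w)%E &
  forall w, H w -> fin_counts w].
Proof.
have [Z [mZ Z0 ZP]] := null_set c; have mg : measurable (good_event c) by exact: measurable_good_event.
exists (good_event c `\` Z); split.
- exact: measurableD.
- by move=> w [].
- move=> phi mphi phi0; rewrite (@ge0_negligible_integral _ _ _ _ _ Z)//.
  exact: measurable_funTS.
- by move=> w [gw nZ]; have [] := ZP w gw nZ.
Qed.

Lemma marks_nonneg c : exists Z, [/\ measurable Z, P Z = 0%E &
  forall w, good_event c w -> ~ Z w ->
    NT w [set p | p.2 < 0] = 0%E /\ NR w [set p | p.2 < 0] = 0%E].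
Proof.
have [Z [mZ Z0 ZP]] := null_set c; exists Z; split => // w gw nZ; have [_ h] := ZP w gw nZ.
have key (M : {measure set ((R * R) * R) -> \bar R}) : (forall n, M (neg n) = 0%E) ->
    M [set p | p.2 < 0] = 0%E.
  move=> M0; apply/eqP; rewrite -measure_le0.
  apply: le_trans (_ : \sum_(n <oo) M (neg n) <= _)%E; last by rewrite eseries0.
  apply: measure_sigma_subadditive => // p p0.
  exists (Num.truncn (norm2 p.1)).+1 => //; split => //; rewrite /ball/=.
  by apply/ltW; rewrite truncnS_gt.
by split; apply: key => n; have [] := h n.
Qed.

Lemma half_density_pos r : 0 < r ->
  half_density r = pi * lam * r * expR (- (pi * lam * r ^+ 2)).
Proof.
move=> r0; rewrite /half_density indicE mem_set/=; last by rewrite in_itv/= r0.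
rewrite /r1_pdf (ltW r0) mul1r !mulrA mulVf ?mul1r//.
Qed.

Lemma half_density_npos r : r <= 0 -> half_density r = 0.
Proof.
move=> r0; rewrite /half_density indicE memNset ?mul0r ?mulr0//= in_itv/= andbT.
by rewrite ltNge r0.
Qed.

Lemma integrable_half_density : mu.-integrable setT (fun r => (half_density r)%:E).
Proof.
apply/integrableP; split; first by apply/measurable_EFinP; exact: measurable_half_density.
under eq_integral do rewrite gee0_abs ?lee_fin ?half_density_ge0//.
have <- : P (good_event true) = (\int[mu]_r (half_density r)%:E)%E by rewrite good_event_prob.
by rewrite -ge0_fin_numE// fin_num_measure//; exact: measurable_good_event.
Qed.

Let cvg_expRN (u : nat -> R) (l : R) :
  u n @[n --> \oo] --> l -> expR (- u n) @[n --> \oo] --> expR (- l).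
Proof. by move=> ul; exact: (cvg_comp _ _ (cvgN ul) (@continuous_expR R (- l))). Qed.

Let exponent_cvg q r : 0 < r -> 0 <= q ->
  simple_exponent (@a n) (@B n) q r @[n --> \oo] -->
  2^-1 * pi * lam * r ^+ 2 * (Fhyp alpha (q * thI * (r * dc) `^ (- alpha)) - 1).
Proof.
move=> r0 q0; apply: fine_cvg; rewrite -campbell//.
have mono p n m : (n <= m)%N -> (1 - expR (- (q * hn n p))) * ppp_density lam thI r p <=
    (1 - expR (- (q * hn m p))) * ppp_density lam thI r p.
  move=> nm; apply: ler_wpM2r; first exact: ppp_density_ge0.
  apply: lerB; first exact: lexx.
  by rewrite ler_expR lerN2; apply: (ler_wpM2l q0); exact: (@hn_nd p n m nm).
rewrite (_ : (\int[@leb3 R]_p ((1 - expR (- (q * path_gain dc alpha p))) * ppp_density lam thI r p)%:E)%E =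
  (\int[@leb3 R]_p limn (fun n => ((1 - expR (- (q * hn n p))) * ppp_density lam thI r p)%:E))%E); last first.
  apply: eq_integral => p _; apply/esym/cvg_lim => //.
  apply: cvg_EFin; first exact: nearW.
  apply: cvgM; last exact: cvg_cst.
  apply: cvgB; first exact: cvg_cst.
  by apply: cvg_expRN; apply: cvgM; [exact: cvg_cst|exact: hn_cvg].
apply: (@cvg_monotone_convergence _ _ _ (@space_measure R)) => //.
- move=> n; apply/measurable_EFinP; apply: measurable_funM; last exact: measurable_ppp_density.
  apply: measurable_funB => //; apply: measurableT_comp => //; apply: measurableT_comp => //.
  by apply: measurable_funM => //; exact: mhn.
- move=> n p _; rewrite lee_fin mulr_ge0 ?ppp_density_ge0// subr_ge0 -expR0 ler_expR oppr_le0.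
  by rewrite mulr_ge0// hn_ge0.
- by move=> p _ n m nm; rewrite lee_fin; exact: mono.
Qed.

Let weight_limit c x (r : R) : R := \1_pos r * (pi * lam * r * expR (Lam c r x)).

(** The factor (r dc)^alpha in [snr_scale] cancels the path loss at distance r, which is why the
    argument of F does not depend on r. *)
Let snr_interf c psi r x : 0 < r ->
  x * sc c r * (beta_of betaT psi * PB * Cr) * thI * (r * dc) `^ (- alpha) =
  interf_ratio thr thI betaT a_c a_t tau c psi * x.
Proof.
move=> r0; rewrite /snr_scale /interf_ratio powRN.
have b0 := beta_of_gt0 bT c; have t0 : 0 < a_c - a_t * tau by rewrite subr_gt0.
have p0 : 0 < (r * dc) `^ alpha by rewrite powR_gt0// mulr_gt0.
by field; rewrite !gt_eqF.
Qed.

Let weight_cvg c x r : 0 <= x -> weight c n x r @[n --> \oo] --> weight_limit c x r.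
Proof.
move=> x0; rewrite /weight /weight_limit; have [r0|r0] := ltP 0 r; last first.
  rewrite indicE memNset/=; last by rewrite in_itv/= andbT ltNge r0.
  rewrite mul0r half_density_npos//; under eq_fun do rewrite mul0r.
  exact: cvg_cst.
rewrite indicE mem_set/=; last by rewrite in_itv/= r0.
have q0 : 0 <= x * sc c r by rewrite mulr_ge0// snr_scale_ge0.
rewrite (_ : 1%:R * _ = half_density r * (expR (- (x * (sc c r * n0sq))) *
   (expR (- (2^-1 * pi * lam * r ^+ 2 * (Fhyp alpha (x * sc c r * bR * thI * (r * dc) `^ (- alpha)) - 1))) *
    expR (- (2^-1 * pi * lam * r ^+ 2 * (Fhyp alpha (x * sc c r * bT' * thI * (r * dc) `^ (- alpha)) - 1)))))).
  apply: cvgM; first exact: cvg_cst.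
  apply: cvgM; first exact: cvg_cst.
  by apply: cvgM; apply: cvg_expRN; apply: exponent_cvg => //; exact: mulr_ge0.
rewrite (snr_interf c true x r0) (snr_interf c false x r0) half_density_pos// mul1r -[RHS]mulrA.
congr (_ * _); rewrite -!expRD /Lambda -/(snr_scale _ _ _ _ _ _ _ _ _ _ _) -!/(interf_ratio _ _ _ _ _ _ _ _).
(* The exponent of the distance density is cut in two halves, one for each process; each half
   cancels the -1 in F - 1. *)
congr expR; have -> : pi * lam * r ^+ 2 = 2^-1 * pi * lam * r ^+ 2 + 2^-1 * pi * lam * r ^+ 2.
  have two : 2^-1 + 2^-1 = 1 :> R by rewrite [RHS](splitr 1) !div1r.
  by rewrite -!mulrDl two mul1r.
set h := 2^-1 * pi * lam * r ^+ 2; set F1 := Fhyp _ _; set F2 := Fhyp _ _; set s := snr_scale _ _ _ _ _ _ _ _ _ _ _.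
by move: h F1 F2 s => h F1 F2 s; ring.
Qed.

Let weight_le c n x r : 0 <= x -> `|weight c n x r| <= half_density r.
Proof.
move=> x0; rewrite ger0_norm; last by rewrite mulr_ge0 ?half_density_ge0// !mulr_ge0 ?expR_ge0.
have q0 : 0 <= x * sc c r by rewrite mulr_ge0// snr_scale_ge0.
have e0 b : 0 <= b -> 0 <= simple_exponent (@a n) (@B n) (x * sc c r * b) r.
  move=> b0; rewrite fine_ge0//; apply: integral_ge0 => p _.
  rewrite lee_fin mulr_ge0 ?ppp_density_ge0// subr_ge0 -expR0 ler_expR oppr_le0.
  by apply: mulr_ge0; [exact: mulr_ge0|exact: (hn_ge0 n p)].
have l1 y : 0 <= y -> expR (- y) <= 1 by move=> y0; rewrite -expR0 ler_expR oppr_le0.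
rewrite -[leRHS]mulr1 ler_wpM2l ?half_density_ge0//.
have m1 (u v : R) : 0 <= u -> 0 <= v -> u <= 1 -> v <= 1 -> u * v <= 1.
  by move=> u0 v0 u1 v1; rewrite -[leRHS]mulr1 ler_pM.
apply: (m1); rewrite ?mulr_ge0 ?expR_ge0//; first by apply: (l1); rewrite mulrA mulr_ge0.
by apply: (m1); rewrite ?expR_ge0//; apply: (l1); exact: (e0).
Qed.

(** Positivity of x makes exp(-x u) vanish as u grows, so the simple loads have the right limit also
    where the load is infinite. On the side of r, [half_density] dominates. *)
Lemma load_laplace c x : 0 < x ->
  (\int[P]_(w in good_event c) (ext0 (fun u => expR (- (x * u))) (load c w))%:E =
   \int[mu]_r (\1_pos r * (pi * lam * r * expR (Lam c r x)))%:E)%E.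
Proof.
move=> x0; have [H [mH Hg HP Hfin]] := approx c; have x0' := ltW x0.
have cphi : continuous (fun u : R => expR (- (x * u))).
  move=> u; apply: continuous_comp; last exact: continuous_expR.
  by apply: cvgN; apply: cvgM; [exact: cvg_cst|exact: cvg_id].
rewrite HP; last 2 first.
- apply/measurable_EFinP; apply: (measurableT_comp _ (measurable_load c)).
  by apply: measurable_ext0; exact: continuous_measurable_fun.
- by move=> w; rewrite lee_fin /ext0; case: (load c w) => // r; rewrite expR_ge0.
have c1 : (\int[P]_(w in H) (expR (- (x * sl c n w)))%:E)%E @[n --> \oo] -->
    (\int[P]_(w in H) (ext0 (fun u => expR (- (x * u))) (load c w))%:E)%E.
  apply: bounded_cvg_integral => //.
  - move=> n; apply: measurable_funTS; apply: (@measurableT_comp _ _ _ _ _ _ (fun u => expR (- (x * u)))) => //.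
    exact: continuous_measurable_fun.
  - move=> n w _; rewrite ger0_norm ?expR_ge0// -expR0 ler_expR oppr_le0.
    by rewrite mulr_ge0.
  - move=> w Hw; apply: (ext0_cvg cphi (cvg_expRNM x0) (load_ge0 c w)).
    by apply: sl_cvg; exact: Hfin.
have c2 : (\int[mu]_r (weight c n x r)%:E)%E @[n --> \oo] -->
    (\int[mu]_r (weight_limit c x r)%:E)%E.
  apply: (@dominated_cvg _ _ _ mu setT measurableT _ _ (fun r => (half_density r)%:E)) => //.
  - by move=> n; apply/measurable_EFinP; exact: mweight.
  - by move=> r _; apply: cvg_EFin; [exact: nearW|exact: weight_cvg].
  - exact: integrable_half_density.
  - by move=> n r _; rewrite abse_EFin lee_fin; exact: weight_le.
have E : (fun n => \int[P]_(w in H) (expR (- (x * sl c n w)))%:E)%E =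
    (fun n => \int[mu]_r (weight c n x r)%:E)%E.
  apply/funext => n; rewrite -sl_laplace// HP//.
    by apply/measurable_EFinP; apply: (@measurableT_comp _ _ _ _ _ _ (fun u => expR (- (x * u)))) => //;
      exact: continuous_measurable_fun.
by rewrite E in c1; exact: (cvg_unique _ c1 c2).
Qed.

(** The simple loads increase to the load, so the nonstrict event is the pointwise limit of its
    approximations: it implies all of them, and where it fails they fail eventually. A strict
    inequality could be lost at equality. *)
Lemma load_tail c e : 0 <= e ->
  (\int[P]_(w in good_event c) (if (thr%:E * load c w + e%:E <= (G w)%:E)%E then 1 else 0)%R%:E =
   \int[P]_(w in good_event c) (ext0 (fun u => gamma_sf k ((thr * u + e) / thr))%R (load c w))%:E)%E.
Proof.
move=> e0; have [H [mH Hg HP Hfin]] := approx c.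
pose phi (u : R) := gamma_sf k ((thr * u + e) / thr).
have cphi : continuous phi.
  move=> u; apply: continuous_comp; last exact: continuous_gamma_sf.
  by apply: cvgM; [apply: cvgD; [apply: cvgM; [exact: cvg_cst|exact: cvg_id]|exact: cvg_cst]|exact: cvg_cst].
have mphi : measurable_fun setT phi by exact: continuous_measurable_fun.
have phi_y : phi x @[x --> +oo] --> (0 : R).
  apply: (cvg_comp (fun u : R => (thr * u + e) / thr) (gamma_sf k)); last exact: gamma_sf_cvgy.
  apply/cvgryPge => A; near=> u; rewrite mulrDl mulrAC divff ?gt_eqF// mul1r.
  by rewrite -lerBlDr; near: u; apply: nbhs_pinfty_ge; rewrite num_real.
have phi01 u : 0 <= u -> 0 <= phi u <= 1.
  by move=> u0; rewrite gamma_sf_ge0 ?gamma_sf_le1// divr_ge0 ?(ltW thr0)// addr_ge0// mulr_ge0// ltW.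
have ext01 u : (0 <= u)%E -> 0 <= ext0 phi u.
  by case: u => [r|//|//] /= r0; have /andP[] := phi01 r r0.
have mind : measurable_fun setT (fun w => (if (thr%:E * load c w + e%:E <= (G w)%:E)%E then 1 else 0) : R).
  apply: measurable_fun_if => //; apply: measurable_fun_lee => //; last exact/measurable_EFinP.
  by apply: emeasurable_funD => //; apply: measurable_funeM; exact: measurable_load.
have mindn n : measurable_fun setT (fun w => (if thr * sl c n w + e <= G w then 1 else 0) : R).
  apply: measurable_fun_if => //; apply: measurable_fun_ler => //.
  by apply: measurable_funD => //; exact: measurable_funM.
have mphin n : measurable_fun setT (fun w => phi (sl c n w)) by exact: measurableT_comp.
rewrite HP; last 2 first.
- exact/measurable_EFinP.
- by move=> w; rewrite lee_fin; case: ifP.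
rewrite HP; last 2 first.
- apply/measurable_EFinP; apply: (measurableT_comp _ (measurable_load c)).
  exact: measurable_ext0.
- by move=> w; rewrite lee_fin ext01// load_ge0.
have c1 : (\int[P]_(w in H) (if thr * sl c n w + e <= G w then 1 else 0)%R%:E)%E @[n --> \oo] -->
    (\int[P]_(w in H) (if (thr%:E * load c w + e%:E <= (G w)%:E)%E then 1 else 0)%R%:E)%E.
  apply: bounded_cvg_integral => //.
  - by move=> n; apply: measurable_funTS; exact: mindn.
  - by move=> n w _; case: ifP; rewrite ?normr1 ?normr0.
  - move=> w Hw; have fw := Hfin w Hw; case: ifPn => hG.
      apply: cvg_near_cst; apply: nearW => n; rewrite ifT// -lee_fin EFinD EFinM.
      apply: le_trans hG; rewrite leeD2r// lee_wpmul2l// ?lee_fin ?(ltW thr0)//.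
      exact: sl_le.
    have cv : (thr * sl c n w + e)%:E @[n --> \oo] --> (thr%:E * load c w + e%:E)%E.
      rewrite (_ : (fun n => _) = (fun n => thr%:E * (sl c n w)%:E + e%:E)%E); last first.
        by apply/funext => n; rewrite EFinD EFinM.
      apply: cvgeD; last exact: cvg_cst.
        apply: ge0_adde_def; rewrite inE ?lee_fin// mule_ge0// ?load_ge0//.
        by rewrite lee_fin ltW.
      by apply: cvgeZl => //; exact: sl_cvg.
    rewrite -ltNge in hG; apply: cvg_near_cst.
    have nb : nbhs (thr%:E * load c w + e%:E)%E [set y | ((G w)%:E < y)%E].
      by apply: open_nbhs_nbhs; split => //; exact: open_ereal_gt_ereal.
    have cvn : \forall n \near \oo, ((G w)%:E < (thr * sl c n w + e)%:E)%E := cv _ nb.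
    apply: filterS cvn => n; rewrite lte_fin => hn'.
    by rewrite leNgt hn'.
have c2 : (\int[P]_(w in H) (phi (sl c n w))%:E)%E @[n --> \oo] -->
    (\int[P]_(w in H) (ext0 phi (load c w))%:E)%E.
  apply: bounded_cvg_integral => //.
  - by move=> n; exact: measurable_funTS.
  - by move=> n w _; have /andP[? ?] := phi01 _ (sl_ge0 c n w); rewrite ger0_norm.
  - move=> w Hw; apply: (ext0_cvg cphi phi_y (load_ge0 c w)).
    by apply: sl_cvg; exact: Hfin.
have E : (fun n => \int[P]_(w in H) (if thr * sl c n w + e <= G w then 1 else 0)%R%:E)%E =
    (fun n => \int[P]_(w in H) (phi (sl c n w))%:E)%E.
  apply/funext => n; rewrite -HP; last 2 first.
  - by apply/measurable_EFinP; exact: mindn.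
  - by move=> w; rewrite lee_fin; case: ifP.
  rewrite -HP; last 2 first.
  - by apply/measurable_EFinP; exact: mphin.
  - by move=> w; have /andP[] := phi01 _ (sl_ge0 c n w); rewrite lee_fin.
  exact: sl_tail.
by rewrite E in c1; exact: (cvg_unique _ c1 c2).
Unshelve. all: by end_near. Qed.

(** * The strict coverage inequality, and finiteness of the load *)

Definition load_event c : set Omega :=
  good_event c `&` [set w | (thr%:E * load c w < (G w)%:E)%E].

Let mgood c : measurable (good_event c).
Proof. exact: measurable_good_event. Qed.

Let mload_lt c : measurable [set w | (thr%:E * load c w < (G w)%:E)%E].
Proof.
rewrite (_ : mkset _ = setT `&` (fun w => (thr%:E * load c w < (G w)%:E)%E) @^-1` [set true]).
  have mb : measurable_fun setT (fun w => (thr%:E * load c w < (G w)%:E)%E).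
    apply: measurable_fun_lte; last exact/measurable_EFinP.
    by apply: measurable_funeM; exact: measurable_load.
  exact: mb.
by rewrite setTI; apply/seteqP; split => w.
Qed.

Lemma measurable_load_event c : measurable (load_event c).
Proof. by apply: measurableI; [exact: mgood|exact: mload_lt]. Qed.

Let mext0_load c (phi : R -> R) : measurable_fun setT phi ->
  measurable_fun setT (fun w => ext0 phi (load c w)).
Proof.
by move=> mphi; apply: (measurableT_comp _ (measurable_load c)); exact: measurable_ext0.
Qed.

Let harmonic0 : (n.+1%:R^-1 : R) @[n --> \oo] --> (0 : R).
Proof. exact: cvg_harmonic. Qed.

Let harmonic_gt0 n : 0 < (n.+1%:R^-1 : R).
Proof. by rewrite invr_gt0 ltr0n. Qed.

Let gamma_shift_cvg (r : R) :
  gamma_sf k ((thr * r + n.+1%:R^-1) / thr) @[n --> \oo] --> gamma_sf k r.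
Proof.
have e : (thr * r + 0) / thr = r by rewrite addr0 mulrAC divff ?mul1r// gt_eqF.
have h : (thr * r + n.+1%:R^-1) / thr @[n --> \oo] --> (thr * r + 0) / thr.
  apply: cvgM; last exact: cvg_cst.
  by apply: cvgD; [exact: cvg_cst|exact: harmonic0].
by rewrite e in h; exact: (cvg_comp _ _ h (@continuous_gamma_sf R k r)).
Qed.

(** A strict inequality leaves room for the shift 1 / (n + 1) once n is large; where it fails, every
    shifted nonstrict one fails too. *)
Let shift_indicator_cvg (L : \bar R) (g : R) : (0 <= L)%E ->
  (if (thr%:E * L + (n.+1%:R^-1)%:E <= g%:E)%E then 1 else 0 : R) @[n --> \oo] -->
  (if (thr%:E * L < g%:E)%E then 1 else 0 : R).
Proof.
move=> L0; case: ifPn => h; apply: cvg_near_cst.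
  case: L L0 h => [r _|_|//]; last by rewrite gt0_muley ?lte_fin.
  rewrite -EFinM lte_fin -subr_gt0 => h.
  have ev : \forall n \near \oo, (n.+1%:R^-1 : R) < g - thr * r.
    exact: (cvgr_lt 0 harmonic0 _ h).
  apply: filterS ev => n nlt; rewrite ifT// -EFinD lee_fin.
  by rewrite addrC -lerBrDr ltW.
apply: nearW => n; rewrite ifF//; apply/negbTE; rewrite -ltNge.
case: L L0 h => [r _|_ _|//].
  rewrite -leNgt -EFinM -EFinD lee_fin lte_fin => h.
  by apply: (le_lt_trans h); rewrite ltrDl.
by rewrite gt0_muley ?lte_fin// addye// ltry.
Qed.

Lemma load_event_tail c : P (load_event c) =
  (\int[P]_(w in good_event c) (ext0 (gamma_sf k) (load c w))%:E)%E.
Proof.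
have c1 : (\int[P]_(w in good_event c)
      (if (thr%:E * load c w + (n.+1%:R^-1)%:E <= (G w)%:E)%E then 1 else 0)%R%:E)%E @[n --> \oo] -->
    (\int[P]_(w in good_event c) (if (thr%:E * load c w < (G w)%:E)%E then 1 else 0)%R%:E)%E.
  apply: bounded_cvg_integral; first exact: mgood.
  - move=> n; apply: measurable_funTS; apply: measurable_fun_if => //; apply: measurable_fun_lee.
      by apply: emeasurable_funD => //; apply: measurable_funeM; exact: measurable_load.
    exact/measurable_EFinP.
  - by move=> n w _; case: ifP; rewrite ?normr1 ?normr0.
  - by move=> w _; apply: shift_indicator_cvg; exact: load_ge0.
have c2 : (\int[P]_(w in good_event c)
      (ext0 (fun u => gamma_sf k ((thr * u + n.+1%:R^-1) / thr))%R (load c w))%:E)%E @[n --> \oo] -->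
    (\int[P]_(w in good_event c) (ext0 (gamma_sf k) (load c w))%:E)%E.
  apply: bounded_cvg_integral; first exact: mgood.
  - move=> n; apply: measurable_funTS; apply: mext0_load.
    apply: (@measurableT_comp _ _ _ _ _ _ (@gamma_sf R k)).
      by apply: continuous_measurable_fun; exact: continuous_gamma_sf.
    by apply: measurable_funM => //; apply: measurable_funD => //; exact: measurable_funM.
  - move=> n w _; have := load_ge0 c w; case: (load c w) => [r|_|//] /=; last by rewrite normr0.
    rewrite lee_fin => r0; have u0 : 0 <= (thr * r + n.+1%:R^-1) / thr.
      by apply: divr_ge0; [apply: addr_ge0; [apply: mulr_ge0 => //|]; exact: ltW|exact: ltW].
    by rewrite ger0_norm ?gamma_sf_ge0 ?gamma_sf_le1.
  - move=> w _; case: (load c w) => [r||] /=; [exact: gamma_shift_cvg|exact: cvg_cst|exact: cvg_cst].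
have E : (fun n => \int[P]_(w in good_event c)
      (if (thr%:E * load c w + (n.+1%:R^-1)%:E <= (G w)%:E)%E then 1 else 0)%R%:E)%E =
    (fun n => \int[P]_(w in good_event c)
      (ext0 (fun u => gamma_sf k ((thr * u + n.+1%:R^-1) / thr))%R (load c w))%:E)%E.
  by apply/funext => n; exact: (load_tail c (ltW (harmonic_gt0 n))).
rewrite E in c1; rewrite -(cvg_unique _ c1 c2)//.
rewrite /load_event setIC -integral_indic//.
apply: eq_integral => w _; rewrite indicE; congr EFin; case: ifPn => h; first by rewrite mem_set.
by rewrite memNset//; exact/negP.
Qed.

Let Fhyp_cvg1 D : 0 < D -> Fhyp alpha (D * n.+1%:R^-1) @[n --> \oo] --> (1 : R).
Proof.
move=> D0; have y0 n : 0 <= D * n.+1%:R^-1 by apply: mulr_ge0; exact: ltW.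
apply: (@squeeze_cvgr _ _ _ _ (cst 1) (fun n => 1 + D * n.+1%:R^-1 *
    (\int[mu]_(t in `[1%R, +oo[%classic) (2 * t / t `^ alpha))%R)).
- by apply: nearW => n; exact: Fhyp_le_linear.
- exact: cvg_cst.
- rewrite -[X in _ --> X]addr0; apply: cvgD; first exact: cvg_cst.
  rewrite -[X in _ --> X](mul0r (\int[mu]_(t in `[1%R, +oo[%classic) (2 * t / t `^ alpha))%R).
  apply: cvgM; last exact: cvg_cst.
  by rewrite -[X in _ --> X](mulr0 D); apply: cvgM; [exact: cvg_cst|exact: harmonic0].
Qed.

Let two_halves r : - (2^-1 * pi * lam * r ^+ 2) - 2^-1 * pi * lam * r ^+ 2 = - (pi * lam * r ^+ 2).
Proof.
have two : 2^-1 + 2^-1 = 1 :> R by rewrite [RHS](splitr 1) !div1r.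
by rewrite -opprD -!mulrDl two mul1r.
Qed.

Let Lambda_cvg c r : Lam c r n.+1%:R^-1 @[n --> \oo] --> - (pi * lam * r ^+ 2).
Proof.
rewrite -two_halves -[X in X - _]add0r -[X in _ --> _ - X]mulr1 -[X in _ --> 0 - X - _]mulr1.
apply: cvgB; last first.
  apply: cvgM; first exact: cvg_cst.
  by apply: Fhyp_cvg1; exact: interf_ratio_gt0.
apply: cvgB; last first.
  apply: cvgM; first exact: cvg_cst.
  by apply: Fhyp_cvg1; exact: interf_ratio_gt0.
rewrite -[X in _ --> X]oppr0 -(mulr0 (sc c r * n0sq)); apply: cvgN.
by apply: cvgM; [exact: cvg_cst|exact: harmonic0].
Qed.

Let Lambda_le c r x : 0 <= x -> Lam c r x <= - (pi * lam * r ^+ 2).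
Proof.
move=> x0; rewrite -two_halves.
have h0 : 0 <= 2^-1 * pi * lam * r ^+ 2.
  by apply: mulr_ge0; [apply: mulr_ge0; [apply: mulr_ge0; [|exact: pi_ge0]|exact: ltW]|exact: sqr_ge0].
have F1 psi : 1 <= Fhyp alpha (interf_ratio thr thI betaT a_c a_t tau c psi * x).
  by have /andP[] := Fhyp_le_linear alpha2 (mulr_ge0 (ltW (interf_ratio_gt0 thr0 thI0 bT tau0 act c psi)) x0).
apply: lerB; last by rewrite ler_peMr//; exact: (F1 false).
rewrite -[leRHS]add0r; apply: lerB; last by rewrite ler_peMr//; exact: (F1 true).
by rewrite oppr_le0; apply: mulr_ge0 => //; apply: mulr_ge0 => //; exact: snr_scale_ge0.
Qed.

Let pilam_ge0 (r : R) : 0 < r -> 0 <= pi * lam * r.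
Proof. by move=> r0; apply: mulr_ge0; [apply: mulr_ge0; [exact: pi_ge0|exact: ltW]|exact: ltW]. Qed.

Let indic_pos (r : R) : 0 < r -> \1_pos r = 1 :> R.
Proof. by move=> r0; rewrite indicE mem_set//= in_itv/= r0. Qed.

Let indic_npos (r : R) : r <= 0 -> \1_pos r = 0 :> R.
Proof. by move=> r0; rewrite indicE memNset//= in_itv/= andbT ltNge r0. Qed.

(** Let the Laplace argument decrease to 0. The expectation tends to the probability that the load
    is finite, while on the side of r the values of F tend to 1 and the density of [r1] on
    [good_event] is restored in full. *)
Lemma load_infinite_null c : P (good_event c `&` [set w | load c w = +oo%E]) = 0%E.
Proof.
pose Y := [set w | load c w = +oo%E].
have mY : measurable Y.
  rewrite (_ : Y = setT `&` load c @^-1` [set +oo%E]); last by rewrite setTI.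
  by apply: (measurable_load c) => //; exact: emeasurable_set1.
have c1 : (\int[P]_(w in good_event c)
      (ext0 (fun u => expR (- (n.+1%:R^-1 * u))) (load c w))%:E)%E @[n --> \oo] -->
    (\int[P]_(w in good_event c) (ext0 (cst 1) (load c w))%:E)%E.
  apply: bounded_cvg_integral; first exact: mgood.
  - move=> n; apply: measurable_funTS; apply: mext0_load; apply: measurableT_comp => //.
    by apply: measurableT_comp => //; exact: measurable_funM.
  - move=> n w _; have := load_ge0 c w; case: (load c w) => [r|_|//] /=; last by rewrite normr0.
    rewrite lee_fin => r0; rewrite ger0_norm ?expR_ge0// -expR0 ler_expR oppr_le0.
    by apply: mulr_ge0 => //; exact: ltW.
  - move=> w _; case: (load c w) => [r||] /=; [|exact: cvg_cst|exact: cvg_cst].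
    have h : - (n.+1%:R^-1 * r) @[n --> \oo] --> - (0 * r).
      by apply: cvgN; apply: cvgM; [exact: harmonic0|exact: cvg_cst].
    rewrite mul0r oppr0 in h; have := cvg_comp _ _ h (@continuous_expR R 0).
    by rewrite expR0.
have c2 : (\int[mu]_r (\1_pos r * (pi * lam * r * expR (Lam c r n.+1%:R^-1)))%:E)%E @[n --> \oo] -->
    (\int[mu]_r (half_density r)%:E)%E.
  apply: (@dominated_cvg _ _ _ mu setT measurableT _ _ (fun r => (half_density r)%:E)) => //.
  - move=> n; apply/measurable_EFinP; apply: measurable_funM; first exact: measurable_indic.
    apply: measurable_funM; first exact: measurable_funM.
    by apply: measurableT_comp => //; exact: measurable_Lambda.
  - move=> r _; apply: cvg_EFin; first exact: nearW.
    have [r0|r0] := ltP 0 r; last first.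
      rewrite half_density_npos//; under eq_fun do rewrite indic_npos// mul0r.
      exact: cvg_cst.
    rewrite half_density_pos//; under eq_fun do rewrite indic_pos// mul1r.
    apply: cvgM; first exact: cvg_cst.
    exact: (cvg_comp _ _ (@Lambda_cvg c r) (@continuous_expR R _)).
  - exact: integrable_half_density.
  - move=> n r _; rewrite abse_EFin lee_fin; have [r0|r0] := ltP 0 r; last first.
      by rewrite half_density_npos// indic_npos// mul0r normr0.
    rewrite half_density_pos// indic_pos// mul1r ger0_norm; last first.
      by apply: mulr_ge0; [exact: pilam_ge0|exact: expR_ge0].
    apply: ler_wpM2l; first exact: pilam_ge0.
    by rewrite ler_expR; apply: Lambda_le; exact: ltW.
have E : (fun n => \int[P]_(w in good_event c)
      (ext0 (fun u => expR (- (n.+1%:R^-1 * u))) (load c w))%:E)%E =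
    (fun n => \int[mu]_r (\1_pos r * (pi * lam * r * expR (Lam c r n.+1%:R^-1)))%:E)%E.
  by apply/funext => n; exact: (load_laplace c (harmonic_gt0 n)).
rewrite E in c1.
(* [ext0 (cst 1)] of the load is the indicator that the load is finite. *)
have PE : P (good_event c `\` Y) = P (good_event c).
  have -> : P (good_event c) = (\int[mu]_r (half_density r)%:E)%E by rewrite good_event_prob.
  rewrite -(cvg_unique _ c1 c2)// setDE setIC -integral_indic//; last exact: measurableC.
  apply: eq_integral => w _; rewrite indicE /ext0; have := load_ge0 c w.
  have [Yw|nY] := pselect (Y w).
    by rewrite memNset ?[load c w]Yw//; apply.
  by rewrite mem_set//; case El : (load c w) => [r||].
have finP : (P (good_event c) \is a fin_num)%E by exact: fin_num_measure.
have DI : P (good_event c) = (P (good_event c `\` Y) + P (good_event c `&` Y))%E by exact: measureDI.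
have cancel (p q : \bar R) : p \is a fin_num -> p = (p + q)%E -> q = 0%E.
  by case: p => // p; case: q => // q _ [] e; congr EFin; lra.
by apply: (cancel _ _ finP); rewrite [LHS]DI; congr (_ + _)%E; exact: PE.
Qed.

(** * Identification of the coefficients *)

Let cov c r m := coverage_term lam PB Cr thr thI dc n0sq alpha betaT a_c a_t tau c r m.

Let cov_ge0 c r m : 0 <= cov c r m.
Proof. exact: coverage_term_ge0. Qed.

Let mcov c m : measurable_fun setT (fun r : mR => \1_pos r * (pi * lam * r * cov c r m)).
Proof.
apply: measurable_funM; first exact: measurable_indic.
by apply: measurable_funM; [exact: measurable_funM|exact: measurable_coverage_term].
Qed.

Let cov_pos_ge0 c m (r : R) : 0 <= \1_pos r * (pi * lam * r * cov c r m).
Proof.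
have [r0|r0] := ltP 0 r; last by rewrite indic_npos// mul0r.
by rewrite indic_pos// mul1r; apply: mulr_ge0; [exact: pilam_ge0|exact: cov_ge0].
Qed.

Let mpois c m : measurable_fun setT (fun w => ext0 (pois_term m) (load c w)).
Proof.
by apply: mext0_load; apply: continuous_measurable_fun; exact: continuous_pois_term.
Qed.

Let pois_load_ge0 c m w : 0 <= ext0 (pois_term m) (load c w).
Proof.
by have := load_ge0 c w; case: (load c w) => [r|_|//] //=; rewrite lee_fin => /pois_term_ge0.
Qed.

(** Both sides are coefficients of one generating function S on [0, 1[, where the Laplace argument 1
    - z stays positive. S is finite because its integrand is at most 1 under a probability. *)
Lemma pois_coverage c m :
  (\int[P]_(w in good_event c) (ext0 (pois_term m) (load c w))%:E =
   \int[mu]_r (\1_pos r * (pi * lam * r * cov c r m))%:E)%E.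
Proof.
pose h z w : R := ext0 (fun u => expR (- ((1 - z) * u))) (load c w).
pose S z : R := fine (\int[P]_(w in good_event c) (h z w)%:E)%E.
have hS z : 0 <= z < 1 -> (\int[P]_(w in good_event c) (h z w)%:E = (S z)%:E)%E.
  case/andP=> z0 z1; rewrite fineK//.
  have h01 w : 0 <= h z w <= 1.
    rewrite /h; have := load_ge0 c w; case: (load c w) => [r|_|//] /=; last by rewrite lexx ler01.
    rewrite lee_fin expR_ge0/= => r0; rewrite -[leRHS]expR0 ler_expR oppr_le0.
    by apply: mulr_ge0 => //; rewrite subr_ge0 ltW.
  rewrite ge0_fin_numE; last by apply: integral_ge0 => w _; have /andP[] := h01 w; rewrite lee_fin.
  apply: le_lt_trans (_ : \int[P]_(w in good_event c) (cst 1 w)%E < +oo)%E; last first.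
    by rewrite integral_cst ?mul1e; [rewrite -ge0_fin_numE// fin_num_measure|exact: mgood].
  apply: ge0_le_integral => //.
  - by move=> w _; have /andP[] := h01 w; rewrite lee_fin.
  - apply/measurable_EFinP; apply: measurable_funTS; apply: mext0_load; apply: measurableT_comp => //.
    by apply: measurableT_comp => //; exact: measurable_funM.
  - by move=> w _; have /andP[] := h01 w; rewrite lee_fin.
have fh z w : 0 <= z < 1 -> good_event c w ->
    series (fun n => ext0 (pois_term n) (load c w) * z ^+ n) @ \oo --> h z w.
  move=> z01 _; rewrite /h; case: (load c w) => [r||] /=; first exact: pois_term_series.
    rewrite (_ : series _ = cst 0); first exact: cvg_cst.
    by apply/funext => n; rewrite /series/= big1// => i _; rewrite mul0r.
  rewrite (_ : series _ = cst 0); first exact: cvg_cst.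
  by apply/funext => n; rewrite /series/= big1// => i _; rewrite mul0r.
pose h' z r : R := \1_pos r * (pi * lam * r * expR (Lam c r (1 - z))).
have hS' z : 0 <= z < 1 -> (\int[mu]_r (h' z r)%:E = (S z)%:E)%E.
  move=> z01; rewrite -hS// /h /h' load_laplace// subr_gt0.
  by case/andP: z01.
have fh' z (r : mR) : 0 <= z < 1 -> setT r ->
    series (fun n => \1_pos r * (pi * lam * r * cov c r n) * z ^+ n) @ \oo --> h' z r.
  move=> z01 _; rewrite (_ : series _ = (fun n => \1_pos r * (pi * lam * r *
      series (fun n => cov c r n * z ^+ n) n))).
    apply: cvgM; first exact: cvg_cst.
    by apply: cvgM; [exact: cvg_cst|exact: coverage_term_series].
  by apply/funext => n; rewrite /series/= !mulr_sumr; apply: eq_bigr => i _; rewrite !mulrA.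
have mf n : measurable_fun (good_event c) (fun w => ext0 (pois_term n) (load c w)).
  by apply: measurable_funTS; exact: mpois.
have f0 n w : good_event c w -> 0 <= ext0 (pois_term n) (load c w) by move=> _; exact: pois_load_ge0.
have f0' n (r : mR) : setT r -> 0 <= \1_pos r * (pi * lam * r * cov c r n).
  by move=> _; exact: cov_pos_ge0.
have fin1 := integral_coef_fin_num (mgood c) mf f0 fh hS m.
have fin2 := integral_coef_fin_num measurableT (mcov c) f0' fh' hS' m.
rewrite -(fineK fin1) -(fineK fin2); congr EFin.
apply: (psum_coef_inj (a := fun n => fine (\int[P]_(w in good_event c) (ext0 (pois_term n) (load c w))%:E)%E)
  (b := fun n => fine (\int[mu]_r (\1_pos r * (pi * lam * r * cov c r n))%:E)%E) (S := S)).
- by move=> n; apply: fine_ge0; apply: integral_ge0 => w gw; rewrite lee_fin; exact: f0.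
- by move=> n; apply: fine_ge0; apply: integral_ge0 => r _; rewrite lee_fin; exact: cov_pos_ge0.
- by move=> z z01; exact: (integral_coef_series (mgood c) mf f0 fh hS).
- by move=> z z01; exact: (integral_coef_series measurableT (mcov c) f0' fh' hS').
Qed.

Lemma load_event_prob c : P (load_event c) =
  (\int[mu]_(r in `[0%R, +oo[%classic) (pi * lam * r * \sum_(m < k) cov c r m)%:E)%E.
Proof.
rewrite load_event_tail.
transitivity (\int[P]_(w in good_event c) \sum_(m < k) (ext0 (pois_term m) (load c w))%:E)%E.
  apply: eq_integral => w _; rewrite sumEFin; congr EFin.
  by case: (load c w) => [r||] //=; rewrite big1.
rewrite ge0_integral_sum; [|exact: mgood| |]; last 2 first.
- by move=> m; apply/measurable_EFinP; apply: measurable_funTS; exact: mpois.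
- by move=> m w _; rewrite lee_fin pois_load_ge0.
under eq_bigr do rewrite pois_coverage.
rewrite -ge0_integral_sum//; last 2 first.
- by move=> m; apply/measurable_EFinP; exact: mcov.
- by move=> m r _; rewrite lee_fin cov_pos_ge0.
rewrite [RHS]integral_mkcond; apply: eq_integral => r _; rewrite sumEFin patchE mem_setE in_itv/= andbT.
rewrite -mulr_sumr -mulr_sumr; have [r0|r0] := ltP 0 r.
  by rewrite indic_pos// (ltW r0) mul1r.
(* The closed half-line of the statement adds the point 0 to [pos]; the factor r makes the integrand
   vanish there. *)
rewrite indic_npos// mul0r; case: ifP => // r0'.
have -> : r = 0 by apply/eqP; rewrite eq_le r0.
by rewrite mulr0 mul0r.
Qed.

(** * From the signal-to-interference ratio to the load *)

Let null_family (A C : set mR) c : measurable A -> measurable C ->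
  P [set w | chi w = c /\ (A (r1 w) /\ C (G w))] =
  ((2^-1)%:E * (\int[mu]_(y in C) (gamma_pdf k thr y)%:E) * \int[mu]_(r in A) (r1_pdf lam r)%:E)%E.
Proof.
move=> mA mC.
have Z0 (i : 'I_0) : measurable ((fun=> set0) i : set ((R * R) * R)) /\
    bounded_ground ((fun=> set0) i : set ((R * R) * R)) by case: i.
have Z1 (i j : 'I_0) : i != j -> (fun=> set0 : set ((R * R) * R)) i `&` (fun=> set0) j = set0 by case: i.
have := @law A C c 0 0 _ (fun=> 0%N) _ (fun=> 0%N) mA mC Z0 Z1 Z0 Z1.
rewrite (_ : mkset _ = [set w | chi w = c /\ (A (r1 w) /\ C (G w))]); last first.
  apply/seteqP; split => w /=; first by move=> [? [? [? _]]].
  by move=> [? [? ?]]; split => //; split => //; split => //; split => -[].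
move=> ->; congr (_ * _)%E; apply: eq_integral => r _.
by rewrite !big_ord0 !mulr1.
Qed.

Let null_G c : P [set w | chi w = c /\ G w < 0] = 0%E.
Proof.
have mC : measurable (`]-oo, 0%R[%classic : set mR) by exact: (@measurable_itv R).
rewrite (_ : mkset _ = [set w | chi w = c /\ (setT (r1 w) /\ `]-oo, 0%R[%classic (G w))]); last first.
  apply/seteqP; split => w /=; rewrite in_itv/=; first by move=> [? ?].
  by move=> [? [_ ?]].
rewrite null_family// [X in (_ * X * _)%E]integral0_eq ?mule0 ?mul0e// => y /=.
by rewrite in_itv/= /gamma_pdf leNgt => ->.
Qed.

Let null_r1 c : P [set w | chi w = c /\ r1 w <= 0] = 0%E.
Proof.
have mA : measurable (`]-oo, 0%R]%classic : set mR) by exact: (@measurable_itv R).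
rewrite (_ : mkset _ = [set w | chi w = c /\ (`]-oo, 0%R]%classic (r1 w) /\ setT (G w))]); last first.
  apply/seteqP; split => w /=; rewrite in_itv/=; first by move=> [? ?].
  by move=> [? [? _]].
rewrite null_family// [X in (_ * X)%E]integral0_eq ?mule0// => r /=.
rewrite in_itv/= /r1_pdf => r0; case: ifP => // r0'.
have -> : r = 0 by apply/eqP; rewrite eq_le r0.
by rewrite mulr0 mul0r.
Qed.

(** The integrand of the statement, with the raw mark; it differs from b times the path gain only at
    negative marks. *)
Let signal_gain (b : R) (p : (R * R) * R) : R := b * (norm2 p.1 * dc) `^ (- alpha) * p.2.

Let measurable_signal_gain b : measurable_fun setT (fun p : (R * R) * R => signal_gain b p).
Proof.
have h : measurable_fun setT (fun p : (mR * mR) * mR => signal_gain b p).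
  apply: measurable_funM; last by apply: (measurableT_comp mid); exact: measurable_snd.
  apply: measurable_funM => //; apply: measurable_funpowR; apply: measurable_funM => //.
  by apply: (measurableT_comp (@measurable_norm2 R)); exact: measurable_fst.
exact: h.
Qed.

Let signal_integral (M : {measure set ((R * R) * R) -> \bar R}) b : 0 <= b ->
  M [set p | p.2 < 0] = 0%E ->
  (\int[M]_p (signal_gain b p)%:E = b%:E * \int[M]_p (path_gain dc alpha p)%:E)%E.
Proof.
move=> b0 M0.
have mg : measurable_fun setT (fun p : (R * R) * R => (path_gain dc alpha p)%:E).
  by apply/measurable_EFinP; exact: measurable_path_gain.
rewrite -ge0_integralZl_EFin//.
apply: ae_eq_integral => //.
- by apply/measurable_EFinP; exact: measurable_signal_gain.
- exact: measurable_funeM.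
- exists [set p | p.2 < 0]; split => // p /=; apply: contra_notP => /negP.
  rewrite -leNgt => p0 _; rewrite /signal_gain /path_gain -EFinM max_l// mulrA.
  by [].
Qed.

(** The raw integrand is signed, so the family lemma is applied to its positive and negative
    parts. *)
Let measurable_signal_integral (M : Omega -> {measure set ((R * R) * R) -> \bar R}) b :
  (forall B, measurable B -> measurable_fun [set: Omega] (fun w => M w B : \bar R)) ->
  measurable_fun setT (fun w => \int[M w]_p (signal_gain b p)%:E)%E.
Proof.
move=> mM; have ms : measurable_fun setT (fun p : (R * R) * R => (signal_gain b p)%:E).
  by apply/measurable_EFinP; exact: measurable_signal_gain.
under eq_fun do rewrite integralE.
apply: emeasurable_funB; apply: measurable_integral_family => //.
  exact: measurable_funepos.
exact: measurable_funeneg.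
Qed.

Hypothesis at0 : 0 < a_t.

(** Clearing the denominator turns the inequality into tau (J + n0sq) < (a_c - a_t tau) S; the
    hypothesis on tau makes the last coefficient positive, and dividing by it gives a lower bound on
    the fading g. *)
Let sinr_threshold c r J g : 0 < r -> 0 <= J -> 0 <= g ->
  let S := beta_of betaT c * PB * Cr * (r * dc) `^ (- alpha) * g in
  (tau < a_c * S / (a_t * S + J + n0sq)) = (thr * (sc c r * (J + n0sq)) < g).
Proof.
move=> r0 J0 g0 S.
have q0 : 0 < a_c - a_t * tau by rewrite subr_gt0.
have b0 := beta_of_gt0 bT c.
have p0 : 0 < (r * dc) `^ alpha by rewrite powR_gt0// mulr_gt0.
have K0 : 0 < beta_of betaT c * PB * Cr * (r * dc) `^ (- alpha).
  by rewrite powRN mulr_gt0 ?invr_gt0// mulr_gt0// mulr_gt0.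
have Jn : 0 <= J + n0sq by rewrite addr_ge0.
have E : thr * (sc c r * (J + n0sq)) =
    tau * (J + n0sq) / ((a_c - a_t * tau) * (beta_of betaT c * PB * Cr * (r * dc) `^ (- alpha))).
  by rewrite /snr_scale powRN; field; rewrite !gt_eqF.
(* For g = 0 the denominator may vanish, but S = 0 makes the ratio 0 in any case and both
   inequalities fail. *)
move: g0; rewrite le_eqVlt => /predU1P[g0|g0].
  rewrite /S -g0 !mulr0 mul0r ltNge (ltW tau0)/=; apply/esym/negbTE; rewrite -leNgt.
  by apply: mulr_ge0; [exact: ltW|apply: mulr_ge0 => //; exact: snr_scale_ge0].
have S0 : 0 < S by rewrite mulr_gt0.
have den0 : 0 < a_t * S + J + n0sq by rewrite -addrA ltr_wpDr// mulr_gt0.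
rewrite E ltr_pdivlMr// ltr_pdivrMr ?(mulr_gt0 q0 K0)//.
rewrite -subr_gt0 -[RHS]subr_gt0; congr (0 < _).
by rewrite /S; ring.
Qed.

Let interference_signal w : R :=
  fine ((\int[NT w]_p (signal_gain ((1 - betaT) * PB * Cr) p)%:E) +
        (\int[NR w]_p (signal_gain (betaT * PB * Cr) p)%:E))%E.

Let sinr w : R :=
  let S := beta_of betaT (chi w) * PB * Cr * (r1 w * dc) `^ (- alpha) * G w in
  a_c * S / (a_t * S + interference_signal w + n0sq).

Let mchib : measurable_fun setT chi.
Proof.
apply: (measurable_fun_bool true).
by rewrite setTI; exact: (mchiE true).
Qed.

Let measurable_covered : measurable [set w | tau < sinr w].
Proof.
have mI : measurable_fun setT interference_signal.
  apply: (@measurableT_comp _ _ _ _ _ _ (@fine R)) => //.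
  by apply: emeasurable_funD; exact: measurable_signal_integral.
have mS : measurable_fun setT (fun w => beta_of betaT (chi w) * PB * Cr * (r1 w * dc) `^ (- alpha) * G w).
  apply: measurable_funM => //; apply: measurable_funM; last first.
    by apply: measurable_funpowR; exact: measurable_funM.
  apply: measurable_funM => //; apply: measurable_funM => //.
  by apply: measurable_fun_if.
have ms : measurable_fun setT sinr.
  apply: measurable_funM; first exact: measurable_funM.
  have md : measurable_fun setT (fun w => a_t * (beta_of betaT (chi w) * PB * Cr *
      (r1 w * dc) `^ (- alpha) * G w) + interference_signal w + n0sq).
    by apply: measurable_funD => //; apply: measurable_funD => //; exact: measurable_funM.
  (* The denominator has no sign a priori, so its inverse is rewritten with the inverse of a square;
     the identity also holds at 0. *)
  have inv_sq (x : R) : x^-1 = x * (x ^+ 2)^-1.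
    have [->|x0] := eqVneq x 0; first by rewrite mul0r invr0.
    by rewrite expr2 invfM mulrA divff// mul1r.
  under eq_fun do rewrite inv_sq.
  apply: measurable_funM => //; apply: measurable_funV_ge0; first by move=> w; exact: sqr_ge0.
  exact: measurable_funX.
rewrite (_ : mkset _ = setT `&` sinr @^-1` `]tau, +oo[%classic).
  by apply: ms => //; exact: measurable_itv.
by rewrite setTI; apply/seteqP; split => w; rewrite /= in_itv/= andbT.
Qed.

(** The two events coincide off three null events: points with negative marks, an infinite load, and
    a negative fading. *)
Lemma covered_load_event c : P ([set w | tau < sinr w] `&` good_event c) = P (load_event c).
Proof.
have [Z [mZ Z0 ZP]] := marks_nonneg c.
pose Y := good_event c `&` [set w | load c w = +oo%E].
pose Ng := [set w | chi w = c /\ G w < 0].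
have mY : measurable Y.
  apply: measurableI; first exact: mgood.
  rewrite (_ : mkset _ = setT `&` load c @^-1` [set +oo%E]); last by rewrite setTI.
  by apply: (measurable_load c) => //; exact: emeasurable_set1.
have mNg : measurable Ng.
  apply: measurableI; first exact: mchiE.
  rewrite [X in measurable X](_ : _ = setT `&` G @^-1` `]-oo, 0%R[%classic).
    by apply: mG => //; exact: measurable_itv.
  by rewrite setTI; apply/seteqP; split => w; rewrite /= in_itv.
apply: (@measure_eq_off_null _ _ _ _ _ _ (Z `|` (Y `|` Ng))).
- by apply: measurableI; [exact: measurable_covered|exact: mgood].
- exact: measurable_load_event.
- by apply: measurableU => //; exact: measurableU.
- have YN0 : P (Y `|` Ng) = 0%E.
    by apply: null_set_setU => //; [exact: load_infinite_null|exact: null_G].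
  by apply: null_set_setU => //; exact: measurableU.
move=> w nN; have nZ : ~ Z w by move=> h; apply: nN; left.
have nY : ~ Y w by move=> h; apply: nN; right; left.
have nG : ~ Ng w by move=> h; apply: nN; right; right.
suff key : good_event c w -> (tau < sinr w) = (thr%:E * load c w < (G w)%:E)%E.
  by split=> -[]; [move=> h gw; split => //=; rewrite -key|move=> gw h; split => //=; rewrite key].
move=> gw; have [cw r0] := gw; have [mT mR'] := ZP w gw nZ.
have G0 : 0 <= G w by rewrite leNgt; apply/negP => g0; apply: nG.
have sc0 : 0 < sc c (r1 w).
  have b0 := beta_of_gt0 bT c; have t0 : 0 < tau / (a_c - a_t * tau) by exact: taus_gt0.
  apply: mulr_gt0; first by apply: (mulr_gt0 t0); rewrite powR_gt0// mulr_gt0.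
  by rewrite invr_gt0 !mulr_gt0.
(* As the scale [sc] is positive, a finite load forces a finite interference, so [fine] loses
   nothing in the ratio. *)
have bnd : (interference w \is a fin_num)%E.
  rewrite ge0_fin_numE ?interference_ge0// ltey; apply/eqP => Iy; apply: nY; split => //=.
  by rewrite /load Iy addye// gt0_muley// lte_fin.
have IE : interference_signal w = fine (interference w).
  by rewrite /interference_signal !signal_integral.
have lE : load c w = (sc c (r1 w) * (fine (interference w) + n0sq))%:E.
  by rewrite /load -{1}(fineK bnd).
rewrite lE -EFinM lte_fin -sinr_threshold//; last by rewrite fine_ge0// interference_ge0.
by rewrite /sinr IE cw.
Qed.

(** The two modes partition the sample space, and on each of them the distances r1 <= 0 form a null
    event. *)
Lemma coverage_probability : P [set w | tau < sinr w] =
  (\sum_(c : bool) \int[mu]_(r in `[0%R, +oo[%classic)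
     (pi * lam * r * \sum_(m < k) cov c r m)%:E)%E.
Proof.
pose A := [set w | tau < sinr w].
have mAc c : measurable (A `&` good_event c).
  by apply: measurableI; [exact: measurable_covered|exact: mgood].
pose N c := [set w | chi w = c /\ r1 w <= 0].
have mN c : measurable (N c).
  apply: measurableI; first exact: mchiE.
  rewrite [X in measurable X](_ : _ = setT `&` r1 @^-1` `]-oo, 0%R]%classic).
    by apply: mr1 => //; exact: measurable_itv.
  by rewrite setTI; apply/seteqP; split => w; rewrite /= in_itv.
rewrite (@measure_eq_off_null _ _ _ _ _ ((A `&` good_event true) `|` (A `&` good_event false))
   (N true `|` N false)).
- rewrite measureU//; last first.
    by apply/seteqP; split => // w [[_ [h1 _]] [_ [h2 _]]]; rewrite h1 in h2.
  have E c : P (A `&` good_event c) = (\int[mu]_(r in `[0%R, +oo[%classic)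
      (pi * lam * r * \sum_(m < k) cov c r m)%:E)%E.
    exact: (etrans (covered_load_event c) (load_event_prob c)).
  by rewrite big_bool/=; congr (_ + _)%E; [exact: (E true)|exact: (E false)].
- exact: measurable_covered.
- exact: measurableU.
- exact: measurableU.
- by apply: null_set_setU => //; exact: null_r1.
- move=> w nN; split => [Aw|[] []//]; case E : (chi w); [left|right]; split => //; split => //;
  rewrite ltNge; apply/negP => r0; apply: nN; [left|right]; by [].
Qed.

End StarModel.

Unset Implicit Arguments.

Theorem theorem2 (R : realType)
  (lam PB Cr thr thI dc n0sq alpha betaT a_c a_t tau : R) (k : nat)
  (d : measure_display) (Omega : measurableType d) (P : probability Omega R)
  (r1 : Omega -> R) (chi : Omega -> bool) (G : Omega -> R)
  (NT NR : Omega -> {measure set ((R * R) * R) -> \bar R}) :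
  (* constants *)
  0 < lam -> 0 < PB -> 0 < Cr -> 0 < thr -> 0 < thI -> 0 < dc ->
  0 <= n0sq -> 2 < alpha -> (1 <= k)%N -> 0 < betaT < 1 ->
  0 < a_t -> a_t < a_c -> a_t + a_c = 1 -> 0 < tau ->
  (* hypothesis of the theorem *)
  a_c > a_t * tau ->
  (* measurability of the random elements *)
  measurable_fun setT r1 -> measurable_fun setT G ->
  measurable [set w | chi w] ->
  (forall B, measurable B -> measurable_fun [set: Omega] (fun w => NT w B : \bar R)) ->
  (forall B, measurable B -> measurable_fun [set: Omega] (fun w => NR w B : \bar R)) ->
  (* joint law: r1 has density r1_pdf, chi uniform on {T,R}, G ~ Gamma(k,thr),
     mutually independent, and conditionally on r1, NT and NR are independent
     Poisson processes on {||y|| > r1} x R with intensity (lam/2) dy x Exp(thI)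
     (i.e. PPPs of intensity lam/2 with i.i.d. exponential marks of mean thI) *)
  (forall (A C : set R) (c : bool)
          (n n' : nat) (B : 'I_n -> set ((R * R) * R)) (kk : 'I_n -> nat)
          (B' : 'I_n' -> set ((R * R) * R)) (kk' : 'I_n' -> nat),
      measurable A -> measurable C ->
      (forall i, measurable (B i) /\ bounded_ground (B i)) ->
      (forall i j, i != j -> B i `&` B j = set0) ->
      (forall i, measurable (B' i) /\ bounded_ground (B' i)) ->
      (forall i j, i != j -> B' i `&` B' j = set0) ->
      P [set w | A (r1 w) /\ chi w = c /\ C (G w) /\
                 (forall i, NT w (B i) = ((kk i)%:R)%:E) /\
                 (forall j, NR w (B' j) = ((kk' j)%:R)%:E)]
      = ((2^-1)%:E
         * (\int[@lebesgue_measure R]_(y in C) (gamma_pdf k thr y)%:E)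
         * \int[@lebesgue_measure R]_(r in A)
              (r1_pdf lam r
               * (\prod_(i < n) pois_pmf (fine (ppp_mean lam thI r (B i))) (kk i))
               * (\prod_(j < n') pois_pmf (fine (ppp_mean lam thI r (B' j))) (kk' j)))%:E)%E) ->
  let S w := beta_of betaT (chi w) * PB * Cr * (r1 w * dc) `^ (- alpha) * G w in
  let I w := fine ((\int[NT w]_p
                     ((1 - betaT) * PB * Cr * (norm2 p.1 * dc) `^ (- alpha) * p.2)%:E)
                   + (\int[NR w]_p
                     (betaT * PB * Cr * (norm2 p.1 * dc) `^ (- alpha) * p.2)%:E))%E in
  let gamma_c w := a_c * S w / (a_t * S w + I w + n0sq) in
  let Lam c r := Lambda lam PB Cr thr thI dc n0sq alpha betaT a_c a_t tau c r in
  P [set w | tau < gamma_c w]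
  = (\sum_(c : bool)
       \int[@lebesgue_measure R]_(r in `[0%R, +oo[%classic)
         (pi * lam * r *
          \sum_(m < k) ((-1) ^+ m / m`!%:R * expR (Lam c r 1)
                        * bell (fun i => derive1n i (Lam c r) 1) m))%:E)%E.
Proof.
move=> lam0 PB0 Cr0 thr0 thI0 dc0 n00 alpha2 k1 bT at0 _ _ tau0 act mr1 mG mchi mNT mNR law.
exact: (coverage_probability lam0 PB0 Cr0 thr0 thI0 dc0 n00 alpha2 k1 bT tau0 act mr1 mG mchi mNT mNR law at0).
Qed.
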